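(* Let $n\in\mathbb{N}$, $T>0$, $H\in(0,1)$, and let $B^H=(B^H_t)_{t\in[0,T]}$ be a fractional Brownian motion on $\mathbb{R}^n$ with Hurst index $H$, defined on a probability space $(\Omega,\mathcal{F},\mathbb{P})$. Let $\nu_T$ be its occupation measure up to time $T$, i.e. the random measure $\nu_T(A)=\int_0^T\mathbf{1}_A(B^H_s)\,ds$ for Borel sets $A\subset\mathbb{R}^n$. Assume that $Hn<1$. Then there exists a random field $L_T\in L^2(\Omega;L^2(\mathbb{R}^n))$ such that $$\nu_T(dx)=L_T(x)\,dx\quad\text{almost surely},$$ and $$\lim_{\alpha\to0^+}\alpha\|\nu_T\|_{W^{-\alpha,2}}^2=\|L_T\|_{L^2(\mathbb{R}^n)}^2\quad\text{almost surely}.$$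
   Context: Fractional Brownian motion on $\mathbb{R}^n$ with Hurst index $H\in(0,1)$ is a centered continuous-time $\mathbb{R}^n$-valued Gaussian process with covariance matrix $\mathrm{Cov}(B^H_t,B^H_s)=\frac12\left(s^{2H}+t^{2H}-|t-s|^{2H}\right)I_n$ for $s,t\in[0,T]$, where $I_n$ is the $n\times n$ identity matrix. The map $(\omega,s)\mapsto B^H_s(\omega)$ is taken to be jointly measurable, so that $\nu_T$ is well defined. $L^2(\Omega;L^2(\mathbb{R}^n))$ is the Lebesgue--Bochner space of strongly measurable functions $F:\Omega\to L^2(\mathbb{R}^n)$ with $\mathbb{E}\|F\|_{L^2(\mathbb{R}^n)}^2<\infty$. $\|\cdot\|$ is the Euclidean norm on $\mathbb{R}^n$. For $\alpha\in(0,1)$, $W^{\alpha,2}(\mathbb{R}^n)$ is the fractional Sobolev space of all $g\in L^2(\mathbb{R}^n)$ with $\int_{\mathbb{R}^n}\int_{\mathbb{R}^n}\frac{|g(x)-g(y)|^2}{\|x-y\|^{n+2\alpha}}\,dx\,dy<\infty$, and $W^{-\alpha,2}(\mathbb{R}^n)$ is its dual space, whose elements are regarded as tempered distributions (Schwartz functions being dense in $W^{\alpha,2}(\mathbb{R}^n)$). For $t>0$ the heat kernel is $\Phi_t(x)=(4\pi t)^{-n/2}\exp\left(-\frac{\|x\|^2}{4t}\right)$, $x\in\mathbb{R}^n$, and for $\alpha\in(0,1)$ the space $W^{-\alpha,2}(\mathbb{R}^n)$ is equipped with the (equivalent) norm $$\|f\|_{W^{-\alpha,2}}=\left(\int_0^1\left(t^{\alpha/2}\|f\ast\Phi_t\|_{L^2}\right)^2\frac{dt}{t}\right)^{1/2},$$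 where $\ast$ denotes convolution. Convention: $\|f\|_{W^{-\alpha,2}}=+\infty$ if $f\notin W^{-\alpha,2}(\mathbb{R}^n)$. The finite measure $\nu_T$ is regarded as a tempered distribution. *)

(* Defs.v *)
From HB Require Import structures.
From mathcomp Require Import all_boot all_order all_algebra.
From mathcomp Require Import all_classical all_reals all_analysis.

Set Implicit Arguments.
Unset Strict Implicit.
Unset Printing Implicit Defensive.
Import Order.TTheory GRing.Theory Num.Theory.
Import numFieldNormedType.Exports.

Local Open Scope classical_set_scope.
Local Open Scope ring_scope.

(* R^n is 'rV[R]_n. Its sigma-algebra is the product one, generated by the
   coordinates, i.e. the Borel sets. *)

Section rV_measurable.
Context {R : realType} (n : nat).

Let coor : 'I_n -> 'rV[R]_n -> measurableTypeR R := fun i x => x ord0 i.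

Let rV_set0 : g_sigma_preimage coor set0.
Proof. exact: sigma_algebra0. Qed.

Let rV_setC A : g_sigma_preimage coor A -> g_sigma_preimage coor (~` A).
Proof. exact: sigma_algebraC. Qed.

Let rV_bigcup (F : _^nat) : (forall i, g_sigma_preimage coor (F i)) ->
  g_sigma_preimage coor (\bigcup_i (F i)).
Proof. exact: sigma_algebra_bigcup. Qed.

HB.instance Definition _ :=
  @isMeasurable.Build (measure_tuple_display default_measure_display)
    'rV[R]_n (g_sigma_preimage coor) rV_set0 rV_setC rV_bigcup.

Lemma measurable_coord (i : 'I_n) :
  measurable_fun [set: 'rV[R]_n] (fun x => x ord0 i : measurableTypeR R).
Proof.
move=> _ Y mY; rewrite setTI; apply: sub_sigma_algebra => /=.
rewrite -bigcup_seq/=; exists i => /=; first by rewrite mem_index_enum.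
by exists Y => //; rewrite setTI.
Qed.

Lemma measurable_fun_coordP d (T : measurableType d) (f : T -> 'rV[R]_n) :
  measurable_fun setT f <->
  forall i, measurable_fun setT (fun x => f x ord0 i : measurableTypeR R).
Proof.
split=> [mf i|mf].
  exact: (measurableT_comp (measurable_coord i) mf).
apply: measurability => //= _ [B + <-].
rewrite -bigcup_seq => -[i _ [C mC <-]]; rewrite !setTI.
by rewrite -[X in measurable X]setTI; exact: (mf i).
Qed.

End rV_measurable.

Section rVcons.
Context {R : realType} (n : nat).

Definition rVcons (p : measurableTypeR R * 'rV[R]_n) : 'rV[R]_n.+1 :=
  \row_i (if unlift ord0 i is Some j then p.2 ord0 j else p.1).

Definition rVuncons (x : 'rV[R]_n.+1) : measurableTypeR R * 'rV[R]_n :=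
  (x ord0 ord0, \row_j x ord0 (lift ord0 j)).

Lemma rVconsK : cancel rVcons rVuncons.
Proof.
move=> [t x]; rewrite /rVuncons mxE unlift_none; congr pair.
by apply/rowP => j; rewrite !mxE liftK.
Qed.

Lemma measurable_rVcons : measurable_fun setT rVcons.
Proof.
apply/measurable_fun_coordP => i.
have [j ->|->] := unliftP ord0 i.
- rewrite [X in measurable_fun _ X](_ : _ = fun p : measurableTypeR R * 'rV[R]_n => p.2 ord0 j); last first.
    by apply/funext => p; rewrite mxE liftK.
  exact: (measurableT_comp (measurable_coord j) measurable_snd).
- rewrite [X in measurable_fun _ X](_ : _ = fst); first exact: measurable_fst.
  by apply/funext => p; rewrite mxE unlift_none.
Qed.

Lemma measurable_rVuncons : measurable_fun setT rVuncons.
Proof.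
apply/measurable_fun_pairP; split; first exact: (measurable_coord ord0).
apply/measurable_fun_coordP => j.
rewrite [X in measurable_fun _ X](_ : _ = fun x : 'rV[R]_n.+1 => x ord0 (lift ord0 j)).
  exact: measurable_coord.
by apply/funext => x; rewrite /= mxE.
Qed.

Variable m : {sigma_finite_measure set 'rV[R]_n -> \bar R}.

(* The Lebesgue measure on R^n.+1 is the image of the product of those on R and
   R^n under the identification of R * R^n with R^n.+1. *)
Definition lebesgue_rVS : set 'rV[R]_n.+1 -> \bar R :=
  pushforward (@lebesgue_measure R \x m)%E rVcons.


HB.instance Definition _ := Measure.copy lebesgue_rVS
  (measure_function_pushforward__canonical__measure_function_Measure
    (@lebesgue_measure R \x m)%E measurable_rVcons).

Let lebesgue_rVS_sigma_finite : sigma_finite setT lebesgue_rVS.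
Proof.
have /sigma_finiteP[F [TF ndF Foo]] := sigma_finiteT (@lebesgue_measure R).
have /sigma_finiteP[G [TG ndG Goo]] := sigma_finiteT m.
exists (fun k => rVuncons @^-1` (F k `*` G k)).
  apply/esym; rewrite -subTset => x _.
  have [i _ Fi] : (\bigcup_i F i) (rVuncons x).1 by rewrite -TF.
  have [j _ Gj] : (\bigcup_i G i) (rVuncons x).2 by rewrite -TG.
  exists (maxn i j) => //; split.
  - exact: (subsetPset _ _ (ndF _ _ (leq_maxl i j))).
  - exact: (subsetPset _ _ (ndG _ _ (leq_maxr i j))).
move=> k; have [mF Fkoo] := Foo k; have [mG Gkoo] := Goo k; split.
  by rewrite -[X in measurable X]setTI; apply: measurable_rVuncons => //;
    exact: measurableX.
rewrite /lebesgue_rVS /pushforward -comp_preimage.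
rewrite (_ : rVuncons \o rVcons = id); last exact/funext/rVconsK.
by rewrite [ltLHS]product_measure1E// lte_mul_pinfty// ge0_fin_numE.
Qed.

HB.instance Definition _ := Measure_isSigmaFinite.Build _ _ _ lebesgue_rVS
  lebesgue_rVS_sigma_finite.

End rVcons.

Fixpoint lebesgue_rV (R : realType) (n : nat) :
    {sigma_finite_measure set 'rV[R]_n -> \bar R} :=
  if n is n'.+1 then lebesgue_rVS (lebesgue_rV R n') else \d_(0 : 'rV[R]_0).

Section real_analysis.
Context {R : realType} (n : nat).
Implicit Types (x y : 'rV[R]_n) (f g h : 'rV[R]_n -> R) (alpha t : R).

Notation mu := (lebesgue_rV R n).

(* The canonical norm `|x| of 'rV[R]_n is the sup norm, not this one. *)
Definition euclid_norm x : R := Num.sqrt (\sum_(i < n) x ord0 i ^+ 2).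

(* Iterated partial derivative along the coordinates listed in s. *)
Definition pderiv (s : seq 'I_n) f : 'rV[R]_n -> R :=
  foldr (fun i g x => 'D_(delta_mx ord0 i) g x) f s.

Definition smooth f : Prop := forall s : seq 'I_n,
  continuous (pderiv s f) /\
  forall (i : 'I_n) x, derivable (pderiv s f) x (delta_mx ord0 i).

Definition schwartz f : Prop := smooth f /\
  forall (k : nat) (s : seq 'I_n), exists C : R,
    forall x, euclid_norm x ^+ k * `|pderiv s f x| <= C.

Definition heat_kernel t x : R :=
  (4 * pi * t) `^ (- (n%:R / 2)) * expR (- (euclid_norm x ^+ 2 / (4 * t))).

Local Open Scope ereal_scope.

Definition gagliardo alpha g : \bar R :=
  \int[mu]_x \int[mu]_y
    (`|g x - g y| ^+ 2 / euclid_norm (x - y) `^ (n%:R + 2 * alpha))%R%:E.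

(* W^{alpha,2}, as a set of representatives modulo a.e. equality *)
Definition sobolev alpha : set ('rV[R]_n -> R) :=
  [set g | g \in Lfun mu 2%:E /\ gagliardo alpha g < +oo].

Definition sobolev_norm alpha g : \bar R :=
  ('N[mu]_2%:E[EFin \o g] ^+ 2 + gagliardo alpha g) `^ 2^-1.

(* Bounded linear functionals on W^{alpha,2}; the bound makes them invariant
   under a.e. equality. *)
Definition sobolev_dual alpha (l : ('rV[R]_n -> R) -> R) : Prop :=
  (forall (a : R) g h, sobolev alpha g -> sobolev alpha h ->
    l (fun x => a * g x + h x)%R = (a * l g + l h)%R) /\
  exists C : R, forall g, sobolev alpha g ->
    `|l g|%:E <= C%:E * sobolev_norm alpha g.

(* A tempered distribution is represented by its action on functions, of which
   only the values at Schwartz functions matter. It belongs to W^{-alpha,2} when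
   it is the restriction to Schwartz functions of an element of the dual of
   W^{alpha,2}. *)
Definition neg_sobolev alpha (u : ('rV[R]_n -> R) -> R) : Prop :=
  exists2 l, sobolev_dual alpha l & forall phi, schwartz phi -> l phi = u phi.

(* u * Phi_t, for a tempered distribution u *)
Definition heat_conv (u : ('rV[R]_n -> R) -> R) t : 'rV[R]_n -> R :=
  fun x => u (fun y => heat_kernel t (x - y)%R).

Definition neg_sobolev_norm alpha (u : ('rV[R]_n -> R) -> R) : \bar R :=
  if `[< neg_sobolev alpha u >] then
    (\int[lebesgue_measure]_(t in `]0%R, 1%R[)
       (((t `^ (alpha / 2))%R%:E * 'N[mu]_2%:E[EFin \o heat_conv u t]) ^+ 2 *
        (t^-1)%R%:E)) `^ 2^-1
  else +oo.

(* A finite measure nu seen as a tempered distribution *)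
Definition distr_of_measure (nu : set 'rV[R]_n -> \bar R) :
    ('rV[R]_n -> R) -> R :=
  fun phi => fine (\int[nu]_x (phi x)%:E).

End real_analysis.

(* Elements of L^2(R^n) are given by representatives, L2norm being only a
   seminorm. A simple function below is valued in representatives: choosing one
   representative per value turns a simple function valued in classes into such
   a function, so strong measurability is the same for classes. *)
Definition L2 (R : realType) (n : nat) : Type :=
  LfunType (lebesgue_rV R n) (lee1n 2).

Definition L2norm (R : realType) (n : nat) (f : L2 R n) : \bar R :=
  'N[lebesgue_rV R n]_2%:E[EFin \o f]%E.

Section probability.
Context d {Omega : measurableType d} {R : realType} (P : probability Omega R).
Variable n : nat.

(* The normal law with mean m and standard deviation s >= 0. For s = 0,
   normal_prob is not the Dirac mass. *)
Definition gaussian_law (m s : R) (A : set R) : \bar R :=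
  if s == 0 then \d_m A else normal_prob m s A.

Definition gaussian_rv (X : Omega -> R) : Prop :=
  measurable_fun setT X /\
  exists m s : R, 0 <= s /\
    forall A : set R, measurable A -> P (X @^-1` A) = gaussian_law m s A.

(* The finite-dimensional distributions are Gaussian vectors: every linear
   combination of their coordinates is a Gaussian variable. *)
Definition gaussian_process (I : set R) (B : R -> Omega -> 'rV[R]_n) : Prop :=
  forall (k : nat) (t : 'I_k -> R) (a : 'I_k -> 'rV[R]_n),
    (forall j, I (t j)) ->
    gaussian_rv (fun w =>
      \sum_(j < k) \sum_(i < n) a j ord0 i * B (t j) w ord0 i).

Record fbm (H T : R) (B : R -> Omega -> 'rV[R]_n) : Prop := {
  fbm_measurable : measurable_fun
    ([set: Omega] `*` (`[0, T] : set (measurableTypeR R)))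
    (fun p : Omega * measurableTypeR R => B p.2 p.1) ;
  fbm_gaussian : gaussian_process `[0, T] B ;
  fbm_centered : forall t (i : 'I_n), t \in `[0, T] ->
    'E_P[fun w => B t w ord0 i]%E = 0%E ;
  fbm_covariance : forall s t (i j : 'I_n), s \in `[0, T] -> t \in `[0, T] ->
    covariance P (fun w => B t w ord0 i) (fun w => B s w ord0 j) =
    (((s `^ (2 * H) + t `^ (2 * H) - `|t - s| `^ (2 * H)) / 2
      *: 1%:M : 'M[R]_n) i j)%:E
}.

Definition occupation (T : R) (B : R -> Omega -> 'rV[R]_n) (w : Omega) :
    set 'rV[R]_n -> \bar R :=
  fun A => (\int[lebesgue_measure]_(s in `[0%R, T]) (\1_A (B s w))%:E)%E.

Definition simple_L2 (F : Omega -> L2 R n) : Prop :=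
  finite_set (range F) /\ forall f, measurable (F @^-1` [set f]).

(* Convergence is required at every w; a P-a.e. limit of simple functions
   satisfies it after a change on a P-null set. *)
Definition strongly_measurable (F : Omega -> L2 R n) : Prop :=
  exists S : nat -> Omega -> L2 R n, (forall k, simple_L2 (S k)) /\
    forall w, L2norm (S k w - F w) @[k --> \oo] --> 0%E.

Definition bochner_L2 (F : Omega -> L2 R n) : Prop :=
  strongly_measurable F /\ (\int[P]_w (L2norm (F w) ^+ 2) < +oo)%E.

End probability.

(* Main.v *)
Require Import Defs.
From HB Require Import structures.
From mathcomp Require Import all_boot all_order all_algebra.
From mathcomp Require Import all_classical all_reals all_analysis.
From mathcomp Require Import measurable_realfun ring lra.

Set Implicit Arguments.
Unset Strict Implicit.
Unset Printing Implicit Defensive.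
Import Order.TTheory GRing.Theory Num.Theory.
Import numFieldNormedType.Exports.

Local Open Scope classical_set_scope.
Local Open Scope ring_scope.

(** Let nu be a finite measure on R^n and U t = nu * Phi_t. By the semigroup property the inner product of
    U t and U u in L^2 is energy (t + u), where energy t is the double integral of Phi_t (x - y) against
    nu (dx) nu (dy). Nonnegativity of the norm of U t - U u makes energy midpoint convex, hence nonincreasing
    as it is bounded away from 0. If it is bounded near 0, with limit l, then U t is Cauchy as t tends to 0;
    its limit L is the density of nu, the square of its norm is l, and alpha times the square of the
    Sobolev norm of nu is alpha times the integral over (0, 1) of t ^ (alpha - 1) energy (2 t), an Abel mean
    that tends to l.

    For the occupation measure, the Fourier representation of the heat kernel gives
    E Phi_t (B_s - B_r) <= (2 pi |s - r| ^ (2 H)) ^ (- n / 2), and |s - r| ^ (- H n) is integrable on the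
    square since H n < 1. The expected energies are therefore bounded, and by monotone convergence almost
    every path has bounded energy.

    Strong measurability: U t is approximated in L^2 by normalized sums of kernels Phi_t (. - q) with q
    rational, the points being chosen greedily. The functions so obtained form a countable family whose
    distances to L are measurable, so that nearest points among its first members are simple functions
    converging to L. *)

(** * The heat kernel on the line *)

(** Energies take the place of the Fourier transform of nu and of Plancherel's theorem. Quantities
    are arranged so that the integrals over R^n have nonnegative integrands, ready for Tonelli: 1 +
    cos replaces cos, and squared distances are expanded only between nonnegative functions. By
    convention the Sobolev norm is +oo outside W^{-alpha,2}, so the density has to be identified
    before the Abel limit: pairing with L in L^2 is the bounded functional that extends nu. The
    identification compares nu with L dx on closed bounded sets and their small neighbourhoods,
    since a heat kernel carries only mass of order t beyond a fixed distance. Only the distances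
    from fixed functions to L w are shown measurable, as limits of distances to the jointly
    measurable U t; this is why a countable dense family is required. In the greedy choice some
    point always does at least as well as the nu-average, up to a constant, which gives a squared
    error of order 1/N for N points, as random sampling from nu would. *)

Section heat_kernel1.
Context {R : realType}.
Implicit Types t u x y z : R.
Notation leb := (@lebesgue_measure R).

(** The heat kernel on the line, that is, the normal density of variance [2 * t]; [heat_kernel] is a
    product of such factors. *)
Definition gk t x : R := (Num.sqrt (4 * pi * t))^-1 * expR (- (x ^+ 2 / (4 * t))).

Lemma gk_ge0 t x : 0 <= gk t x.
Proof. by rewrite mulr_ge0// ?invr_ge0// expR_ge0. Qed.

Lemma gk_normal_pdf t x y : 0 < t -> gk t (x - y) = normal_pdf y (Num.sqrt (2 * t)) x.
Proof.
move=> t0; have s0 : Num.sqrt (2 * t) != 0 by rewrite gt_eqF// sqrtr_gt0 mulr_gt0.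
rewrite normal_pdfE// /gk /normal_peak /normal_fun sqr_sqrtr; last by rewrite mulr_ge0// ltW.
congr (_^-1 * expR _); last first.
  by rewrite -mulNr; congr (_ * _^-1); ring.
by congr Num.sqrt; ring.
Qed.

Lemma measurable_gk t : measurable_fun setT (gk t).
Proof.
apply: measurable_funM => //; apply: measurableT_comp => //.
apply: measurableT_comp => //; apply: measurable_funM => //.
Qed.

Lemma integral_gk t y : 0 < t -> (\int[leb]_x (gk t (x - y))%:E = 1)%E.
Proof.
by move=> t0; under eq_integral do rewrite gk_normal_pdf//; exact: integral_normal_pdf.
Qed.

Lemma integral_gk0 t : 0 < t -> (\int[leb]_x (gk t x)%:E = 1)%E.
Proof.
by move=> t0; rewrite -(integral_gk 0 t0); apply: eq_integral => x _; rewrite subr0.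
Qed.

(** Completing the square in [x]: the product of the two kernels is [gk (t + u) (y - z)] times a
    kernel of time [v] centred at the weighted mean [c], and the latter has mass 1. *)
Lemma gk_semigroup t u y z : 0 < t -> 0 < u ->
  (\int[leb]_x (gk t (x - y) * gk u (x - z))%:E = (gk (t + u) (y - z))%:E)%E.
Proof.
move=> t0 u0; have tu0 : 0 < t + u by rewrite addr_gt0.
pose v := t * u / (t + u); pose c := (u * y + t * z) / (t + u).
have v0 : 0 < v by rewrite divr_gt0// mulr_gt0.
have E x : gk t (x - y) * gk u (x - z) = gk (t + u) (y - z) * gk v (x - c).
  rewrite /gk mulrACA [RHS]mulrACA -!invfM -!sqrtrM ?mulr_ge0 ?pi_ge0 ?ltW// -!expRD.
  congr ((Num.sqrt _)^-1 * expR _).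
    by rewrite /v; field; rewrite gt_eqF.
  by rewrite /v /c; field; rewrite !gt_eqF.
under eq_integral do rewrite E EFinM.
rewrite ge0_integralZl_EFin ?gk_ge0//.
- by rewrite integral_gk// mule1.
- by move=> x _; rewrite lee_fin gk_ge0.
- apply/measurable_EFinP; apply: (measurableT_comp (measurable_gk v)) => //.
  exact: measurable_funB.
Qed.

End heat_kernel1.

(** * Stein's identity for the heat kernel *)

Section stein.
Context {R : realType}.
Implicit Types t u x y z m : R.
Notation leb := (@lebesgue_measure R).

Lemma is_derive_gk t m z : 0 < t ->
  is_derive z (1 : R) (fun z => gk t (z - m)) (- ((z - m) / (2 * t) * gk t (z - m))).
Proof.
move=> t0.
have H : is_derive z (1 : R) (fun z : R => - ((z - m) ^+ 2 / (4 * t))) (- ((z - m) / (2 * t))).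
  rewrite [X in is_derive _ _ X _](_ : _ = (- (4 * t)^-1) *: ((id - cst m) ^+ 2)); last first.
    by apply/funext => w; rewrite !fctE /GRing.scale /= mulNr mulrC.
  apply: is_derive_eq; rewrite /GRing.scale /= !fctE /=; field; by rewrite gt_eqF.
have H2 := @is_derive1_comp _ expR _ z _ _ (is_derive_expR _) H.
rewrite [X in is_derive _ _ X _](_ : _ = (Num.sqrt (4 * pi * t))^-1 *:
    (expR \o (fun z : R => - ((z - m) ^+ 2 / (4 * t))))); last first.
  by apply/funext => w; rewrite !fctE.
apply: is_derive_eq; rewrite /GRing.scale /= /gk; ring.
Qed.

Lemma continuous_gk t : 0 < t -> continuous (gk t).
Proof.
move=> t0 x; rewrite (_ : gk t = fun z => gk t (z - 0)); last by apply/funext => z; rewrite subr0.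
by apply: differentiable_continuous; apply/derivable1_diffP; case: (is_derive_gk 0 x t0).
Qed.

Lemma gk_le_double t x : 0 < t -> expR (x ^+ 2 / (8 * t)) * gk t x = Num.sqrt 2 * gk (2 * t) x.
Proof.
move=> t0; rewrite /gk mulrCA -expRD.
rewrite (_ : 4 * pi * (2 * t) = 2 * (4 * pi * t)); last by ring.
rewrite [in RHS]sqrtrM// [in RHS]invfM !mulrA divff ?gt_eqF ?sqrtr_gt0// mul1r.
by congr (_ * expR _); field; rewrite gt_eqF.
Qed.

(** Half of the Gaussian exponent absorbs a quadratic factor, at the price of doubling the time. All
    dominations of polynomial weights below come from this bound. *)
Lemma sqr_gk_le t x : 0 < t -> (1 + x ^+ 2 / (8 * t)) * gk t x <= Num.sqrt 2 * gk (2 * t) x.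
Proof.
by move=> t0; rewrite -gk_le_double// ler_wpM2r ?gk_ge0// expR_ge1Dx.
Qed.

Lemma integrable_gk t m : 0 < t -> leb.-integrable setT (fun z => (gk t (z - m))%:E).
Proof.
move=> t0; under eq_fun do rewrite gk_normal_pdf//; exact: integrable_normal_pdf.
Qed.

Lemma integrable_le_gk t m (K : R) (p : R -> R) : 0 < t -> measurable_fun setT p ->
  (forall z, `|p z| <= K * (1 + (z - m) ^+ 2)) ->
  leb.-integrable setT (fun z => (p z * gk t (z - m))%:E).
Proof.
move=> t0 mp pK.
have K0 : 0 <= K by have := le_trans (normr_ge0 _) (pK m); rewrite subrr expr0n addr0 mulr1.
have mg : measurable_fun setT (fun z => gk t (z - m)).
  by apply: measurableT_comp (measurable_gk t) _; exact: measurable_funB.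
(* The constant comes from 1 + y^2 <= (1 + 8 t) (1 + y^2 / (8 t)), the right-hand factor being the
   one handled by [sqr_gk_le]. *)
have A0 : 0 <= K * (1 + 8 * t) by rewrite mulr_ge0// addr_ge0// mulr_ge0// ltW.
apply: (@le_integrable _ _ _ leb _ measurableT _
    (fun z => (K * (1 + 8 * t) * Num.sqrt 2)%:E * (gk (2 * t) (z - m))%:E)%E).
- by apply/measurable_EFinP; exact: measurable_funM.
- move=> z _; rewrite -EFinM !abse_EFin lee_fin [leLHS]normrM [leRHS]normrM
    (ger0_norm (gk_ge0 t _)) (ger0_norm (gk_ge0 (2 * t) _)).
  rewrite [X in _ <= X * _]ger0_norm; last by rewrite mulr_ge0.
  apply: (@le_trans _ _ (K * (1 + 8 * t) * ((1 + (z - m) ^+ 2 / (8 * t)) * gk t (z - m)))).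
    rewrite mulrA ler_wpM2r ?gk_ge0//; apply: le_trans (pK z) _.
    rewrite -mulrA ler_wpM2l//.
    rewrite [leRHS](_ : _ = 1 + (z - m) ^+ 2 + (8 * t + (z - m) ^+ 2 / (8 * t))); last first.
      by field; rewrite gt_eqF.
    by rewrite lerDl addr_ge0// ?divr_ge0 ?sqr_ge0// ?mulr_ge0 ?ltW.
  by rewrite -[leRHS]mulrA ler_wpM2l ?sqr_gk_le.
- by apply: integrableZl => //; apply: integrable_gk; rewrite mulr_gt0.
Qed.

(** Gaussian integration by parts: the derivative of [gk t (z - m)] is [- (z - m) / (2 * t)] times
    itself, so the difference of the two sides is a multiple of the integral of a derivative, whose
    boundary terms vanish at infinity. *)
Lemma stein t m (K : R) (p p' : R -> R) : 0 < t ->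
  (forall z, is_derive z (1 : R) p (p' z)) -> continuous p' ->
  (forall z, `|p z| <= K * (1 + `|z - m|)) -> (forall z, `|p' z| <= K) ->
  (\int[leb]_z ((z - m) * p z * gk t (z - m)) = 2 * t * \int[leb]_z (p' z * gk t (z - m)))%R.
Proof.
move=> t0 dp cp' pK p'K.
have K0 : 0 <= K := le_trans (normr_ge0 _) (p'K m).
have cp : continuous p.
  by move=> z; apply: differentiable_continuous; apply/derivable1_diffP; case: (dp z).
have cg : continuous (fun z => gk t (z - m)).
  move=> z; apply: (@continuous_comp _ _ _ (fun z => z - m) (gk t)); last exact: continuous_gk.
  by apply: cvgB; [exact: cvg_id|exact: cvg_cst].
have ab1 z : `|z - m| <= 1 + (z - m) ^+ 2.
  have [|] := lerP `|z - m| 1; first by move=> /le_trans; apply; rewrite lerDl sqr_ge0.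
  by move=> z1; rewrite -(real_normK (num_real (z - m))); nra.
have i1 : leb.-integrable setT (fun z => (p' z * gk t (z - m))%:E).
  apply: (@integrable_le_gk t m K) => //; first exact: continuous_measurable_fun.
  by move=> z; apply: le_trans (p'K z) _; rewrite ler_peMr// lerDl sqr_ge0.
have i2 : leb.-integrable setT (fun z => ((z - m) * p z * gk t (z - m))%:E).
  apply: (@integrable_le_gk t m (2 * K)) => //.
    by apply: measurable_funM; [exact: measurable_funB|exact: continuous_measurable_fun].
  move=> z; rewrite normrM; apply: (@le_trans _ _ (`|z - m| * (K * (1 + `|z - m|)))).
    by rewrite ler_wpM2l.
  rewrite mulrCA -mulrA (mulrC 2) -mulrA ler_wpM2l// mulrDr mulr1 -expr2 real_normK ?num_real//.
  by have := ab1 z; nra.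
pose h z := p z * gk t (z - m).
pose h' z := p' z * gk t (z - m) - (2 * t)^-1 * ((z - m) * p z * gk t (z - m)).
have dh z : is_derive z (1 : R) h (h' z).
  have := @is_deriveM _ _ p (fun z => gk t (z - m)) z 1 _ _ (dp z) (is_derive_gk m z t0).
  move=> H; apply: is_derive_eq H _; rewrite /h' /GRing.scale /=; field; by rewrite gt_eqF.
have ih' : leb.-integrable setT (EFin \o h').
  have := integrableB measurableT i1 (integrableZl measurableT (2 * t)^-1 i2).
  by apply: eq_integrable => // z _ /=; rewrite -EFinM -EFinB.
have ch' : continuous h'.
  move=> z; apply: cvgB; first by apply: cvgM; [exact: cp'|exact: cg].
  apply: cvgM; first exact: cvg_cst.
  apply: cvgM; last exact: cg.
  apply: cvgM; last exact: cp.
  by apply: cvgB; [exact: cvg_id|exact: cvg_cst].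
suff: (\int[leb]_z h' z = 0)%R.
  rewrite /h' RintegralB//; last first.
    by have := integrableZl measurableT (2 * t)^-1 i2.
  rewrite RintegralZl// => /eqP; rewrite subr_eq0 => /eqP ->.
  by rewrite mulrA divff ?mul1r// gt_eqF// mulr_gt0.
have t8 : 0 <= 8 * t by rewrite mulr_ge0// ltW.
have A0 : 0 <= K * (2 + 8 * t) by rewrite mulr_ge0// addr_ge0.
(* Quadratic decay of [h]: one doubling of the time absorbs the linear growth of [p], and the
   remaining Gaussian of time [2 * t] absorbs [(z - m) ^+ 2]. *)
have hb : exists2 M : R, 0 <= M & forall z, `|h z| * (z - m) ^+ 2 <= M.
  exists (K * (2 + 8 * t) * Num.sqrt 2 * ((Num.sqrt (4 * pi * (2 * t)))^-1 * (8 * t))).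
    by rewrite mulr_ge0 ?(mulr_ge0 A0)// mulr_ge0 ?invr_ge0.
  move=> z; rewrite /h normrM (ger0_norm (gk_ge0 _ _)); set y := z - m.
  have B1 : `|p z| * gk t y <= K * (2 + 8 * t) * (Num.sqrt 2 * gk (2 * t) y).
    apply: (@le_trans _ _ (K * (2 + 8 * t) * ((1 + y ^+ 2 / (8 * t)) * gk t y))); last first.
      by rewrite ler_wpM2l ?sqr_gk_le.
    rewrite mulrA ler_wpM2r ?gk_ge0//; apply: le_trans (pK z) _.
    rewrite -mulrA ler_wpM2l// -/y; have := ab1 z; rewrite -/y => y1.
    rewrite (_ : (2 + 8 * t) * _ = 2 + y ^+ 2 + (8 * t + 2 * y ^+ 2 / (8 * t))); last first.
      by field; rewrite gt_eqF.
    rewrite -[leLHS]addr0 lerD//; first by lra.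
    by rewrite addr_ge0// divr_ge0// mulr_ge0 ?sqr_ge0.
  have B2 : gk (2 * t) y * y ^+ 2 <= (Num.sqrt (4 * pi * (2 * t)))^-1 * (8 * t).
    rewrite /gk -[leLHS]mulrA ler_wpM2l ?invr_ge0// expRN mulrC ler_pdivrMr ?expR_gt0//.
    apply: (@le_trans _ _ (8 * t * (1 + y ^+ 2 / (4 * (2 * t))))).
      rewrite (_ : 8 * t * _ = y ^+ 2 + 8 * t); first by rewrite lerDl.
      by field; rewrite gt_eqF.
    by rewrite ler_wpM2l ?expR_ge1Dx.
  apply: (@le_trans _ _ (K * (2 + 8 * t) * (Num.sqrt 2 * gk (2 * t) y) * y ^+ 2)).
    by rewrite ler_wpM2r ?sqr_ge0.
  rewrite [leLHS](_ : _ = K * (2 + 8 * t) * Num.sqrt 2 * (gk (2 * t) y * y ^+ 2)); last by ring.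
  by rewrite ler_wpM2l// mulr_ge0.
have [M M0 hM] := hb.
(* Both end points at once, [e] being 1 or -1. The squared distance to [m] is only bounded below by
   [n.+1%:R / 4], which is enough for a bound by [4 * M] times [harmonic]. *)
have lim_h (e : R) : `|e| = 1 -> h (e * n.+1%:R) @[n --> \oo] --> 0.
  move=> e1; apply: norm_cvg0.
  apply: (@squeeze_cvgr _ _ _ _ (cst 0) (fun n => 4 * M * harmonic n)).
  - near=> n; rewrite normr_ge0/=.
    have nm : 2 * `|m| <= n.+1%:R.
      apply: (@le_trans _ _ n%:R); last by rewrite ler_nat.
      by near: n; exact: nbhs_infty_ger.
    have n0 : 0 < n.+1%:R :> R by [].
    have d1 : n.+1%:R / 2 <= `|e * n.+1%:R - m|.
      have := lerB_dist (e * n.+1%:R) m; rewrite normrM e1 mul1r ger0_norm//; lra.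
    have d2 : n.+1%:R / 4 <= (e * n.+1%:R - m) ^+ 2.
      rewrite -real_normK ?num_real//.
      have : 1 <= n.+1%:R :> R by rewrite ler1n.
      by nra.
    have := hM (e * n.+1%:R).
    have := normr_ge0 (h (e * n.+1%:R)).
    by rewrite /harmonic /= ler_pdivlMr//; nra.
  - exact: cvg_cst.
  - rewrite -(mulr0 (4 * M)); apply: cvgM; [exact: cvg_cst|exact: cvg_harmonic].
(* The integral over the line is the limit of those over [D n], by dominated convergence; on [D n]
   the fundamental theorem of calculus leaves the boundary terms of [lim_h]. *)
pose D n : set R := `[- n.+1%:R, n.+1%:R]%classic.
have c1 : (\int[leb]_(z in D n) (h' z)%:E)%E @[n --> \oo] --> (\int[leb]_z (h' z)%:E)%E.
  have e1 n : measurable_fun setT ((EFin \o h') \_ (D n)).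
    apply/(measurable_restrict _ _ measurableT) => //; first exact: measurable_itv.
    by apply: measurable_funS (measurable_int _ ih').
  have e2 : {ae leb, forall z : R, setT z -> ((EFin \o h') \_ (D n)) z @[n --> \oo] --> (EFin \o h') z}.
    apply: aeW => z _; apply: cvg_near_cst; near=> n.
    rewrite patchE ifT// inE /D /= in_itv /=; rewrite -ler_norml.
    apply: (@le_trans _ _ n%:R); last by rewrite ler_nat.
    by near: n; exact: nbhs_infty_ger.
  have e3 : {ae leb, forall (z : R) n, setT z -> `|((EFin \o h') \_ (D n)) z| <= `|(h' z)%:E|}%E.
    by apply: aeW => z n _; rewrite patchE; case: ifPn => // _; rewrite abse0 abse_ge0.
  have [_ _] := @dominated_convergence _ _ R leb setT measurableT _ _ _ e1 (measurable_int _ ih') e2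
     (integrable_abse ih') e3.
  by under eq_fun do rewrite -integral_mkcond.
have c2 : (\int[leb]_(z in D n) (h' z)%:E)%E @[n --> \oo] --> 0%E.
  have -> : (fun n => \int[leb]_(z in D n) (h' z)%:E)%E = (fun n => (h (1 * n.+1%:R) - h (-1 * n.+1%:R))%:E)%E.
    apply/funext => n; rewrite mul1r mulN1r EFinB; apply: continuous_FTC2.
    - by rewrite (@lt_trans _ _ 0)// oppr_lt0.
    - exact: continuous_subspaceT.
    - have ch : continuous h.
        by move=> z; apply: differentiable_continuous; apply/derivable1_diffP; case: (dh z).
      split.
      + by move=> z _; case: (dh z).
      + exact/cvg_at_right_filter/ch.
      + exact/cvg_at_left_filter/ch.
    - by move=> z _; rewrite derive1E; case: (dh z).
  apply: cvg_EFin; first by near=> n.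
  rewrite -(subrr (0 : R)); apply: cvgB; apply: lim_h; first by rewrite normr1.
  by rewrite normrN normr1.
have := cvg_unique _ c1 c2 => /(_ (@ereal_hausdorff R)) H.
by rewrite /Rintegral H.
Unshelve. all: by end_near. Qed.

End stein.

Section heat_kernel1_moments.
Context {R : realType}.
Implicit Types t u x y z m th : R.
Notation leb := (@lebesgue_measure R).

(** Stein's identity with [p = 1] shows that the mean of [z - m] vanishes. *)
Lemma gk_integral_linear t m : 0 < t -> (\int[leb]_z (z * gk t (z - m)) = m)%R.
Proof.
move=> t0.
have i0 := integrable_gk m t0.
have i1 : leb.-integrable setT (fun z => ((z - m) * gk t (z - m))%:E).
  apply: (@integrable_le_gk _ t m 1) => //; first exact: measurable_funB.
  move=> z; rewrite mul1r; set y := z - m.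
  rewrite -(real_normK (num_real y)); have := normr_ge0 y; nra.
have c0 : continuous (cst 0 : R -> R) by move=> z; exact: cvg_cst.
have := @stein R t m 1 (cst 1) (cst 0) t0 (fun z => is_derive_cst _ _ _) c0.
have -> : (fun z => (z - m) * cst 1 z * gk t (z - m)) = (fun z => (z - m) * gk t (z - m)).
  by apply/funext => z /=; rewrite mulr1.
(* Writing the zero integrand as [0 * 0] lets [RintegralZl] extract a factor 0. *)
have -> : (fun z : R => cst 0 z * gk t (z - m)) = (fun z => 0 * 0).
  by apply/funext => z /=; rewrite !mul0r.
rewrite RintegralZl//; last exact: integrable0.
rewrite mul0r mulr0 => H.
have -> : (fun z => z * gk t (z - m)) = (fun z => (z - m) * gk t (z - m) + m * gk t (z - m)).
  by apply/funext => z; ring.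
rewrite RintegralD//; last first.
  by have := integrableZl measurableT m i0.
rewrite RintegralZl//.
rewrite H ?add0r; last 2 first.
- by move=> z /=; rewrite normr1 mul1r lerDl.
- by move=> z /=; rewrite normr0.
by rewrite /Rintegral integral_gk// mulr1.
Qed.

(** Stein's identity with [p z = z - m], whose derivative is 1. *)
Lemma gk_integral_quadratic t m : 0 < t -> (\int[leb]_z ((z - m) ^+ 2 * gk t (z - m)) = 2 * t)%R.
Proof.
move=> t0.
have := @stein R t m 1 (fun z => z - m) (cst 1) t0.
have -> : (fun z => (z - m) * (z - m) * gk t (z - m)) = (fun z => (z - m) ^+ 2 * gk t (z - m)).
  by apply/funext.
have -> : (fun z : R => cst 1 z * gk t (z - m)) = (fun z => gk t (z - m)).
  by apply/funext => z /=; rewrite !mul1r.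
rewrite {2}/Rintegral integral_gk// mulr1; apply.
- move=> z; have := @is_deriveB _ _ _ id (cst m) z 1 _ _ (is_derive_id _ _) (is_derive_cst _ _ _).
  by rewrite subr0.
- by move=> z; exact: cvg_cst.
- by move=> z; rewrite mul1r lerDr.
- by move=> z /=; rewrite normr1.
Qed.

(* By Stein's identity, F x := \int cos (x z + th) gk t z dz solves F' = - 2 t x F. *)
Lemma gk_integral_cos t x th : 0 < t ->
  (\int[leb]_z (cos (x * z + th) * gk t z) = expR (- (t * x ^+ 2)) * cos th)%R.
Proof.
move=> t0.
pose F x := (\int[leb]_z (cos (x * z + th) * gk t z))%R.
pose g z := gk t (z - 0).
have gE z : gk t z = g z by rewrite /g subr0.
have dl y z : is_derive z (1 : R) (fun z => y * z + th) y.
  rewrite [X in is_derive _ _ X _](_ : _ = (y *: id + cst th)); last first.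
    by apply/funext => w; rewrite !fctE.
  by apply: is_derive_eq; rewrite addr0 /GRing.scale/= mulr1.
have dl' y z : is_derive y (1 : R) (fun y => y * z + th) z.
  by have := dl z y; under eq_fun do rewrite mulrC.
have cl y : continuous (fun z => y * z + th).
  by move=> z; apply: differentiable_continuous; apply/derivable1_diffP; case: (dl y z).
have mcos y : measurable_fun setT (fun z => cos (y * z + th)).
  apply: continuous_measurable_fun => z; apply: (@continuous_comp _ _ _ (fun z => y * z + th) cos).
    exact: cl.
  exact: continuous_cos.
have icos y : leb.-integrable setT (EFin \o (fun z => cos (y * z + th) * gk t z)).
  have := @integrable_le_gk _ t 0 1 (fun z => cos (y * z + th)) t0 (mcos y).
  rewrite /comp; under [in X in _ -> X]eq_fun do rewrite gE; apply.
  by move=> z; rewrite mul1r (le_trans (cos_max _))// lerDl sqr_ge0.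
have dF y : is_derive y (1 : R) F (- (2 * t * y) * F y).
  have D z w : is_derive w (1 : R) (fun y => cos (y * z + th) * gk t z) (- sin (w * z + th) * z * gk t z).
    have H := @is_derive1_comp _ cos _ w _ _ (is_derive_cos _) (dl' w z).
    have := @is_deriveM _ _ _ (cst (gk t z)) w 1 _ _ H (is_derive_cst _ _ _).
    move=> H2; apply: is_derive_eq H2 _; rewrite /GRing.scale/=; ring.
  have P1 w z : (partial1of2 (fun y z => cos (y * z + th) * gk t z)) w z = - sin (w * z + th) * z * gk t z.
    by rewrite partial1of2E; case: (D z w).
  (* The dominating function for differentiation under the integral sign: the derivative in [y]
     brings out a factor [z], and the sine is at most 1. *)
  have iG : leb.-integrable setT (EFin \o (fun z => `|z| * gk t z)).
    have := @integrable_le_gk _ t 0 1 (fun z => `|z|) t0.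
    rewrite /comp; under [in X in _ -> X]eq_fun do rewrite gE; apply => // z.
    by rewrite subr0 mul1r normr_id -(real_normK (num_real z)); have := normr_ge0 z; nra.
  have G1 : forall w z, `]y - 1, y + 1[%classic w -> setT z ->
     `|partial1of2 (fun y z => cos (y * z + th) * gk t z) w z| <= `|z| * gk t z.
    move=> w z _ _; rewrite P1 [leLHS]normrM (ger0_norm (gk_ge0 t z)) ler_wpM2r ?gk_ge0//.
    by rewrite normrM normrN ler_piMl// sin_max.
  have yI : `]y - 1, y + 1[%classic y by rewrite /= in_itv/=; apply/andP; split; lra.
  have der1 : forall w z, `]y - 1, y + 1[%classic w -> setT z ->
     derivable (fun y => cos (y * z + th) * gk t z) w 1 by move=> w z _ _; case: (D z w).
  have dv := @derivable_under_integral R _ _ leb (fun y z => cos (y * z + th) * gk t z) setT measurableT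
     y _ _ yI (fun w _ => icos w) der1 (fun z => `|z| * gk t z) _ iG G1.
  have de := @differentiation_under_integral R _ _ leb (fun y z => cos (y * z + th) * gk t z) setT measurableT
     y _ _ yI (fun w _ => icos w) der1 (fun z => `|z| * gk t z) _ iG G1.
  have G0 z : 0 <= `|z| * gk t z by rewrite mulr_ge0 ?gk_ge0.
  apply: DeriveDef; first exact: dv.
  have := de G0; rewrite derive1E => ->.
  under eq_Rintegral do rewrite P1.
  have S1 z : is_derive z (1 : R) (fun z => - sin (y * z + th)) (- (cos (y * z + th) * y)).
    exact: is_deriveN (@is_derive1_comp _ sin _ z _ _ (is_derive_sin _) (dl y z)).
  have S2 : continuous (fun z => - (cos (y * z + th) * y)).
    move=> z; apply: (@cvgN _ R^o); apply: cvgM; last exact: cvg_cst.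
    apply: (@continuous_comp _ _ _ (fun z => y * z + th) cos); first exact: cl.
    exact: continuous_cos.
  have S3 z : `|- sin (y * z + th)| <= (1 + `|y|) * (1 + `|z - 0|).
    by rewrite normrN (le_trans (sin_max _))// mulr_ege1 ?lerDl.
  have S4 z : `|- (cos (y * z + th) * y)| <= 1 + `|y|.
    by rewrite normrN normrM (@le_trans _ _ `|y|)// ?ler_piMl ?cos_max// lerDr.
  (* With [p z = - sin (y * z + th)], Stein's identity turns the factor [z] of the derivative into
     [- (2 * t * y)] times the original cosine integral. *)
  have := stein t0 S1 S2 S3 S4.
  rewrite (_ : (fun z => _ * _ * gk t (z - 0)) = (fun z => - sin (y * z + th) * z * gk t z)); last first.
    by apply/funext => z; rewrite (gE z) /g; ring.
  move=> ->.
  rewrite (_ : (fun z => _ * gk t (z - 0)) = (fun z => - y * (cos (y * z + th) * gk t z))); last first.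
    by apply/funext => z; rewrite (gE z) /g; ring.
  by rewrite RintegralZl// -/(F y); ring.
(* The integrating factor of the equation: [Q] has derivative 0, so it equals its value at 0, which
   is [cos th]. *)
pose Q y := F y * expR (t * y ^+ 2).
have dQ y : is_derive y (1 : R) Q 0.
  have H1 : is_derive y (1 : R) (fun y : R => t * y ^+ 2) (2 * t * y).
    rewrite [X in is_derive _ _ X _](_ : _ = t *: (id ^+ 2)); last first.
      by apply/funext => w; rewrite !fctE.
    by apply: is_derive_eq; rewrite /GRing.scale /=; ring.
  have H2 := @is_derive1_comp _ expR _ y _ _ (is_derive_expR _) H1.
  have := @is_deriveM _ _ _ _ y 1 _ _ (dF y) H2.
  by move=> H; apply: is_derive_eq H _; rewrite /GRing.scale/=; ring.
have : Q x = Q 0 by apply: is_derive_0_is_cst.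
rewrite /Q expr0n mulr0 expR0 mulr1 => /(congr1 (fun r => r * expR (- (t * x ^+ 2)))).
rewrite -mulrA -expRD subrr expR0 mulr1 -/(F x) => ->; rewrite mulrC; congr (_ * _).
rewrite /F; under eq_Rintegral do rewrite mul0r add0r.
rewrite RintegralZl//; last by have := integrable_gk 0 t0; under eq_fun do rewrite subr0.
by rewrite /Rintegral integral_gk0// mulr1.
Qed.

Lemma gk_integral_1cos t x th : 0 < t ->
  (\int[leb]_z ((1 + cos (x * z + th)) * gk t z)%:E = (1 + expR (- (t * x ^+ 2)) * cos th)%:E)%E.
Proof.
move=> t0.
have ig : leb.-integrable setT (EFin \o gk t).
  by have := integrable_gk 0 t0; under eq_fun do rewrite subr0.
have ic : leb.-integrable setT (EFin \o (fun z => cos (x * z + th) * gk t z)).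
  have := @integrable_le_gk _ t 0 1 (fun z => cos (x * z + th)) t0.
  under [X in _ -> _ -> integrable _ _ X]eq_fun do rewrite subr0.
  apply; last by move=> z; rewrite mul1r (le_trans (cos_max _))// lerDl sqr_ge0.
  apply: continuous_measurable_fun => z; apply: (@continuous_comp _ _ _ (fun z => x * z + th) cos).
    by apply: cvgD; [apply: cvgM; [exact: cvg_cst|exact: cvg_id]|exact: cvg_cst].
  exact: continuous_cos.
under eq_integral do rewrite mulrDl mul1r EFinD.
rewrite integralD//.
rewrite integral_gk0//.
rewrite EFinD -(gk_integral_cos x th t0) /Rintegral fineK//.
exact: integrable_fin_num.
Qed.

End heat_kernel1_moments.

(** * Lebesgue measure and the heat kernel on R^n *)

Section rV_measure.
Context {R : realType}.
Notation leb := (@lebesgue_measure R).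

Lemma measurable_rVP n d (T : measurableType d) (f : T -> 'rV[R]_n) :
  measurable_fun setT f <-> forall i, measurable_fun setT (fun x => f x ord0 i : R).
Proof. exact: measurable_fun_coordP. Qed.

Lemma measurable_coordR n (i : 'I_n) : measurable_fun setT (fun x : 'rV[R]_n => x ord0 i : R).
Proof. exact: measurable_coord. Qed.

Lemma measurable_rVB n d (T : measurableType d) (f g : T -> 'rV[R]_n) :
  measurable_fun setT f -> measurable_fun setT g ->
  measurable_fun setT (fun x => f x - g x).
Proof.
move=> /measurable_rVP mf /measurable_rVP mg.
apply/measurable_rVP => i.
rewrite (_ : (fun x => _) = (fun x => f x ord0 i - g x ord0 i)).
  exact: measurable_funB.
by apply/funext => x; rewrite !mxE.
Qed.

Lemma euclid_norm_ge0 n (x : 'rV[R]_n) : 0 <= euclid_norm x.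
Proof. exact: sqrtr_ge0. Qed.

Lemma sqr_euclid_norm n (x : 'rV[R]_n) : euclid_norm x ^+ 2 = \sum_i x ord0 i ^+ 2.
Proof. by rewrite sqr_sqrtr// sumr_ge0// => i _; rewrite sqr_ge0. Qed.

(** Links the two norms at play: balls and distances use the sup norm, the heat kernel the Euclidean
    one. *)
Lemma le_norm_euclid_norm n (x : 'rV[R]_n) : `|x| <= euclid_norm x.
Proof.
rewrite /Num.norm/= mx_normrE.
apply/bigmax_leP; split=> [|[i j] _ /=]; first exact: euclid_norm_ge0.
rewrite ord1 -sqrtr_sqr ler_wsqrtr// (bigD1 j)//= lerDl sumr_ge0// => k _.
exact: sqr_ge0.
Qed.

(** The exponential of a sum of squares and the power [n / 2] both factorize. Integrals over R^n of
    products of heat kernels thereby reduce to the line. *)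
Lemma heat_kernelE n t (x : 'rV[R]_n) : 0 < t -> heat_kernel t x = \prod_i gk t (x ord0 i).
Proof.
move=> t0; rewrite /heat_kernel /gk big_split/= sqr_euclid_norm; congr (_ * _).
  rewrite prodr_const card_ord -powR12_sqrt ?mulr_ge0 ?pi_ge0 ?ltW//.
  by rewrite powRN exprVn [n%:R / 2]mulrC powRrM powR_mulrn ?powR_ge0.
rewrite -expR_sum; congr expR; rewrite mulr_suml -sumrN.
by apply: eq_bigr => i _.
Qed.

Lemma heat_kernel_ge0 n t (x : 'rV[R]_n) : 0 <= heat_kernel t x.
Proof. by rewrite mulr_ge0 ?powR_ge0 ?expR_ge0. Qed.

Lemma euclid_normN n (x : 'rV[R]_n) : euclid_norm (- x) = euclid_norm x.
Proof. by congr Num.sqrt; apply: eq_bigr => i _; rewrite mxE sqrrN. Qed.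

Lemma heat_kernelN n t (x : 'rV[R]_n) : heat_kernel t (- x) = heat_kernel t x.
Proof.
by rewrite /heat_kernel euclid_normN.
Qed.

Lemma heat_kernel_ub n t (x : 'rV[R]_n) : 0 < t ->
  heat_kernel t x <= (4 * pi * t) `^ (- (n%:R / 2)).
Proof.
move=> t0; rewrite ler_piMr ?powR_ge0// -expR0 ler_expR oppr_le0 divr_ge0 ?sqr_ge0//.
by rewrite mulr_ge0// ltW.
Qed.

Lemma measurable_heat_kernel n t : measurable_fun setT (@heat_kernel R n t).
Proof.
apply: measurable_funM => //; apply: measurableT_comp => //; apply: measurableT_comp => //.
apply: measurable_funM => //; under eq_fun do rewrite sqr_euclid_norm.
apply: measurable_sum => i; apply: measurable_funX; exact: measurable_coordR.
Qed.

Lemma measurable_heat_kernelB n t d (T : measurableType d) (f g : T -> 'rV[R]_n) :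
  measurable_fun setT f -> measurable_fun setT g ->
  measurable_fun setT (fun x => heat_kernel t (f x - g x)).
Proof.
move=> mf mg; apply: measurableT_comp; first exact: measurable_heat_kernel.
exact: measurable_rVB.
Qed.

(** Tonelli's theorem read through the recursive definition of [lebesgue_rV]; the inductions on the
    dimension rest on it. *)
Lemma integral_rVS n (f : 'rV[R]_n.+1 -> \bar R) :
  measurable_fun setT f -> (forall x, 0 <= f x)%E ->
  (\int[lebesgue_rV R n.+1]_x f x =
   \int[leb]_a \int[lebesgue_rV R n]_x f (rVcons (a, x)))%E.
Proof.
move=> mf f0; rewrite /= ge0_integral_pushforward//=; last exact: measurable_rVcons.
rewrite preimage_setT fubini_tonelli1//.
by apply: measurableT_comp => //; exact: measurable_rVcons.
Qed.

Lemma rVcons0 n a (x : 'rV[R]_n) : rVcons (a, x) ord0 ord0 = a.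
Proof. by rewrite mxE unlift_none. Qed.

Lemma rVconsS n a (x : 'rV[R]_n) i : rVcons (a, x) ord0 (lift ord0 i) = x ord0 i.
Proof. by rewrite mxE liftK. Qed.

Lemma measurable_fun_prod_coord n (g : 'I_n -> R -> R) :
  (forall i, measurable_fun setT (g i)) ->
  measurable_fun setT (fun x : 'rV[R]_n => \prod_i g i (x ord0 i)).
Proof.
move=> mg; apply: measurable_prod => i _.
by apply: (measurableT_comp (mg i)); exact: measurable_coord.
Qed.

Lemma integral_rV_prod n (g : 'I_n -> R -> R) (c : 'I_n -> R) :
  (forall i, measurable_fun setT (g i)) -> (forall i a, 0 <= g i a) ->
  (forall i, \int[leb]_a (g i a)%:E = (c i)%:E)%E ->
  (\int[lebesgue_rV R n]_x (\prod_i g i (x ord0 i))%:E = (\prod_i c i)%:E)%E.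
Proof.
elim: n g c => [|n ih] g c mg g0 gc.
  (* In dimension 0 Lebesgue measure is the Dirac mass at the only point, and both products are
     empty. *)
  rewrite /= integral_dirac//; last first.
    by apply/measurable_EFinP; exact: measurable_fun_prod_coord.
  by rewrite diracE in_setT mul1e !big_ord0.
have p0 m (h : 'I_m -> R -> R) (x : 'rV[R]_m) : (forall i a, 0 <= h i a) -> 0 <= \prod_i h i (x ord0 i).
  by move=> h0; rewrite prodr_ge0.
rewrite integral_rVS; last 2 first.
- by apply/measurable_EFinP; exact: measurable_fun_prod_coord.
- by move=> x; rewrite lee_fin p0.
under eq_integral => a _.
  under eq_integral => x _.
    rewrite big_ord_recl rVcons0 EFinM.
    under eq_bigr do rewrite rVconsS.
    over.
  rewrite ge0_integralZl_EFin//; last 2 first.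
  - by move=> x _; rewrite lee_fin prodr_ge0.
  - by apply/measurable_EFinP; apply: (measurable_fun_prod_coord (g := fun i => g (lift ord0 i))).
  rewrite (ih (fun i => g (lift ord0 i)) (fun i => c (lift ord0 i)))//.
  over.
rewrite ge0_integralZr//; last 3 first.
- by apply/measurable_EFinP; exact: mg.
- by move=> a _; rewrite lee_fin.
- rewrite lee_fin prodr_ge0// => i _.
  by rewrite -lee_fin -gc integral_ge0// => a _; rewrite lee_fin.
by rewrite gc -EFinM [in RHS]big_ord_recl.
Qed.

Lemma integral_heat_kernel n t (y : 'rV[R]_n) : 0 < t ->
  (\int[lebesgue_rV R n]_x (heat_kernel t (x - y))%:E = 1)%E.
Proof.
move=> t0.
transitivity (\int[lebesgue_rV R n]_x (\prod_i gk t (x ord0 i - y ord0 i))%:E)%E.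
  by apply: eq_integral => x _; rewrite heat_kernelE//; congr EFin; apply: eq_bigr => i _; rewrite !mxE.
rewrite (@integral_rV_prod _ (fun i a => gk t (a - y ord0 i)) (fun=> 1)).
- by rewrite big1.
- by move=> i; apply: (measurableT_comp (measurable_gk t)); exact: measurable_funB.
- by move=> i a; exact: gk_ge0.
- by move=> i; exact: integral_gk.
Qed.

Lemma heat_kernel_semigroup n t u (y z : 'rV[R]_n) : 0 < t -> 0 < u ->
  (\int[lebesgue_rV R n]_x (heat_kernel t (x - y) * heat_kernel u (x - z))%:E =
   (heat_kernel (t + u) (y - z))%:E)%E.
Proof.
move=> t0 u0.
transitivity (\int[lebesgue_rV R n]_x
   (\prod_i (gk t (x ord0 i - y ord0 i) * gk u (x ord0 i - z ord0 i)))%:E)%E.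
  apply: eq_integral => x _; rewrite !heat_kernelE// -big_split; congr EFin.
  by apply: eq_bigr => i _; rewrite !mxE.
rewrite (@integral_rV_prod _ (fun i a => gk t (a - y ord0 i) * gk u (a - z ord0 i))
    (fun i => gk (t + u) (y ord0 i - z ord0 i))).
- by rewrite heat_kernelE ?addr_gt0//; congr EFin; apply: eq_bigr => i _; rewrite !mxE.
- by move=> i; apply: measurable_funM; apply: (measurableT_comp (measurable_gk _)); exact: measurable_funB.
- by move=> i a; rewrite mulr_ge0 ?gk_ge0.
- by move=> i; exact: gk_semigroup.
Qed.

Definition dotp n (x y : 'rV[R]_n) : R := \sum_i x ord0 i * y ord0 i.

Lemma measurable_dotp n d (T : measurableType d) (f g : T -> 'rV[R]_n) :
  measurable_fun setT f -> measurable_fun setT g ->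
  measurable_fun setT (fun x => dotp (f x) (g x)).
Proof.
move=> /measurable_rVP mf /measurable_rVP mg.
by apply: measurable_sum => i; exact: measurable_funM.
Qed.

Lemma measurable_cosR : measurable_fun setT (@cos R).
Proof. by apply: continuous_measurable_fun; exact: continuous_cos. Qed.

Lemma cos1_ge0 (a : R) : 0 <= 1 + cos a.
Proof. by rewrite -lerBlDl sub0r cos_geN1. Qed.

(* The nonnegative function 1 + cos makes Tonelli's theorem applicable, and the phase th makes the
   statement provable by induction on n. *)
Lemma heat_kernel_integral_cos n t (x : 'rV[R]_n) th : 0 < t ->
  (\int[lebesgue_rV R n]_z ((1 + cos (dotp x z + th)) * heat_kernel t z)%:E =
   (1 + expR (- (t * euclid_norm x ^+ 2)) * cos th)%:E)%E.
Proof.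
move=> t0.
have mF m (y : 'rV[R]_m) b : measurable_fun setT
    (fun z : 'rV[R]_m => (1 + cos (dotp y z + b)) * heat_kernel t z).
  apply: measurable_funM; last exact: measurable_heat_kernel.
  apply: measurable_funD => //; apply: (measurableT_comp measurable_cosR).
  by apply: measurable_funD => //; apply: measurable_dotp.
elim: n x th => [|n ih] x th.
  rewrite /= integral_dirac//; last by apply/measurable_EFinP; exact: mF.
  rewrite diracE in_setT mul1e heat_kernelE// sqr_euclid_norm /dotp !big_ord0.
  by rewrite mulr0 oppr0 expR0 mul1r mulr1 add0r.
rewrite integral_rVS; last 2 first.
- by apply/measurable_EFinP; exact: mF.
- by move=> z; rewrite lee_fin mulr_ge0 ?cos1_ge0 ?heat_kernel_ge0.
pose x' : 'rV[R]_n := \row_j x ord0 (lift ord0 j).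
pose k := expR (- (t * euclid_norm x' ^+ 2)).
have k1 : k <= 1.
  by rewrite -expR0 ler_expR oppr_le0 mulr_ge0 ?sqr_ge0// ltW.
(* The induction hypothesis, used with the phase [x ord0 ord0 * a + th], yields 1 + k cos. It is
   split as (1 - k) + k (1 + cos), two nonnegative terms since [k <= 1], to which the formulas on
   the line apply. *)
have E a : (\int[lebesgue_rV R n]_z ((1 + cos (dotp x (rVcons (a, z)) + th)) * heat_kernel t (rVcons (a, z)))%:E =
   ((1 - k) * gk t a)%:E + (k * ((1 + cos (x ord0 ord0 * a + th)) * gk t a))%:E)%E.
  transitivity (\int[lebesgue_rV R n]_z ((gk t a)%:E *
     ((1 + cos (dotp x' z + (x ord0 ord0 * a + th))) * heat_kernel t z)%:E))%E.
    apply: eq_integral => z _; rewrite -EFinM; congr EFin.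
    rewrite [heat_kernel t (rVcons _)]heat_kernelE// big_ord_recl rVcons0.
    under eq_bigr do rewrite rVconsS.
    rewrite -heat_kernelE// mulrCA; congr (_ * ((1 + cos _) * _)).
    rewrite /dotp big_ord_recl rVcons0 [RHS]addrCA -addrA; congr (_ + _).
    by congr (_ + _); apply: eq_bigr => i _; rewrite rVconsS mxE.
  rewrite ge0_integralZl_EFin ?gk_ge0//; last 2 first.
  - by move=> z _; rewrite lee_fin mulr_ge0 ?cos1_ge0 ?heat_kernel_ge0.
  - by apply/measurable_EFinP; exact: mF.
  by rewrite ih -EFinM -EFinD -/k; congr EFin; ring.
under eq_integral do rewrite E.
rewrite ge0_integralD//; last 4 first.
- by move=> a _; rewrite lee_fin mulr_ge0 ?gk_ge0// subr_ge0.
- by apply/measurable_EFinP; apply: measurable_funM => //; exact: measurable_gk.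
- by move=> a _; rewrite lee_fin !mulr_ge0 ?gk_ge0 ?cos1_ge0// expR_ge0.
- apply/measurable_EFinP; apply: measurable_funM => //; apply: measurable_funM; last exact: measurable_gk.
  apply: measurable_funD => //; apply: (measurableT_comp measurable_cosR).
  by apply: measurable_funD => //; apply: measurable_funM.
under eq_integral do rewrite EFinM.
under [X in (_ + X)%E]eq_integral do rewrite EFinM.
rewrite ge0_integralZl_EFin//; last 3 first.
- by move=> a _; rewrite lee_fin gk_ge0.
- by apply/measurable_EFinP; exact: measurable_gk.
- by rewrite subr_ge0.
rewrite ge0_integralZl_EFin ?expR_ge0//; last 2 first.
- by move=> a _; rewrite lee_fin mulr_ge0 ?gk_ge0 ?cos1_ge0.
- apply/measurable_EFinP; apply: measurable_funM; last exact: measurable_gk.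
  apply: measurable_funD => //; apply: (measurableT_comp measurable_cosR).
  by apply: measurable_funD => //; apply: measurable_funM.
rewrite integral_gk0// gk_integral_1cos// mule1 -EFinM -EFinD; congr EFin.
rewrite mulrDr mulr1 addrA subrK mulrA; congr (1 + _ * _).
rewrite /k -expRD; congr expR; rewrite !sqr_euclid_norm big_ord_recl mulrDr opprD addrC.
by congr (_ - _ * _); apply: eq_bigr => i _; rewrite mxE.
Qed.

End rV_measure.

(** * Borel sets of R^n, uniqueness of measures, tails of the heat kernel *)

Section rV_borel.
Context {R : realType}.
Notation leb := (@lebesgue_measure R).

Lemma ler_coord_norm n (x : 'rV[R]_n) i : `|x ord0 i| <= `|x|.
Proof.
rewrite [leRHS]/Num.norm/= mx_normrE.
exact: (le_bigmax_cond _ (fun ij : 'I_1 * 'I_n => `|x ij.1 ij.2|) (isT : predT (ord0, i))).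
Qed.

Lemma rV_ballE n (x y : 'rV[R]_n) (e : R) :
  ball x e y <-> 0 < e /\ forall i, `|x ord0 i - y ord0 i| < e.
Proof.
split=> [[e0 h]|[e0 h]]; split => // i; first exact: (h ord0 i).
by move=> j; rewrite ord1; exact: h.
Qed.

Lemma measurable_rV_ball n (x : 'rV[R]_n) (e : R) : measurable (ball x e : set 'rV[R]_n).
Proof.
have [e0|e0] := ltP 0 e; last first.
  rewrite (_ : ball x e = set0) ?measurable0//; apply/seteqP; split => // y.
  by move=> /rV_ballE[]; rewrite ltNge e0.
rewrite (_ : ball x e = \bigcap_(i in [set: 'I_n]) (fun y : 'rV[R]_n => y ord0 i : R) @^-1` (ball (x ord0 i) e)).
  apply: fin_bigcap_measurable; first exact: finite_finset.
  move=> i _; rewrite -[X in measurable X]setTI; apply: measurable_coordR => //.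
  exact: measurable_ball.
apply/seteqP; split => y; first by move=> /rV_ballE[_ h] i _; exact: h.
by move=> h; apply/rV_ballE; split => // i; exact: (h i I).
Qed.

Lemma rV_rat_dense n (x : 'rV[R]_n) (e : R) : 0 < e ->
  exists q : 'rV[rat]_n, ball x e (map_mx ratr q : 'rV[R]_n).
Proof.
move=> e0.
have H i : exists q : rat, ratr q \in `]x ord0 i - e, x ord0 i + e[.
  by apply: rat_in_itvoo; rewrite ltrD2l; lra.
have [q hq] := choice H.
exists (\row_i q i); apply/rV_ballE; split => // i; rewrite !mxE.
by have := hq i; rewrite in_itv/= distrC ltr_distl.
Qed.

(** The sigma-algebra is generated by the coordinates, so openness must be made countable: [U] is
    the union of the balls with rational centre and radius [k.+1%:R^-1] that it contains. *)
Lemma open_measurable_rV n (U : set 'rV[R]_n) : open U -> measurable U.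
Proof.
move=> oU.
pose F (p : 'rV[rat]_n * nat) : set 'rV[R]_n :=
  if `[< ball (map_mx ratr p.1 : 'rV[R]_n) (p.2.+1%:R^-1 : R) `<=` U >]
  then ball (map_mx ratr p.1 : 'rV[R]_n) (p.2.+1%:R^-1 : R) else set0.
rewrite (_ : U = \bigcup_p F p).
  apply: countable_bigcupT_measurable; first exact: countableP.
  by move=> p; rewrite /F; case: ifP => _; [exact: measurable_rV_ball|exact: measurable0].
apply/seteqP; split => [x Ux|x [p _]]; last first.
  by rewrite /F; case: ifPn => // /asboolP h; exact: h.
have /nbhs_ballP[e /= e0 eU] : nbhs x U by exact: open_nbhs_nbhs.
(* The factor 2: a ball that contains [x] and has radius [k.+1%:R^-1] lies within twice that radius
   of [x]. *)
have [k ke] : exists k : nat, 2 * k.+1%:R^-1 < e.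
  have [k hk] : exists k, k.+1%:R^-1 < e / 2.
    by have [k] := ltr_add_invr (divr_gt0 e0 (ltr0Sn R 1)); rewrite add0r => ?; exists k.
  by exists k; move: hk; move: (k.+1%:R^-1) => z; lra.
have k0 : 0 < k.+1%:R^-1 :> R by rewrite invr_gt0.
have [q xq] := rV_rat_dense x k0.
exists (q, k) => //; rewrite /F /= ifT; first exact: ball_sym.
apply/asboolP => y qy; apply: eU.
apply: (@le_ball _ _ x (k.+1%:R^-1 + k.+1%:R^-1)); last exact: ball_triangle xq qy.
by move: ke; move: (k.+1%:R^-1) => w; lra.
Qed.

Lemma closed_measurable_rV n (C : set 'rV[R]_n) : closed C -> measurable C.
Proof. by move=> /closed_openC/open_measurable_rV/measurableC; rewrite setCK. Qed.

Lemma continuous_measurable_rV n (f : 'rV[R]_n -> R) : continuous f -> measurable_fun setT f.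
Proof.
move=> cf; apply: (measurability _ (RGenOpens.measurableE R)) => //= _ [_ [a [b ->] <-]].
rewrite setTI; apply: open_measurable_rV; apply: open_comp; last exact: interval_open.
by move=> x _; exact: cf.
Qed.

Lemma closed_norm_le n (r : R) : closed [set x : 'rV[R]_n | `|x| <= r].
Proof.
rewrite (_ : [set _ | _] = (fun x => `|x|) @^-1` [set y | y <= r])//.
by apply: closed_comp; [move=> x _; exact: norm_continuous|exact: closed_le].
Qed.

(** The set lies in a cube, whose indicator is a product of indicators of [[- r, r]]. *)
Lemma lebesgue_rV_bounded n (A : set 'rV[R]_n) (r : R) : measurable A ->
  (forall x, A x -> `|x| <= r) -> (lebesgue_rV R n A < +oo)%E.
Proof.
move=> mA Ar.
have mI : measurable (`[- r, r]%classic : set R) by exact: measurable_itv.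
have H := @integral_rV_prod R n (fun=> \1_`[- r, r]) (fun=> fine (leb `[- r, r]%classic)).
rewrite -[A]setIT -integral_indic//.
apply: (@le_lt_trans _ _ (\int[lebesgue_rV R n]_x (\prod_i \1_(`[- r, r]%classic) (x ord0 i))%:E)%E); last first.
  rewrite H ?ltry//.
  by move=> i; rewrite integral_indic// setIT fineK// lebesgue_measure_itv/=; case: ifP.
apply: ge0_le_integral => //.
- by apply/measurable_EFinP; exact: measurable_indic.
- apply/measurable_EFinP; apply: (measurable_fun_prod_coord (g := fun=> \1_`[- r, r])) => i.
  exact: measurable_indic.
- move=> x _; rewrite lee_fin; rewrite indicE; have [xA|_] := boolP (x \in A); last by rewrite prodr_ge0.
  rewrite big1// => i _; rewrite indicE mem_set//= in_itv/= -ler_norml.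
  by apply: le_trans (ler_coord_norm x i) _; apply: Ar; rewrite inE in xA.
Qed.

(** Closed bounded sets form a pi-system that generates the sigma-algebra, and the closed balls of
    integer radius exhaust the space with finite mass. *)
Lemma rV_measure_unique n (m1 m2 : {measure set 'rV[R]_n -> \bar R}) :
  (forall (C : set 'rV[R]_n) (r : R), closed C -> (forall x, C x -> `|x| <= r) -> m1 C = m2 C) ->
  (forall r : R, m1 [set x | (`|x| <= r)%R] < +oo)%E ->
  forall A, measurable A -> m1 A = m2 A.
Proof.
move=> m12 m1oo.
pose G := [set C : set 'rV[R]_n | closed C /\ exists r : R, forall x, C x -> `|x| <= r].
pose g k := [set x : 'rV[R]_n | `|x| <= k%:R].
have Gg k : G (g k) by split; [exact: closed_norm_le|exists k%:R].
apply: (@measure_unique _ R _ G g) => //.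
- apply/seteqP; split; last first.
    apply: smallest_sub; first exact: sigma_algebra_measurable.
    by move=> C [cC _]; exact: closed_measurable_rV.
  pose T := g_sigma_algebraType G.
  suff mid : measurable_fun [set: T] (id : T -> 'rV[R]_n).
    by move=> A mA; have := mid measurableT A mA; rewrite setTI.
  apply/measurable_fun_coordP => i.
  (* A closed half-space is unbounded, hence it is recovered as the union of its traces on the balls
     [g k]. *)
  apply: (measurability _ (RGenCInfty.measurableE R)) => //= _ [_ [a ->] <-].
  rewrite setTI (_ : _ @^-1` _ = \bigcup_k ([set x : 'rV[R]_n | a <= x ord0 i] `&` g k)); last first.
    apply/seteqP; split => x /=; rewrite ?in_itv/= ?andbT; last by case=> k _ [].
    move=> ax; exists (Num.truncn `|x|).+1 => //; split => //=.
    by apply: ltW; exact: truncnS_gt.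
  apply: (@bigcupT_measurable _ T) => k; apply: sub_sigma_algebra; split.
    apply: closedI; last exact: closed_norm_le.
    rewrite (_ : [set _ | _] = (fun x : 'rV[R]_n => x ord0 i) @^-1` [set y | a <= y])//.
    by apply: closed_comp; [move=> x _; exact: coord_continuous|exact: closed_ge].
  by exists k%:R => x [].
- move=> A B [cA [r Ar]] [cB _]; split; first exact: closedI.
  by exists r => x [/Ar].
- apply/seteqP; split => // x _; exists (Num.truncn `|x|).+1 => //=.
  by apply: ltW; exact: truncnS_gt.
- by move=> C [cC [r Cr]]; exact: (m12 C r).
- by move=> k; exact: m1oo.
Qed.

Lemma heat_kernel_tail n t (y : 'rV[R]_n) (de : R) : 0 < t -> 0 < de ->
  (\int[lebesgue_rV R n]_(x in [set x | (de <= `|x - y|)%R]) (heat_kernel t (x - y))%:E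
   <= (2 `^ (n%:R / 2) * (8 / de ^+ 2) * t)%:E)%E.
Proof.
move=> t0 d0.
have mS : measurable [set x : 'rV[R]_n | de <= `|x - y|].
  rewrite (_ : [set _ | _] = ~` ball y de); first by apply: measurableC; exact: measurable_rV_ball.
  by apply/seteqP; split => x; rewrite -ball_normE /= distrC leNgt => /negP.
have c0 : 0 <= 2 `^ (n%:R / 2) * (8 / de ^+ 2) * t :> R.
  by rewrite !mulr_ge0 ?powR_ge0 ?invr_ge0 ?sqr_ge0// ltW.
have mk u : measurable_fun setT (fun x : 'rV[R]_n => (heat_kernel u (x - y))%:E).
  by apply/measurable_EFinP; apply: measurable_heat_kernelB.
apply: (@le_trans _ _ (\int[lebesgue_rV R n]_x ((2 `^ (n%:R / 2) * (8 / de ^+ 2) * t)%:E *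
    (heat_kernel (2 * t) (x - y))%:E))%E); last first.
  rewrite ge0_integralZl_EFin//.
  - by rewrite integral_heat_kernel ?mulr_gt0// mule1.
  - by move=> x _; rewrite lee_fin heat_kernel_ge0.
apply: (@le_trans _ _ (\int[lebesgue_rV R n]_(x in [set x | (de <= `|x - y|)%R])
    ((2 `^ (n%:R / 2) * (8 / de ^+ 2) * t)%:E * (heat_kernel (2 * t) (x - y))%:E))%E); last first.
  apply: ge0_subset_integral => //.
  - by apply: measurable_funeM; exact: mk.
  - by move=> x _; rewrite mule_ge0// lee_fin heat_kernel_ge0.
apply: ge0_le_integral => //.
- by move=> x _; rewrite lee_fin heat_kernel_ge0.
- exact: measurable_funTS.
- by apply: measurable_funTS; apply: measurable_funeM; exact: mk.
move=> x /= dx; rewrite -EFinM lee_fin; set z := x - y in dx *.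
have dz : de ^+ 2 <= euclid_norm z ^+ 2.
  by rewrite lerXn2r ?nnegrE ?euclid_norm_ge0 ?(ltW d0)// (le_trans dx)// le_norm_euclid_norm.
rewrite /heat_kernel (_ : 4 * pi * (2 * t) = 2 * (4 * pi * t)); last by ring.
rewrite [in leRHS]powRM ?mulr_ge0 ?pi_ge0 ?(ltW t0)//.
set e2 := euclid_norm z ^+ 2 in dz *; set P := (4 * pi * t) `^ _.
rewrite [leRHS](_ : _ = P * (8 / de ^+ 2 * t * expR (- (e2 / (4 * (2 * t)))))); last first.
  have := @powRD R 2 (n%:R / 2) (- (n%:R / 2)).
  rewrite subrr powRr0 eqxx implyTb /= => /(_ (negbT (gt_eqF (ltr0n R 2)))) H.
  transitivity ((2 `^ (n%:R / 2) * 2 `^ (- (n%:R / 2))) * P * (8 / de ^+ 2 * t * expR (- (e2 / (4 * (2 * t)))))).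
    by ring.
  by rewrite -H mul1r.
rewrite ler_wpM2l ?powR_ge0//.
rewrite (_ : e2 / (4 * t) = e2 / (8 * t) + e2 / (4 * (2 * t))); last by field; rewrite gt_eqF.
rewrite opprD expRD ler_wpM2r ?expR_ge0//.
have u0 : 0 < de ^+ 2 / (8 * t) by rewrite divr_gt0 ?exprn_gt0// mulr_gt0.
rewrite (_ : 8 / de ^+ 2 * t = (de ^+ 2 / (8 * t))^-1); last first.
  by field; rewrite !gt_eqF.
rewrite expRN lef_pV2 ?posrE ?expR_gt0//.
apply: (@le_trans _ _ (e2 / (8 * t))).
  by rewrite ler_wpM2r// invr_ge0 mulr_ge0// ltW.
by apply: le_trans (expR_ge1Dx _); rewrite lerDr.
Qed.

End rV_borel.

(** * Square integrable functions *)

Section square_integral.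
Context d (T : measurableType d) (R : realType).
Variable mu : {measure set T -> \bar R}.
Implicit Types f g : T -> R.
Local Open Scope ereal_scope.

(** The squared L^2 norm, kept as an integral so that squares can be expanded and Tonelli applied;
    [Lnorm2_sqr] is the link with the norm. *)
Definition sqint f := \int[mu]_x ((f x) ^+ 2)%:E.

Lemma sqint_ge0 f : 0 <= sqint f.
Proof. by apply: integral_ge0 => x _; rewrite lee_fin sqr_ge0. Qed.

Lemma Lnorm2_sqr f : 'N[mu]_2%:E[EFin \o f] ^+ 2 = sqint f.
Proof.
have p2 (z : \bar R) : 0 <= z -> z `^ 2 = z ^+ 2.
  case: z => [r|_|//]; last by rewrite poweRyr.
  by move=> r0; rewrite poweR_EFin expe2 -EFinM (@powR_mulrn _ r 2).
rewrite -p2 ?Lnorm_ge0// powR_Lnorm//; apply: eq_integral => x _.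
by rewrite p2// expe2 -EFinM -expr2 real_normK ?num_real.
Qed.

Lemma sqint_finite_norm f : sqint f < +oo -> finite_norm mu 2%:E f.
Proof.
rewrite -Lnorm2_sqr /finite_norm; have := Lnorm_ge0 mu 2%:E (EFin \o f).
by case: ('N[mu]_2%:E[EFin \o f]) => [r _ _| |//]; rewrite ?ltry// expe2 mulyy.
Qed.

Lemma finite_norm_sqint f : finite_norm mu 2%:E f -> sqint f < +oo.
Proof.
rewrite -Lnorm2_sqr /finite_norm; have := Lnorm_ge0 mu 2%:E (EFin \o f).
by case: ('N[mu]_2%:E[EFin \o f]) => // r _ _; rewrite expe2 -EFinM ltry.
Qed.

Lemma sqintN f g : sqint (fun x => f x - g x)%R = sqint (fun x => g x - f x)%R.
Proof. by apply: eq_integral => x _; rewrite -sqrrN opprB. Qed.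

Lemma measurable_sqr f : measurable_fun setT f -> measurable_fun setT (fun x => ((f x) ^+ 2)%:E).
Proof. by move=> mf; apply/measurable_EFinP; exact: measurable_funX. Qed.

Lemma sqint_sub f g (a b c : R) : measurable_fun setT f -> measurable_fun setT g ->
  (forall x, 0 <= f x)%R -> (forall x, 0 <= g x)%R ->
  sqint f = a%:E -> \int[mu]_x (f x * g x)%:E = b%:E -> sqint g = c%:E ->
  sqint (fun x => f x - g x)%R = (a - 2 * b + c)%:E.
Proof.
move=> mf mg f0 g0 fa fb gc.
(* The cross term stands on the left, so that only integrals of nonnegative functions are added. *)
have : sqint (fun x => f x - g x)%R + (2 * b)%:E = (a + c)%:E.
  rewrite !EFinD -fa -gc EFinM -fb -ge0_integralZl_EFin//; last 2 first.
  - by move=> x _; rewrite lee_fin mulr_ge0.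
  - by apply/measurable_EFinP; exact: measurable_funM.
  rewrite -ge0_integralD//; last 4 first.
  - by move=> x _; rewrite lee_fin sqr_ge0.
  - by apply: measurable_sqr; exact: measurable_funB.
  - by move=> x _; rewrite mule_ge0 ?lee_fin ?mulr_ge0.
  - by apply: measurable_funeM; apply/measurable_EFinP; exact: measurable_funM.
  rewrite -ge0_integralD//; last 4 first.
  - by move=> x _; rewrite lee_fin sqr_ge0.
  - exact: measurable_sqr.
  - by move=> x _; rewrite lee_fin sqr_ge0.
  - exact: measurable_sqr.
  by apply: eq_integral => x _; rewrite -EFinM -!EFinD; congr EFin; ring.
have := sqint_ge0 (fun x => f x - g x)%R.
case: (sqint _) => // r _; rewrite -EFinD => -[h]; congr EFin.
by lra.
Qed.

Lemma Lnorm2_sub_triangle f g (h : T -> R) : measurable_fun setT f -> measurable_fun setT g -> measurable_fun setT h ->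
  'N[mu]_2%:E[EFin \o (fun x => f x - h x)%R] <=
  'N[mu]_2%:E[EFin \o (fun x => f x - g x)%R] + 'N[mu]_2%:E[EFin \o (fun x => g x - h x)%R].
Proof.
move=> mf mg mh.
have := @eminkowski _ _ _ mu (fun x => f x - g x)%R (fun x => g x - h x)%R 2%:E.
rewrite (_ : (fun x => f x - g x)%R \+ (fun x => g x - h x)%R = (fun x => f x - h x))%R; last first.
  by apply/funext => x /=; rewrite addrA subrK.
by apply; [exact: measurable_funB|exact: measurable_funB|rewrite lee_fin ler1n].
Qed.

Lemma sqint_cvg0 (F : nat -> T -> R) :
  (forall e : R, (0 < e)%R -> exists N, forall n, (N <= n)%N -> sqint (F n) <= e%:E) ->
  'N[mu]_2%:E[EFin \o F n] @[n --> \oo] --> 0.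
Proof.
move=> H; apply/fine_cvgP; split.
  have [N hN] := H 1%R ltr01; exists N => // n /= Nn.
  rewrite ge0_fin_numE ?Lnorm_ge0//; apply: sqint_finite_norm.
  by apply: le_lt_trans (hN _ Nn) _; rewrite ltry.
apply/cvgrPdist_le => e e0; have [N hN] := H (e ^+ 2)%R (exprn_gt0 _ e0).
exists N => // n /= Nn; have := hN _ Nn.
rewrite sub0r normrN -Lnorm2_sqr.
have := Lnorm_ge0 mu 2%:E (EFin \o F n).
case: ('N[mu]_2%:E[EFin \o F n]) => //= r r0.
rewrite -EFinM lee_fin -expr2 ger0_norm ?lee_fin//; move: r0; rewrite lee_fin; nra.
Qed.

(** The norm is 1-Lipschitz; both inequalities are the triangle inequality with the zero function as
    third point. *)
Lemma cvg_sqint (F : nat -> T -> R) f : (forall n, measurable_fun setT (F n)) ->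
  measurable_fun setT f -> sqint f < +oo ->
  (forall e : R, (0 < e)%R -> exists N, forall n, (N <= n)%N -> sqint (fun x => F n x - f x)%R <= e%:E) ->
  sqint (F n) @[n --> \oo] --> sqint f.
Proof.
move=> mF mf foo H.
have N0 := sqint_cvg0 H.
have fN : 'N[mu]_2%:E[EFin \o f] \is a fin_num.
  by rewrite ge0_fin_numE ?Lnorm_ge0//; exact: sqint_finite_norm.
have sub0 g : (fun x => g x - cst 0 x)%R = g by apply/funext => x /=; rewrite subr0.
have m0 : measurable_fun setT (cst 0%R : T -> R) by [].
have subN g : 'N[mu]_2%:E[EFin \o (fun x => f x - g x)%R] = 'N[mu]_2%:E[EFin \o (fun x => g x - f x)%R].
  rewrite -[RHS]oppe_Lnorm; congr Lnorm; apply/funext => x /=.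
  by rewrite opprB.
have NF : 'N[mu]_2%:E[EFin \o F n] @[n --> \oo] --> 'N[mu]_2%:E[EFin \o f].
  have /fine_cvgP[[M _ Hf] Nc] := N0.
  rewrite -(fineK fN); apply/fine_cvgP; split.
    exists M => // n Mn; have /= := Hf n Mn.
    rewrite !ge0_fin_numE ?Lnorm_ge0// => h.
    have := Lnorm2_sub_triangle (mF n) mf m0; rewrite !sub0.
    by move=> /le_lt_trans; apply; rewrite lte_add_pinfty// -ge0_fin_numE ?Lnorm_ge0.
  apply/cvgrPdist_le => e e0; move/cvgrPdist_le: Nc => /(_ e e0)[M2 _ HM2].
  exists (maxn M M2) => // n /=; rewrite geq_max => /andP[Mn M2n].
  have := HM2 n M2n; have := Hf n Mn; rewrite /= sub0r normrN.
  have := Lnorm2_sub_triangle (mF n) mf m0; rewrite !sub0.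
  have := Lnorm2_sub_triangle mf (mF n) m0; rewrite !sub0 subN.
  have := Lnorm_ge0 mu 2%:E (EFin \o F n).
  have := Lnorm_ge0 mu 2%:E (EFin \o (fun x => F n x - f x)%R).
  case: ('N[mu]_2%:E[EFin \o (fun x => F n x - f x)%R]) => //= r r0.
  move: fN; case: ('N[mu]_2%:E[EFin \o f]) => //= s _.
  case: ('N[mu]_2%:E[EFin \o F n]) => //= t _.
  rewrite -!EFinD !lee_fin => h1 h2 _; rewrite ger0_norm// => h3.
  rewrite ler_norml; apply/andP; split; lra.
rewrite (_ : (fun n => sqint (F n)) = (fun n => 'N[mu]_2%:E[EFin \o F n] * 'N[mu]_2%:E[EFin \o F n])); last first.
  by apply/funext => n; rewrite -Lnorm2_sqr expe2.
rewrite -Lnorm2_sqr expe2.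
by apply: cvgeM => //; rewrite mule_def_fin.
Qed.

(** Pointwise, 2 f^2 + 2 (f - g)^2 - g^2 is the square of 2 f - g. *)
Lemma sqint_lty_sub f g : measurable_fun setT f -> measurable_fun setT g ->
  sqint f < +oo -> sqint (fun x => f x - g x)%R < +oo -> sqint g < +oo.
Proof.
move=> mf mg foo fgoo.
have m1 := measurable_sqr mf.
have m2 : measurable_fun setT (fun x => ((f x - g x) ^+ 2)%:E).
  by apply: (measurable_sqr (f := fun x => f x - g x)%R); exact: measurable_funB.
apply: (@le_lt_trans _ _ (2%:E * sqint f + 2%:E * sqint (fun x => f x - g x)%R)).
  rewrite -!ge0_integralZl_EFin//; try by move=> x _; rewrite lee_fin sqr_ge0.
  rewrite -ge0_integralD//; last 4 first.
  - by move=> x _; rewrite mule_ge0// lee_fin sqr_ge0.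
  - exact: measurable_funeM.
  - by move=> x _; rewrite mule_ge0// lee_fin sqr_ge0.
  - exact: measurable_funeM.
  apply: ge0_le_integral => //.
  - by move=> x _; rewrite lee_fin sqr_ge0.
  - exact: measurable_sqr.
  - by apply: emeasurable_funD; exact: measurable_funeM.
  - move=> x _; rewrite -!EFinM -EFinD lee_fin -subr_ge0.
    rewrite (_ : _ - _ = (2 * f x - g x) ^+ 2)%R ?sqr_ge0//; ring.
by rewrite lte_add_pinfty// lte_mul_pinfty// ?lee_fin.
Qed.

Lemma le_sqint_pointwise (a b e : R) : (0 < e)%R -> (a <= b + e + (b - a) ^+ 2 / e)%R.
Proof.
move=> e0; rewrite -subr_ge0; set u := (a - b)%R; rewrite (_ : (b - a) ^+ 2 = u ^+ 2)%R; last by rewrite /u; ring.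
rewrite (_ : _ - a = e - u + u ^+ 2 / e)%R; last by rewrite /u; ring.
rewrite (_ : _ + _ = ((e - u / 2) ^+ 2 + 3 / 4 * u ^+ 2) / e)%R; last by field; rewrite gt_eqF.
by rewrite divr_ge0 ?(ltW e0)// addr_ge0 ?sqr_ge0// mulr_ge0 ?sqr_ge0.
Qed.

Lemma le_integral_sqint f g (U : set T) (e : R) : measurable U -> (0 < e)%R ->
  measurable_fun setT f -> measurable_fun setT g ->
  (forall x, 0 <= f x)%R -> (forall x, 0 <= g x)%R ->
  \int[mu]_(x in U) (f x)%:E <=
  \int[mu]_(x in U) (g x)%:E + e%:E * mu U + e^-1%:E * sqint (fun x => g x - f x)%R.
Proof.
move=> mU e0 mf mg f0 g0.
have m2 : measurable_fun setT (fun x => ((g x - f x) ^+ 2)%:E).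
  by apply: (measurable_sqr (f := fun x => g x - f x)%R); exact: measurable_funB.
have ei0 : (0 <= e^-1)%R by rewrite invr_ge0 ltW.
apply: (@le_trans _ _ (\int[mu]_(x in U) ((g x)%:E + e%:E + e^-1%:E * ((g x - f x) ^+ 2)%:E))).
  apply: ge0_le_integral => //.
  - by move=> x _; rewrite lee_fin.
  - by apply/measurable_EFinP; exact: measurable_funTS.
  - apply: emeasurable_funD.
      by apply: emeasurable_funD => //; apply/measurable_EFinP; exact: measurable_funTS.
    by apply: measurable_funeM; exact: measurable_funTS.
  - move=> x _; rewrite -EFinM -!EFinD lee_fin mulrC; exact: le_sqint_pointwise.
rewrite ge0_integralD//; last 4 first.
- by move=> x _; rewrite adde_ge0// lee_fin// ltW.
- by apply: emeasurable_funD => //; apply/measurable_EFinP; exact: measurable_funTS.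
- by move=> x _; rewrite mule_ge0// lee_fin ?sqr_ge0.
- by apply: measurable_funeM; exact: measurable_funTS.
rewrite ge0_integralD//; last 3 first.
- by move=> x _; rewrite lee_fin.
- by apply/measurable_EFinP; exact: measurable_funTS.
- by move=> x _; rewrite lee_fin ltW.
rewrite (integral_cst mu mU e%:E) leeD2l//.
rewrite ge0_integralZl_EFin//; last 2 first.
- by move=> x _; rewrite lee_fin sqr_ge0.
- exact: measurable_funTS.
apply: lee_pmul => //; first by apply: integral_ge0 => x _; rewrite lee_fin sqr_ge0.
by apply: ge0_subset_integral => // x _; rewrite lee_fin sqr_ge0.
Qed.

Lemma limn_einf_ge0 (u : nat -> \bar R) : (forall n, 0 <= u n) -> 0 <= limn_einf u.
Proof.
move=> u0; rewrite limn_einf_lim; apply: lime_ge; first exact: is_cvg_einfs.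
by apply: nearW => n; apply: le_ereal_inf_tmp => _ [m _ <-].
Qed.

Lemma limn_esup_le_near (u : nat -> \bar R) l N : (forall n, (N <= n)%N -> u n <= l) ->
  limn_esup u <= l.
Proof.
move=> ul; rewrite limn_esup_lim; apply: lime_le; first exact: is_cvg_esups.
exists N => // j /= Nj; apply: ge_ereal_sup => _ [m /= jm <-].
by apply: ul; exact: leq_trans jm.
Qed.

(** The Riesz-Fischer argument, carried out on functions so that the limit is measurable and
    nonnegative everywhere. *)
Lemma L2_complete (F : nat -> T -> R) : (forall n, measurable_fun setT (F n)) ->
  (forall n x, 0 <= F n x)%R ->
  (forall e : R, (0 < e)%R -> exists N, forall m n, (N <= m)%N -> (N <= n)%N ->
     sqint (fun x => F m x - F n x)%R <= e%:E) ->
  exists L : T -> R, [/\ measurable_fun setT L, (forall x, 0 <= L x)%R &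
    forall e : R, (0 < e)%R -> exists N, forall n, (N <= n)%N ->
     sqint (fun x => F n x - L x)%R <= e%:E].
Proof.
move=> mF F0 CF.
have e8 j : (0 < (8 ^+ j)^-1 :> R)%R by rewrite invr_gt0 exprn_gt0.
have [phi hphi] := choice (fun j => CF _ (e8 j)).
(* The sum makes [k j] at least [j] and at least [phi i] for all [i <= j], so the consecutive terms
   [F (k j)] and [F (k j.+1)] are within [(8 ^+ j)^-1] in squared norm. *)
pose k j := (j + \sum_(i < j.+1) phi i)%N.
have kphi j i : (i <= j)%N -> (phi i <= k j)%N.
  move=> ij; rewrite /k (bigD1 (Ordinal (ij : (i < j.+1)%N)))//=.
  by rewrite addnCA leq_addr.
have kle j : (j <= k j)%N by exact: leq_addr.
pose g j := F (k j).
pose D j x := (g j.+1 x - g j x)%R.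
have mD j : measurable_fun setT (D j) by exact: (measurable_funB (mF _) (mF _)).
have iD j : sqint (D j) <= ((8 ^+ j)^-1)%:E.
  by apply: hphi; [apply: kphi|apply: kphi] => //; exact: leqnSn.
(* With weights 4^j against squared steps at most 8^(-j), the integral of [S] is at most the sum of
   the 2^(-j). Where [S x] is finite, [D j x] is of order 2^(-j), and the subsequence converges. *)
pose S x := \sum_(0 <= j <oo) ((4 ^+ j)%:E * ((D j x) ^+ 2)%:E).
have S0 j x : 0 <= (4 ^+ j)%:E * ((D j x) ^+ 2)%:E.
  by apply: mule_ge0; rewrite lee_fin; [exact: exprn_ge0|exact: sqr_ge0].
have mS : measurable_fun setT S.
  by apply: ge0_emeasurable_sum => // j _; apply: measurable_funeM; exact: measurable_sqr.
have iS : mu.-integrable setT S.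
  apply/integrableP; split => //.
  under eq_integral do rewrite gee0_abs ?nneseries_ge0//.
  rewrite integral_nneseries//; last first.
    by move=> j; apply: measurable_funeM; exact: measurable_sqr.
  apply: (@le_lt_trans _ _ (\sum_(0 <= j <oo) (2 / (2 ^ (j + 1))%:R)%:E)); last first.
    have := @cvg_geometric_eseries_half R 2 0.
    by move=> /cvg_lim -> //; rewrite ltry.
  apply: lee_nneseries => [j _ _|j _]; first by apply: integral_ge0 => x _; exact: S0.
  rewrite ge0_integralZl_EFin ?exprn_ge0//; last 2 first.
  - by move=> x _; rewrite lee_fin sqr_ge0.
  - exact: measurable_sqr.
  apply: le_trans (lee_wpmul2l _ (iD j)) _; first by rewrite lee_fin exprn_ge0.
  rewrite -EFinM lee_fin natrX addn1 (_ : 8 = 4 * 2)%R; last by ring.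
  rewrite exprMn invfM mulrA divff ?mul1r; last by rewrite expf_neq0.
  by rewrite exprS invfM mulrA divff ?mul1r.
have aeS := integrable_ae measurableT iS.
(* An upper limit is measurable without any convergence; [fine] gives the value 0 at the points
   where it is infinite. *)
pose L x := fine (limn_esup (fun j => (g j x)%:E)).
have cvg_g : {ae mu, forall x, setT x -> g j x @[j --> \oo] --> L x}.
  apply: filterS aeS => x /(_ I) Sfin _.
  have [M hM] : exists M : R, S x = M%:E by exists (fine (S x)); rewrite fineK.
  have bD j : (`|D j x| <= (1 + M) * (2^-1) ^+ j)%R.
    have h1 : ((4 ^+ j) * (D j x) ^+ 2 <= M)%R.
      rewrite -lee_fin -hM /S EFinM.
      have := @nneseries_lim_ge R (fun j => (4 ^+ j)%:E * ((D j x) ^+ 2)%:E) xpredT 0 j.+1.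
      move=> /(_ (fun n _ _ => S0 n x)); apply: le_trans.
      by rewrite big_nat_recr//= leeDr// sume_ge0.
    have M0 : (0 <= M)%R by apply: le_trans h1; apply: mulr_ge0; [exact: exprn_ge0|exact: sqr_ge0].
    rewrite exprVn ler_pdivlMr ?exprn_gt0//.
    have h2 : ((`|D j x| * 2 ^+ j) ^+ 2 <= M)%R.
      rewrite exprMn real_normK ?num_real// -exprM mulnC exprM mulrC.
      by rewrite (_ : 2 ^+ 2 = 4 :> R)%R//; ring.
    have h3 : (0 <= `|D j x| * 2 ^+ j)%R by rewrite mulr_ge0 ?exprn_ge0.
    by nra.
  have cS : cvgn (series (D^~ x)).
    apply: normed_cvg; apply: (@series_le_cvg _ _ (geometric (1 + M)%R (2^-1)%R)).
    - by move=> j; exact: normr_ge0.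
    - by move=> j /=; apply: le_trans (bD j); exact: normr_ge0.
    - by move=> j; exact: bD.
    - by apply: is_cvg_geometric_series; rewrite ger0_norm// invf_lt1 ?ltr1n.
  have cg : cvgn (g^~ x).
    have -> : g^~ x = (fun n => g 0%N x + series (D^~ x) n)%R.
      by apply/funext => n; exact: (eq_sum_telescope (g^~ x) n).
    by apply: is_cvgD => //; exact: is_cvg_cst.
  have cE : (g j x)%:E @[j --> \oo] --> (limn (g^~ x))%:E.
    by apply: cvg_EFin; [exact: nearW|exact: cg].
  have [_ h] := cvg_limn_einf_sup cE.
  by rewrite /L h.
have mL : measurable_fun setT L.
  apply: measurableT_comp; first exact: fine_measurable.
  by apply: measurable_fun_limn_esup => j; apply/measurable_EFinP; exact: mF.
have L0 x : (0 <= L x)%R.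
  apply: fine_ge0; apply: le_trans (limn_einf_sup _).
  by apply: limn_einf_ge0 => n; rewrite lee_fin F0.
exists L; split => // e e0.
have [N hN] := CF e e0; exists N => n Nn.
(* Fatou's lemma along the subsequence transfers the Cauchy bound to the limit, for the whole
   sequence. *)
pose h j x := ((F n x - g j x) ^+ 2)%:E.
have mh j : measurable_fun setT (h j).
  by apply: (measurable_sqr (f := fun x => F n x - g j x)%R); exact: (measurable_funB (mF _) (mF _)).
apply: (@le_trans _ _ (\int[mu]_x limn_einf (h^~ x))).
  apply: ae_ge0_le_integral => //.
  - by move=> x _; rewrite lee_fin sqr_ge0.
  - by apply: (measurable_sqr (f := fun x => F n x - L x)%R); exact: measurable_funB.
  - by move=> x _; apply: limn_einf_ge0 => j; rewrite lee_fin sqr_ge0.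
  - rewrite (_ : (fun x => _) = (fun x => - limn_esup (fun j => - h j x)))//.
    apply: measurableT_comp => //; apply: measurable_fun_limn_esup => j.
    by apply: measurableT_comp => //; exact: mh.
  - apply: filterS cvg_g => x /(_ I) gx _.
    have hx : h j x @[j --> \oo] --> ((F n x - L x) ^+ 2)%:E.
      apply: cvg_EFin; first exact: nearW.
      rewrite /comp /h /=.
      have c1 : (F n x - g j x)%R @[j --> \oo] --> (F n x - L x)%R.
        by apply: cvgB => //; exact: cvg_cst.
      by rewrite expr2; apply: cvgM.
    by have [-> _] := cvg_limn_einf_sup hx.
apply: (le_trans (fatou mu measurableT mh _)).
  by move=> j x _; rewrite lee_fin sqr_ge0.
apply: (le_trans (limn_einf_sup _)); apply: (limn_esup_le_near (N := N)) => j Nj.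
by apply: hN => //; apply: leq_trans (kle j).
Qed.

End square_integral.

(** * Heat smoothing of a finite measure and its energy *)

Section parametric_integral.
Local Open Scope ereal_scope.
Context d1 d2 (T1 : measurableType d1) (T2 : measurableType d2) (R : realType).
Variables (m1 : {sigma_finite_measure set T1 -> \bar R}).
Variables (m2 : {sigma_finite_measure set T2 -> \bar R}).
Variable f : T1 -> T2 -> \bar R.
Hypothesis mf : measurable_fun setT (fun p => f p.1 p.2).
Hypothesis f0 : forall x y, 0 <= f x y.

Lemma measurable_integral_snd : measurable_fun setT (fun x => \int[m2]_y f x y).
Proof.
by have := @measurable_fun_fubini_tonelli_F _ _ T1 T2 R m2 (fun p => f p.1 p.2) mf (fun p => f0 p.1 p.2).
Qed.

Lemma measurable_integral_fst : measurable_fun setT (fun y => \int[m1]_x f x y).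
Proof.
by have := @measurable_fun_fubini_tonelli_G _ _ T1 T2 R m1 (fun p => f p.1 p.2) mf (fun p => f0 p.1 p.2).
Qed.

Lemma integral_swap : \int[m1]_x \int[m2]_y f x y = \int[m2]_y \int[m1]_x f x y.
Proof. by have := @fubini_tonelli _ _ T1 T2 R m1 m2 (fun p => f p.1 p.2) mf (fun p => f0 p.1 p.2). Qed.

End parametric_integral.
Arguments measurable_integral_snd {d1 d2 T1 T2 R} m2 f.
Arguments measurable_integral_fst {d1 d2 T1 T2 R} m1 f.
Arguments integral_swap {d1 d2 T1 T2 R} m1 m2 f.

Lemma integral_indicM d (T : measurableType d) (R : realType) (m : {measure set T -> \bar R})
    (A : set T) (f : T -> R) :
  (\int[m]_(x in A) (f x)%:E = \int[m]_x (\1_A x * f x)%:E)%E.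
Proof.
rewrite integral_mkcond; apply: eq_integral => x _.
by rewrite patchE indicE; case: ifPn => _; rewrite ?mul1r ?mul0r.
Qed.

Section heat_smoothing.
Context {R : realType} (n : nat).
Notation mu := (lebesgue_rV R n).
Implicit Types nu : {finite_measure set 'rV[R]_n -> \bar R}.
Local Notation U nu t := (heat_conv (distr_of_measure nu) t).
Local Open Scope ereal_scope.

Lemma finite_measure_fineK nu : (fine (nu setT))%:E = nu setT.
Proof. by rewrite fineK// fin_num_measure. Qed.

Lemma measurable_heat_kernelBl t (x : 'rV[R]_n) : measurable_fun setT (fun y : 'rV[R]_n => (heat_kernel t (x - y))%:E).
Proof. by apply/measurable_EFinP; exact: measurable_heat_kernelB. Qed.

Lemma integral_heat_kernel_ub nu t x : (0 < t)%R ->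
  \int[nu]_y (heat_kernel t (x - y))%:E <= ((4 * pi * t) `^ (- (n%:R / 2)) * fine (nu setT))%:E.
Proof.
move=> t0; rewrite EFinM finite_measure_fineK -(integral_cst nu measurableT ((4 * pi * t) `^ (- (n%:R / 2)))%:E).
apply: ge0_le_integral => //.
- by move=> y _; rewrite lee_fin heat_kernel_ge0.
- exact: measurable_heat_kernelBl.
- by move=> y _; rewrite lee_fin heat_kernel_ub.
Qed.

Lemma heat_convE nu t x : (0 < t)%R -> (U nu t x)%:E = \int[nu]_y (heat_kernel t (x - y))%:E.
Proof.
move=> t0; rewrite /heat_conv /distr_of_measure fineK// ge0_fin_numE.
  by apply: le_lt_trans (integral_heat_kernel_ub nu x t0) _; rewrite ltry.
by apply: integral_ge0 => y _; rewrite lee_fin heat_kernel_ge0.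
Qed.

Lemma heat_conv_ge0 nu t x : (0 <= U nu t x)%R.
Proof. by apply: fine_ge0; apply: integral_ge0 => y _; rewrite lee_fin heat_kernel_ge0. Qed.

Lemma heat_conv_ub nu t x : (0 < t)%R ->
  (U nu t x <= (4 * pi * t) `^ (- (n%:R / 2)) * fine (nu setT))%R.
Proof. by move=> t0; rewrite -lee_fin heat_convE// integral_heat_kernel_ub. Qed.

Lemma measurable_heat_conv nu t : measurable_fun setT (U nu t).
Proof.
apply: measurableT_comp; first exact: fine_measurable.
apply: (measurable_integral_snd nu (fun x y : 'rV[R]_n => (heat_kernel t (x - y))%:E)).
  by apply/measurable_EFinP; apply: measurable_heat_kernelB.
by move=> x y; rewrite lee_fin heat_kernel_ge0.
Qed.

(** Tonelli moves the semigroup property of the kernel under the integral against [nu]. *)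
Lemma heat_conv_semigroup nu t u y : (0 < t)%R -> (0 < u)%R ->
  \int[mu]_x (heat_kernel u (x - y) * U nu t x)%:E = (U nu (u + t) y)%:E.
Proof.
move=> t0 u0.
have mk (v : R) (f g : 'rV[R]_n * 'rV[R]_n -> 'rV[R]_n) : measurable_fun setT f -> measurable_fun setT g ->
   measurable_fun setT (fun p => (heat_kernel v (f p - g p))).
  by move=> mf mg; exact: measurable_heat_kernelB.
transitivity (\int[mu]_x \int[nu]_z (heat_kernel u (x - y) * heat_kernel t (x - z))%:E).
  apply: eq_integral => x _; rewrite EFinM heat_convE//.
  rewrite -ge0_integralZl_EFin ?heat_kernel_ge0//; last exact: measurable_heat_kernelBl.
  by move=> z _; rewrite lee_fin heat_kernel_ge0.
rewrite (integral_swap mu nu (fun x z : 'rV[R]_n => (heat_kernel u (x - y) * heat_kernel t (x - z))%:E)).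
- rewrite heat_convE ?addr_gt0//; apply: eq_integral => z _.
  exact: heat_kernel_semigroup.
- by apply/measurable_EFinP; apply: measurable_funM; apply: measurable_heat_kernelB.
- by move=> x z; rewrite lee_fin mulr_ge0 ?heat_kernel_ge0.
Qed.

(** A real number, which loses nothing for [t > 0]: the kernel is bounded and [nu] is finite, see
    [energyE]. *)
Definition energy nu t : R := fine (\int[nu]_y (U nu t y)%:E).

Lemma energy_ge0 nu t : (0 <= energy nu t)%R.
Proof. by apply: fine_ge0; apply: integral_ge0 => y _; rewrite lee_fin heat_conv_ge0. Qed.

Lemma integral_heat_conv_ub nu t : (0 < t)%R ->
  \int[nu]_y (U nu t y)%:E <= ((4 * pi * t) `^ (- (n%:R / 2)) * fine (nu setT) ^+ 2)%:E.
Proof.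
move=> t0; rewrite expr2 mulrA EFinM finite_measure_fineK.
rewrite -(integral_cst nu measurableT ((4 * pi * t) `^ (- (n%:R / 2)) * fine (nu setT))%:E).
apply: ge0_le_integral => //.
- by move=> y _; rewrite lee_fin heat_conv_ge0.
- by apply/measurable_EFinP; exact: measurable_heat_conv.
- by move=> y _; rewrite lee_fin heat_conv_ub.
Qed.

Lemma energyE nu t : (0 < t)%R -> (energy nu t)%:E = \int[nu]_y (U nu t y)%:E.
Proof.
move=> t0; rewrite /energy fineK// ge0_fin_numE.
  by apply: le_lt_trans (integral_heat_conv_ub nu t0) _; rewrite ltry.
by apply: integral_ge0 => y _; rewrite lee_fin heat_conv_ge0.
Qed.

Lemma energy_ub nu t : (0 < t)%R ->
  (energy nu t <= (4 * pi * t) `^ (- (n%:R / 2)) * fine (nu setT) ^+ 2)%R.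
Proof. by move=> t0; rewrite -lee_fin energyE// integral_heat_conv_ub. Qed.

Lemma heat_conv_pairing nu t u : (0 < t)%R -> (0 < u)%R ->
  \int[mu]_x (U nu t x * U nu u x)%:E = (energy nu (t + u))%:E.
Proof.
move=> t0 u0.
have mU v : measurable_fun setT (U nu v) := measurable_heat_conv nu v.
transitivity (\int[mu]_x \int[nu]_y (heat_kernel t (x - y) * U nu u x)%:E).
  apply: eq_integral => x _; rewrite EFinM heat_convE//.
  rewrite -ge0_integralZr//.
  - exact: measurable_heat_kernelBl.
  - by move=> z _; rewrite lee_fin heat_kernel_ge0.
  - by rewrite lee_fin heat_conv_ge0.
rewrite (integral_swap mu nu (fun x z : 'rV[R]_n => (heat_kernel t (x - z) * U nu u x)%:E)).
- rewrite energyE ?addr_gt0//; apply: eq_integral => z _ /=.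
  exact: heat_conv_semigroup.
- apply/measurable_EFinP; apply: measurable_funM; first exact: measurable_heat_kernelB.
  exact: measurableT_comp.
- by move=> x z; rewrite lee_fin mulr_ge0 ?heat_kernel_ge0 ?heat_conv_ge0.
Qed.

Lemma sqint_heat_conv nu t : (0 < t)%R -> sqint mu (U nu t) = (energy nu (t + t))%:E.
Proof.
by move=> t0; rewrite -heat_conv_pairing.
Qed.

Lemma sqint_heat_conv_sub nu t u : (0 < t)%R -> (0 < u)%R ->
  sqint mu (fun x => U nu t x - U nu u x)%R =
  (energy nu (t + t) - 2 * energy nu (t + u) + energy nu (u + u))%:E.
Proof.
move=> t0 u0; apply: sqint_sub; rewrite ?sqint_heat_conv ?heat_conv_pairing//.
- exact: measurable_heat_conv.
- exact: measurable_heat_conv.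
- exact: heat_conv_ge0.
- exact: heat_conv_ge0.
Qed.

End heat_smoothing.

Section midpoint_convex.
Context {R : realType}.

(* Otherwise the increments over steps of a fixed length, which do not decrease, make G unbounded. *)
Lemma midconvex_bounded_nonincreasing (G : R -> R) :
  (forall t u, 0 < t -> 0 < u -> 2 * G (t + u) <= G (t + t) + G (u + u)) ->
  (forall a, 0 < a -> exists M, forall t, a <= t -> G t <= M) ->
  forall s t, 0 < s -> s <= t -> G t <= G s.
Proof.
move=> cG bG s t s0 st; rewrite leNgt; apply/negP => Gst.
pose h := t - s; pose e := G t - G s.
have e0 : 0 < e by rewrite subr_gt0.
have h0 : 0 <= h by rewrite subr_ge0.
have step k : e <= G (s + k.+1%:R * h) - G (s + k%:R * h).
  elim: k => [|k ih]; first by rewrite mul0r addr0 mul1r /e /h (_ : s + (t - s) = t)//; ring.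
  have p0 : 0 < s + k%:R * h by rewrite ltr_pwDl// mulr_ge0.
  have p2 : 0 < s + k.+2%:R * h by rewrite ltr_pwDl// mulr_ge0.
  (* Half times, since the convexity hypothesis evaluates [G] at the doubled arguments and at their
     sum. *)
  have := cG ((s + k%:R * h) / 2) ((s + k.+2%:R * h) / 2) (divr_gt0 p0 (ltr0Sn _ 1)) (divr_gt0 p2 (ltr0Sn _ 1)).
  rewrite -!splitr (_ : _ / 2 + _ / 2 = s + k.+1%:R * h); first by lra.
  by rewrite -!natr1; field.
have grow k : G s + k%:R * e <= G (s + k%:R * h).
  elim: k => [|k ih]; first by rewrite !mul0r !addr0.
  have -> : k.+1%:R * e = k%:R * e + e by rewrite -natr1; ring.
  by have := step k; move: ih; move: (G _) (G (s + k.+1%:R * h)) => a b; lra.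
have [M hM] := bG s s0.
(* After this many steps the accumulated growth exceeds [M - G s]. *)
have := hM (s + (Num.truncn ((M - G s) / e)).+1%:R * h).
rewrite lerDl mulr_ge0// => /(_ isT).
have := grow (Num.truncn ((M - G s) / e)).+1.
have := truncnS_gt ((M - G s) / e); rewrite ltr_pdivrMr//; lra.
Qed.

(** The limit at 0 of a nonincreasing function is the supremum of its values. A bound along
    [k.+1%:R^-1] is what the almost sure statement on the energies provides. *)
Lemma nonincreasing_bounded_limit0 (G : R -> R) (M : R) :
  (forall s t, 0 < s -> s <= t -> G t <= G s) ->
  (forall k : nat, G k.+1%:R^-1 <= M) ->
  exists l : R, (forall t, 0 < t -> G t <= l) /\
    forall e, 0 < e -> exists2 de, 0 < de & forall t, 0 < t -> t <= de -> l - e <= G t.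
Proof.
move=> dG bG.
pose S := [set G t | t in [set t | 0 < t]].
have ubS : ubound S M.
  move=> _ [t /= t0 <-].
  have [k hk] : exists k : nat, k.+1%:R^-1 < t.
    by have [k] := ltr_add_invr t0; rewrite add0r => ?; exists k.
  by apply: le_trans (bG k); apply: dG (ltW hk); rewrite invr_gt0.
have supS : has_sup S.
  by split; [exists (G 1); exists 1 => //=; exact: ltr01|exists M].
exists (sup S); split => [t t0|e e0].
  by apply: ub_le_sup; [exists M|exists t].
have [_ [de /= d0 <-] hd] := sup_adherent e0 supS.
by exists de => // t t0 td; apply: le_trans (ltW hd) _; exact: dG.
Qed.

End midpoint_convex.

(** * From bounded energy to a density *)

Section smoothed_mass.
Context {R : realType} (n : nat).
Notation mu := (lebesgue_rV R n).
Variable nu : {finite_measure set 'rV[R]_n -> \bar R}.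
Local Notation U t := (heat_conv (distr_of_measure nu) t).
Local Open Scope ereal_scope.
Local Notation K de := (2 `^ (n%:R / 2) * (8 / de ^+ 2))%R.

Lemma integral_heat_conv_swap (A : set 'rV[R]_n) t : measurable A -> (0 < t)%R ->
  \int[mu]_(x in A) (U t x)%:E = \int[nu]_y \int[mu]_(x in A) (heat_kernel t (x - y))%:E.
Proof.
move=> mA t0.
have mI : measurable_fun setT (\1_A : 'rV[R]_n -> R) by exact: measurable_indic.
transitivity (\int[mu]_x \int[nu]_y (\1_A x * heat_kernel t (x - y))%:E).
  rewrite integral_indicM; apply: eq_integral => x _.
  under [RHS]eq_integral do rewrite EFinM.
  rewrite ge0_integralZl_EFin//; last 2 first.
  - by move=> y _; rewrite lee_fin heat_kernel_ge0.
  - exact: measurable_heat_kernelBl.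
  by rewrite -heat_convE.
rewrite (integral_swap mu nu (fun x y : 'rV[R]_n => (\1_A x * heat_kernel t (x - y))%:E)).
- by apply: eq_integral => y _; rewrite [RHS]integral_indicM.
- apply/measurable_EFinP; apply: measurable_funM; last exact: measurable_heat_kernelB.
  exact: measurableT_comp.
- by move=> x y; rewrite lee_fin mulr_ge0 ?heat_kernel_ge0.
Qed.

Lemma measurable_integral_heat_kernel (A : set 'rV[R]_n) t : measurable A ->
  measurable_fun setT (fun y : 'rV[R]_n => \int[mu]_(x in A) (heat_kernel t (x - y))%:E).
Proof.
move=> mA; under eq_fun do rewrite integral_indicM.
apply: (measurable_integral_fst mu (fun x y : 'rV[R]_n => (\1_A x * heat_kernel t (x - y))%:E)).
  apply/measurable_EFinP; apply: measurable_funM; last exact: measurable_heat_kernelB.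
  by apply: measurableT_comp => //; exact: measurable_indic.
by move=> x y; rewrite lee_fin mulr_ge0 ?heat_kernel_ge0.
Qed.

Lemma integral_heat_kernel_le1 (A : set 'rV[R]_n) t y : measurable A -> (0 < t)%R ->
  \int[mu]_(x in A) (heat_kernel t (x - y))%:E <= 1.
Proof.
move=> mA t0; rewrite -(integral_heat_kernel y t0); apply: ge0_subset_integral => //.
- by apply/measurable_EFinP; exact: measurable_heat_kernelB.
- by move=> x _; rewrite lee_fin heat_kernel_ge0.
Qed.

Lemma integral_heat_kernel_far (A : set 'rV[R]_n) t de y : measurable A -> (0 < t)%R -> (0 < de)%R ->
  (forall x, A x -> de <= `|x - y|)%R ->
  \int[mu]_(x in A) (heat_kernel t (x - y))%:E <= (K de * t)%:E.
Proof.
move=> mA t0 d0 Ay; apply: le_trans (heat_kernel_tail y t0 d0).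
apply: ge0_subset_integral => //.
- rewrite (_ : [set _ | _] = ~` ball y de); first by apply: measurableC; exact: measurable_rV_ball.
  by apply/seteqP; split => x; rewrite -ball_normE /= distrC leNgt => /negP.
- by apply/measurable_EFinP; apply: measurable_funTS; exact: measurable_heat_kernelB.
- by move=> x _; rewrite lee_fin heat_kernel_ge0.
Qed.

(** The left-hand side is the mass that heat started from [nu] puts in [A]. A starting point in [B]
    contributes at most 1; one outside is at distance at least [de] from [A] and contributes a tail
    of order [t]. *)
Lemma integral_heat_conv_le (A B : set 'rV[R]_n) t de : measurable A -> measurable B ->
  (0 < t)%R -> (0 < de)%R -> (forall x y, A x -> ~ B y -> de <= `|x - y|)%R ->
  \int[mu]_(x in A) (U t x)%:E <= nu B + (K de * t)%:E * nu setT.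
Proof.
move=> mA mB t0 d0 AB; rewrite integral_heat_conv_swap//.
have c0 : (0 <= K de * t)%R by rewrite !mulr_ge0 ?powR_ge0 ?invr_ge0 ?sqr_ge0// ltW.
apply: (@le_trans _ _ (\int[nu]_y ((\1_B y)%:E + (K de * t)%:E))).
  apply: ge0_le_integral => //.
  - by move=> y _; apply: integral_ge0 => x _; rewrite lee_fin heat_kernel_ge0.
  - exact: measurable_integral_heat_kernel.
  - by apply: emeasurable_funD => //; apply/measurable_EFinP; exact: measurable_indic.
  - move=> y _; rewrite indicE; have [yB|yB] := boolP (y \in B).
      by apply: (le_trans (integral_heat_kernel_le1 _ mA t0)); rewrite leeDl// lee_fin.
    rewrite add0e; apply: integral_heat_kernel_far => // x Ax.
    by apply: AB => // By; rewrite mem_set in yB.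
rewrite ge0_integralD//; last first.
  by apply/measurable_EFinP; exact: measurable_indic.
by rewrite integral_indic// setIT (integral_cst nu measurableT (K de * t)%:E).
Qed.

(** The converse comparison: heat started in [A] stays in [B] except for a tail of order [t]. *)
Lemma measure_le_integral_heat_conv (A B : set 'rV[R]_n) t de : measurable A -> measurable B ->
  (0 < t)%R -> (0 < de)%R -> (forall x y, A y -> ~ B x -> de <= `|x - y|)%R ->
  nu A <= \int[mu]_(x in B) (U t x)%:E + (K de * t)%:E * nu setT.
Proof.
move=> mA mB t0 d0 AB; rewrite integral_heat_conv_swap//.
have c0 : (0 <= K de * t)%R by rewrite !mulr_ge0 ?powR_ge0 ?invr_ge0 ?sqr_ge0// ltW.
have mF : measurable_fun setT (fun y : 'rV[R]_n => \int[mu]_(x in B) (heat_kernel t (x - y))%:E).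
  exact: measurable_integral_heat_kernel.
have F0 y : 0 <= \int[mu]_(x in B) (heat_kernel t (x - y))%:E.
  by apply: integral_ge0 => x _; rewrite lee_fin heat_kernel_ge0.
rewrite -(integral_cst nu measurableT (K de * t)%:E) -ge0_integralD//.
rewrite -[A]setIT -integral_indic//; apply: ge0_le_integral => //.
- by apply/measurable_EFinP; exact: measurable_indic.
- exact: emeasurable_funD.
move=> y _; rewrite indicE; have [yA|yA] := boolP (y \in A); last first.
  by rewrite adde_ge0.
rewrite /= -(integral_heat_kernel y t0) -(setvU B) ge0_integral_setU//.
- rewrite addeC leeD2l//; apply: integral_heat_kernel_far => //; first exact: measurableC.
  by move=> x nBx; apply: AB => //; rewrite inE in yA.
- exact: measurableC.
- by apply/measurable_EFinP; apply: measurable_funTS; exact: measurable_heat_kernelB.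
- by move=> x _; rewrite lee_fin heat_kernel_ge0.
- by apply/disj_set2P; rewrite setICl.
Qed.

End smoothed_mass.

Section bounded_energy_density.
Context {R : realType} (n : nat).
Notation mu := (lebesgue_rV R n).
Variable nu : {finite_measure set 'rV[R]_n -> \bar R}.
Local Notation U t := (heat_conv (distr_of_measure nu) t).
Local Notation K de := (2 `^ (n%:R / 2) * (8 / de ^+ 2))%R.

Lemma energy_midconvex (t u : R) : 0 < t -> 0 < u ->
  2 * energy nu (t + u) <= energy nu (t + t) + energy nu (u + u).
Proof.
move=> t0 u0.
have := sqint_ge0 mu (fun x => U t x - U u x)%R.
rewrite (sqint_heat_conv_sub nu t0 u0) lee_fin.
by move: (energy nu (t + t)) (energy nu (t + u)) (energy nu (u + u)) => a b c; lra.
Qed.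

Lemma energy_nonincreasing (s t : R) : 0 < s -> s <= t -> energy nu t <= energy nu s.
Proof.
apply: midconvex_bounded_nonincreasing; first exact: energy_midconvex.
move=> a a0; exists ((4 * pi * a) `^ (- (n%:R / 2)) * fine (nu setT) ^+ 2) => u au.
have u0 : 0 < u by exact: lt_le_trans au.
apply: le_trans (energy_ub nu u0) _; rewrite ler_wpM2r ?sqr_ge0//.
have p0 v : 0 < v -> 0 < 4 * pi * v :> R by move=> v0; rewrite !mulr_gt0// pi_gt0.
rewrite !powRN lef_pV2 ?posrE ?powR_gt0 ?p0//.
by apply: ge0_ler_powR; rewrite ?nnegrE ?divr_ge0 ?(ltW (p0 _ _))// ler_pM2l// mulr_gt0// pi_gt0.
Qed.

(* The square of the L^2 distance between two smoothings is energy (2t) - 2 energy (t + u) + energy (2u),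
   which is small near 0 since energy is monotone and bounded. *)
Lemma heat_conv_limit (M : R) : (forall k : nat, energy nu k.+1%:R^-1 <= M) ->
  exists (L : 'rV[R]_n -> R) (l : R), [/\ measurable_fun setT L, forall x, 0 <= L x,
    sqint mu L = l%:E,
    forall e : R, 0 < e -> exists N, forall k, (N <= k)%N ->
      (sqint mu (fun x => U k.+1%:R^-1 x - L x)%R <= e%:E)%E &
    (forall t, 0 < t -> energy nu t <= l) /\
    forall e, 0 < e -> exists2 de, 0 < de & forall t, 0 < t -> t <= de -> l - e <= energy nu t].
Proof.
move=> hM; have [l [ul hl]] := nonincreasing_bounded_limit0 energy_nonincreasing hM.
have k0 (k : nat) : 0 < k.+1%:R^-1 :> R by rewrite invr_gt0.
pose F (k : nat) := U k.+1%:R^-1.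
have mF k : measurable_fun setT (F k) by exact: measurable_heat_conv.
have F0 k x : 0 <= F k x by exact: heat_conv_ge0.
have small de : 0 < de -> exists N : nat, forall k, (N <= k)%N -> k.+1%:R^-1 < de :> R.
  move=> d0; have [N hN] : exists N : nat, N.+1%:R^-1 < de.
    by have [N] := ltr_add_invr d0; rewrite add0r => ?; exists N.
  by exists N => k Nk; apply: le_lt_trans hN; rewrite lef_pV2 ?posrE// ler_nat.
have CF : forall e : R, 0 < e -> exists N, forall m k, (N <= m)%N -> (N <= k)%N ->
     (sqint mu (fun x => F m x - F k x)%R <= e%:E)%E.
  (* For times [a] and [b] at most [de / 2], the energies at [2a] and [2b] are at most [l] and the
     one at [a + b] is at least [l - e / 2]; the squared distance is then at most [e]. *)
  move=> e e0; have [de d0 hd] := hl (e / 2) (divr_gt0 e0 (ltr0Sn _ 1)).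
  have [N hN] := small (de / 2) (divr_gt0 d0 (ltr0Sn _ 1)).
  exists N => m k /hN dm /hN dk; rewrite /F sqint_heat_conv_sub// lee_fin.
  have := k0 m; have := k0 k; move: dm dk; move: (m.+1%:R^-1) (k.+1%:R^-1) => a b dm dk b0 a0.
  have abd : a + b <= de by lra.
  have h1 := ul (a + a) (addr_gt0 a0 a0); have h2 := ul (b + b) (addr_gt0 b0 b0).
  have h3 : l - e / 2 <= energy nu (a + b) by apply: hd; [exact: addr_gt0|exact: abd].
  by move: h1 h2 h3; move: (energy nu (a + a)) (energy nu (a + b)) (energy nu (b + b)) => x y z; lra.
have [L [mL L0 hL]] := L2_complete mF F0 CF.
have Loo : (sqint mu L < +oo)%E.
  have [N hN] := hL 1 ltr01.
  apply: (sqint_lty_sub (mF N) mL); first by rewrite /F sqint_heat_conv// ltry.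
  by apply: le_lt_trans (hN N (leqnn N)) _; rewrite ltry.
exists L, l; split => //.
(* The squared norms of the smoothings tend to that of [L] by convergence in L^2, and to [l] because
   they are energies at times tending to 0. *)
have c1 := cvg_sqint mF mL Loo hL.
have c2 : sqint mu (F k) @[k --> \oo] --> l%:E.
  under eq_fun do rewrite /F sqint_heat_conv//.
  apply: cvg_EFin; first exact: nearW.
  rewrite /comp /=; apply/cvgrPdist_le => e e0.
  have [de d0 hd] := hl e e0; have [N hN] := small (de / 2) (divr_gt0 d0 (ltr0Sn _ 1)).
  exists N => // k /= Nk; have := hN k Nk; have := k0 k; move: (k.+1%:R^-1) => a a0 ad.
  have aad : a + a <= de by lra.
  have h1 := ul (a + a) (addr_gt0 a0 a0).
  have h2 : l - e <= energy nu (a + a) by apply: hd; [exact: addr_gt0|exact: aad].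
  by move: h1 h2; move: (energy nu (a + a)) => x h1 h2; rewrite ger0_norm; lra.
exact: (cvg_unique (@ereal_hausdorff R) c1 c2).
Qed.

Section identification.
Variables (L : 'rV[R]_n -> R) (l : R).
Hypotheses (mL : measurable_fun setT L) (L0 : forall x, 0 <= L x).
Hypothesis Ll : sqint mu L = l%:E.
Hypothesis cvgL : forall e : R, 0 < e -> exists N, forall k, (N <= k)%N ->
      (sqint mu (fun x => U k.+1%:R^-1 x - L x)%R <= e%:E)%E.
Local Open Scope ereal_scope.

Lemma integral_limit_close (C : set 'rV[R]_n) (e : R) : measurable C -> mu C < +oo -> (0 < e)%R ->
  exists N, forall k, (N <= k)%N ->
    \int[mu]_(x in C) (U k.+1%:R^-1 x)%:E <= \int[mu]_(x in C) (L x)%:E + e%:E /\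
    \int[mu]_(x in C) (L x)%:E <= \int[mu]_(x in C) (U k.+1%:R^-1 x)%:E + e%:E.
Proof.
move=> mC Coo e0.
have [c c0 hc] : exists2 c : R, (0 <= c)%R & mu C = c%:E.
  exists (fine (mu C)); first exact: fine_ge0.
  by rewrite fineK// ge0_fin_numE.
(* With this [h] and squared distance at most [h * (e / 2)], both errors of [le_integral_sqint] are
   at most [e / 2]; adding 1 to the measure [c] of [C] avoids a division by 0. *)
pose h := (e / 2 / (c + 1))%R.
have h0 : (0 < h)%R by rewrite !divr_gt0// ltr_wpDl.
have [N hN] := cvgL (mulr_gt0 h0 (divr_gt0 e0 (ltr0Sn _ 1))).
have hce : (h * c <= e / 2)%R.
  rewrite /h -mulrA ler_piMr ?divr_ge0 ?(ltW e0)// mulrC ler_pdivrMr ?mul1r ?lerDl ?ler01//.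
  by rewrite ltr_wpDl.
have R1 (f g : 'rV[R]_n -> R) : measurable_fun setT f -> measurable_fun setT g ->
  (forall x, 0 <= f x)%R -> (forall x, 0 <= g x)%R ->
  sqint mu (fun x => g x - f x)%R <= (h * (e / 2))%:E ->
  \int[mu]_(x in C) (f x)%:E <= \int[mu]_(x in C) (g x)%:E + e%:E.
  move=> mf mg f0 g0 fg; apply: le_trans (le_integral_sqint mu mC h0 mf mg f0 g0) _.
  rewrite -addeA leeD2l// [X in _ * X + _](_ : _ = c%:E)//.
  rewrite -EFinM [in leRHS](splitr e) EFinD leeD ?lee_fin//.
  apply: le_trans (lee_wpmul2l _ fg) _; first by rewrite lee_fin invr_ge0 ltW.
  by rewrite -EFinM mulKf// gt_eqF.
have mU k : measurable_fun setT (U k.+1%:R^-1) by exact: measurable_heat_conv.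
exists N => k Nk; split; apply: R1 => //; try by move=> x; exact: heat_conv_ge0.
- by rewrite sqintN; exact: hN.
- exact: hN.
Qed.

Lemma tail_small (de e : R) : (0 < e)%R -> (0 < de)%R -> exists N, forall k, (N <= k)%N ->
  (K de * k.+1%:R^-1)%:E * nu setT <= e%:E.
Proof.
move=> e0 d0; pose A := (K de * fine (nu setT))%R.
have A0 : (0 <= A)%R.
  by rewrite !mulr_ge0 ?powR_ge0 ?invr_ge0 ?sqr_ge0// fine_ge0.
exists (Num.truncn (A / e)) => k Ak; rewrite -finite_measure_fineK -EFinM lee_fin.
rewrite mulrAC -/A ler_pdivrMr// mulrC -ler_pdivrMr//.
by apply: ltW; apply: lt_le_trans (truncnS_gt _) _; rewrite ler_nat.
Qed.

(** The limit of [integral_heat_conv_le] at times [k.+1%:R^-1]: half of [e] pays for replacing the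
    smoothing by [L], the other half for the heat tail. *)
Lemma integral_limit_le (A B : set 'rV[R]_n) (de : R) : measurable A -> measurable B ->
  mu A < +oo -> (0 < de)%R -> (forall x y, A x -> ~ B y -> de <= `|x - y|)%R ->
  \int[mu]_(x in A) (L x)%:E <= nu B.
Proof.
move=> mA mB Aoo d0 AB; apply/lee_addgt0Pr => e e0.
have e20 : (0 < e / 2)%R by rewrite divr_gt0.
have [N hN] := integral_limit_close mA Aoo e20.
have [N' hN'] := tail_small e20 d0.
have [_ h] := hN (maxn N N') (leq_maxl _ _).
apply: le_trans h _; rewrite [in leRHS](splitr e) EFinD addeA leeD2r//.
have k0 : (0 < (maxn N N').+1%:R^-1 :> R)%R by rewrite invr_gt0.
apply: le_trans (integral_heat_conv_le nu mA mB k0 d0 AB) _.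
by rewrite leeD2l// hN'// leq_maxr.
Qed.

Lemma measure_le_integral_limit (A B : set 'rV[R]_n) (de : R) : measurable A -> measurable B ->
  mu B < +oo -> (0 < de)%R -> (forall x y, A y -> ~ B x -> de <= `|x - y|)%R ->
  nu A <= \int[mu]_(x in B) (L x)%:E.
Proof.
move=> mA mB Boo d0 AB; apply/lee_addgt0Pr => e e0.
have e20 : (0 < e / 2)%R by rewrite divr_gt0.
have [N hN] := integral_limit_close mB Boo e20.
have [N' hN'] := tail_small e20 d0.
have [h _] := hN (maxn N N') (leq_maxl _ _).
have k0 : (0 < (maxn N N').+1%:R^-1 :> R)%R by rewrite invr_gt0.
apply: le_trans (measure_le_integral_heat_conv nu mA mB k0 d0 AB) _.
rewrite (splitr e) EFinD addeA; apply: leeD => //.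
by rewrite hN'// leq_maxr.
Qed.

Definition density_measure (A : set 'rV[R]_n) : \bar R := \int[mu]_(x in A) (L x)%:E.

Let density0 : density_measure set0 = 0.
Proof. exact: integral_set0. Qed.

Let density_ge0 A : 0 <= density_measure A.
Proof. by apply: integral_ge0 => x _; rewrite lee_fin. Qed.

Let density_sigma_additive : semi_sigma_additive density_measure.
Proof.
move=> F mF tF mUF; rewrite /density_measure ge0_integral_bigcup//; last 2 first.
- by apply/measurable_EFinP; exact: measurable_funTS.
- by move=> x _; rewrite lee_fin.
by apply: is_cvg_ereal_nneg_natsum_cond => k _ _; exact: density_ge0.
Qed.

HB.instance Definition _ := isMeasure.Build _ _ _ density_measure density0 density_ge0 density_sigma_additive.

Lemma integral_bounded_lty (C : set 'rV[R]_n) : measurable C -> mu C < +oo -> density_measure C < +oo.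
Proof.
move=> mC Coo; apply: le_lt_trans (@le_integral_sqint _ _ _ mu L (cst 0%R) C 1 mC ltr01 mL _ L0 _) _ => //.
rewrite lte_add_pinfty//.
- rewrite lte_add_pinfty//.
    by under eq_integral do rewrite /=; rewrite integral0 ltry.
  by rewrite mul1e.
- rewrite invr1 mul1e (_ : sqint _ _ = l%:E) ?ltry// -Ll.
  by apply: eq_integral => x _; rewrite /= sub0r sqrrN.
Qed.

Let fatten (C : set 'rV[R]_n) (e : R) := \bigcup_(y in C) ball y e.

(** By [rV_measure_unique] a closed bounded [C] suffices. Its open neighbourhoods [F k] decrease to
    [C], each of the two measures of [C] is at most the other measure of [F k], and continuity from
    above applies since bounded sets have finite mass. *)
Lemma measure_eq_density A : measurable A -> nu A = \int[mu]_(x in A) (L x)%:E.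
Proof.
move: A; apply: (@rV_measure_unique R n nu density_measure); last first.
  move=> r; rewrite -ge0_fin_numE//; apply: fin_num_measure.
  by apply: closed_measurable_rV; exact: closed_norm_le.
move=> C r cC Cr.
have mC : measurable C := closed_measurable_rV cC.
have mfat e : measurable (fatten C e).
  have [e0|e0] := ltP 0%R e; last first.
    rewrite (_ : fatten C e = set0)//; apply/seteqP; split => // x [y _].
    by move=> /rV_ballE[]; rewrite ltNge e0.
  by apply: open_measurable_rV; apply: bigcup_open => y _; exact: ball_open.
have fatS e : (0 < e)%R -> C `<=` fatten C e.
  by move=> e0 x Cx; exists x => //; exact: ballxx.
have fatoo e : mu (fatten C e) < +oo.
  apply: (@lebesgue_rV_bounded _ _ _ (r + e)%R) => // x [y Cy]; rewrite -ball_normE /= => xy.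
  rewrite -(subrK y x); apply: le_trans (ler_normD _ _) _.
  by rewrite addrC lerD ?Cr// distrC ltW.
have far e x y : C x -> ~ fatten C e y -> (e <= `|x - y|)%R.
  move=> Cx ny; rewrite leNgt; apply/negP => xy; apply: ny; exists x => //.
  by rewrite -ball_normE.
pose F (k : nat) := fatten C k.+1%:R^-1.
have k0 (k : nat) : (0 < k.+1%:R^-1 :> R)%R by rewrite invr_gt0.
have capF : \bigcap_k F k = C.
  apply/seteqP; split => [x Fx|x Cx k _]; last exact: fatS.
  rewrite (proj1 (closure_id C) cC) => B /nbhs_ballP[e /= e0 eB].
  have [k ke] : exists k : nat, (k.+1%:R^-1 < e)%R.
    by have [k] := ltr_add_invr e0; rewrite add0r => ?; exists k.
  have [y Cy yx] := Fx k I; exists y; split => //; apply: eB.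
  by apply: le_ball (ltW ke) _ _; exact: ball_sym.
have ndF : {homo F : i j / (i <= j)%N >-> (j <= i)%O}.
  move=> i j ij; apply/subsetPset => x [y Cy xy]; exists y => //.
  by apply: le_ball xy; rewrite lef_pV2 ?posrE// ler_nat.
have mcap : measurable (\bigcap_k F k) by rewrite capF.
apply/eqP; rewrite eq_le; apply/andP; split.
- have c := @nonincreasing_cvg_mu _ _ _ density_measure F (integral_bounded_lty (mfat _) (fatoo _)) (fun k => mfat _) mcap ndF.
  rewrite capF in c; rewrite -(cvg_lim _ c)//; apply: lime_ge; first by apply/cvg_ex; eexists; exact: c.
  apply: nearW => k; apply: (measure_le_integral_limit mC (mfat _) (fatoo _) (k0 k)) => x y Cy nx.
  by rewrite distrC; exact: far.
- have Foo : nu (F 0%N) < +oo by rewrite -ge0_fin_numE// fin_num_measure//; exact: mfat.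
  have c := @nonincreasing_cvg_mu _ _ _ nu F Foo (fun k => mfat _) mcap ndF.
  rewrite capF in c; rewrite -(cvg_lim _ c)//; apply: lime_ge; first by apply/cvg_ex; eexists; exact: c.
  apply: nearW => k; apply: (integral_limit_le mC (mfat _) _ (k0 k)).
    by apply: le_lt_trans (fatoo 1%R); apply: le_measure; rewrite ?inE//; exact: fatS.
  exact: far.
Qed.

End identification.
End bounded_energy_density.

(** * The Abel limit *)

Section power_integral.
Context {R : realType}.
Notation leb := (@lebesgue_measure R).

(** The integrand may be singular at [c]: the fundamental theorem is applied on intervals that stay
    away from [c], followed by monotone convergence. *)
Lemma integral_powR_right (c de a : R) : 0 < a -> 0 < de ->
  (\int[leb]_(t in `]c, (c + de)%R]) ((t - c) `^ (a - 1))%:E = (de `^ a / a)%:E)%E.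
Proof.
move=> a0 d0.
pose f t := (t - c) `^ (a - 1).
have mf : measurable_fun setT f.
  by apply: (measurableT_comp (measurable_powR (a - 1))); exact: measurable_funB.
pose x n := c + de * expR (- n.+1%:R).
pose D n : set R := `[x n, c + de]%classic.
have xc n : c < x n by rewrite ltrDl mulr_gt0// expR_gt0.
have mD n : measurable (D n) by exact: measurable_itv.
have cvgx : x n @[n --> \oo] --> c.
  rewrite -[X in _ --> X]addr0 -(mulr0 de); apply: cvgD; first exact: cvg_cst.
  apply: cvgM; first exact: cvg_cst.
  have -> : (fun n => expR (- n.+1%:R)) = (fun n => expR (-1) * (expR (-1)) ^+ n) :> (nat -> R).
    by apply/funext => n; rewrite -exprS -expRM_natl mulrN mulr1.
  rewrite -(mulr0 (expR (-1))); apply: cvgM; first exact: cvg_cst.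
  by apply: cvg_expr; rewrite ger0_norm ?expR_ge0// -[ltRHS]expR0 ltr_expR.
have decx m n : (m <= n)%N -> x n <= x m.
  by move=> mn; rewrite lerD2l ler_pM2l// ler_expR lerN2 ler_nat.
pose g n := (EFin \o f) \_ (D n).
have g0 n t : (0 <= g n t)%E by rewrite /g patchE; case: ifP => // _; rewrite lee_fin powR_ge0.
have mg n : measurable_fun setT (g n).
  apply/(measurable_restrict _ _ measurableT) => //.
  by apply: measurable_funTS; exact/measurable_EFinP.
have ndg t : {homo g^~ t : m n / (m <= n)%N >-> (m <= n)%E}.
  move=> m n mn; rewrite /g !patchE; case: ifPn => [|_]; last by case: ifP => // _; rewrite lee_fin powR_ge0.
  rewrite inE /D /= in_itv/= => /andP[xt tc]; rewrite ifT// inE /= in_itv/= tc andbT.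
  by apply: le_trans xt; exact: decx.
have lim_g : forall t, limn (g^~ t) = ((EFin \o f) \_ `]c, (c + de)%R]) t.
  move=> t; apply: cvg_lim => //; apply: cvg_near_cst; rewrite patchE.
  case: ifPn => tc; last first.
    apply: nearW => n; rewrite /g patchE ifF//; apply: contraNF tc; rewrite !inE /D /= !in_itv/=.
    by move=> /andP[xt ->]; rewrite andbT (lt_le_trans (xc n)).
  rewrite inE /= in_itv/= in tc; have /andP[ct tcd] := tc.
  have : \forall n \near \oo, x n < t by exact: (cvgr_lt c cvgx).
  apply: filterS => n xt; rewrite /g patchE ifT// inE /D /= in_itv/= tcd andbT; exact: ltW.
have mono := @cvg_monotone_convergence _ _ R leb setT measurableT g mg (fun n t _ => g0 n t) (fun t _ => ndg t).
rewrite integral_mkcond; under eq_integral do rewrite -lim_g.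
have df (b t : R) : c < t -> is_derive t (1 : R) (fun t => (t - c) `^ b) (b * (t - c) `^ (b - 1)).
  move=> ct; have d1 : is_derive t (1 : R) (fun t => t - c) 1.
    have := @is_deriveB _ _ _ id (cst c) t 1 _ _ (is_derive_id _ _) (is_derive_cst _ _ _).
    by rewrite subr0.
  have tc0 : 0 < t - c by rewrite subr_gt0.
  have := @is_derive1_comp R (fun u : R => u `^ b) (fun t : R => t - c) t _ _ (is_derive1_powR b tc0) d1.
  by rewrite mulr1.
have cf (b t : R) : c < t -> {for t, continuous (fun t => (t - c) `^ b)}.
  by move=> ct; apply: differentiable_continuous; apply/derivable1_diffP; case: (df b t ct).
pose F t := a^-1 * (t - c) `^ a.
have dF t : c < t -> is_derive t (1 : R) F (f t).
  move=> ct; have := @is_deriveZ _ _ _ (fun t => (t - c) `^ a) a^-1 t 1 _ (df a t ct).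
  by rewrite /GRing.scale/= mulKf// gt_eqF.
have cF t : c < t -> {for t, continuous F}.
  by move=> ct; apply: differentiable_continuous; apply/derivable1_diffP; case: (dF t ct).
have Ig n : (\int[leb]_t g n t = (F (c + de) - F (x n))%:E)%E.
  rewrite /g -integral_mkcond EFinB; apply: continuous_FTC2.
  - by rewrite ltrD2l gtr_pMr// -[ltRHS]expR0 ltr_expR oppr_lt0.
  - apply: continuous_in_subspaceT => t; rewrite inE /= in_itv/= => /andP[xt _].
    by apply: cf; apply: lt_le_trans xt.
  - split.
    + move=> t; rewrite in_itv/= => /andP[xt _].
      by case: (dF t (lt_trans (xc n) xt)).
    + by apply: cvg_at_right_filter; exact: cF.
    + by apply: cvg_at_left_filter; apply: cF; rewrite ltrDl.
  - move=> t; rewrite in_itv/= => /andP[xt _]; rewrite derive1E.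
    by case: (dF t (lt_trans (xc n) xt)).
have c2 : (\int[leb]_t g n t)%E @[n --> \oo] --> (de `^ a / a)%:E.
  under eq_fun do rewrite Ig.
  apply: cvg_EFin; first exact: nearW.
  rewrite /comp /= (_ : de `^ a / a = F (c + de) - 0); last by rewrite subr0 /F addrAC subrr add0r mulrC.
  apply: cvgB; first exact: cvg_cst.
  rewrite -(mulr0 a^-1) /F; apply: cvgM; first exact: cvg_cst.
  have -> : (fun n => (x n - c) `^ a) = (fun n => de `^ a * expR (- a) * expR (- a) ^+ n).
    apply/funext => n; rewrite /x (addrC c) addrK powRM ?expR_ge0 ?ltW// -mulrA -exprS; congr (_ * _).
    by rewrite /powR gt_eqF ?expR_gt0// expRK -expRM_natl mulrN mulrC mulrN mulrC.
  rewrite -(mulr0 (de `^ a * expR (- a))); apply: cvgM; first exact: cvg_cst.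
  by apply: cvg_expr; rewrite ger0_norm ?expR_ge0// -[ltRHS]expR0 ltr_expR oppr_lt0.
exact: (cvg_unique (@ereal_hausdorff R) mono c2).
Qed.

Lemma integral_powR_left (c de a : R) : 0 < a -> 0 < de ->
  (\int[leb]_(t in `[(c - de)%R, c[) ((c - t) `^ (a - 1))%:E = (de `^ a / a)%:E)%E.
Proof.
move=> a0 d0; rewrite -(integral_powR_right (- c) a0 d0).
have mf : measurable_fun setT (fun t : R => ((c - t) `^ (a - 1))%:E).
  apply/measurable_EFinP; apply: (measurableT_comp (measurable_powR (a - 1))).
  exact: measurable_funB.
transitivity (\int[pushforward leb (-%R : _ -> measurableTypeR R)]_(t in `[(c - de)%R, c[) ((c - t) `^ (a - 1))%:E)%E.
  by apply: eq_measure_integral => //= A mA AS; exact/esym/lebesgue_measureN.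
rewrite ge0_integral_pushforward; last 4 first.
- exact: oppr_measurable.
- exact: measurable_itv.
- exact: measurable_funTS.
- by move=> t _; rewrite lee_fin powR_ge0.
rewrite (_ : _ @^-1` _ = `](- c), (- c + de)%R]%classic); last first.
  apply/seteqP; split => t /=; rewrite !in_itv/= => /andP[h1 h2]; apply/andP; split; lra.
by apply: eq_integral => t _; rewrite /comp !opprK addrC.
Qed.

End power_integral.

Section density_integral.
Context d (T : measurableType d) (R : realType).
Variables (mu nu : {measure set T -> \bar R}) (L : T -> R).
Hypotheses (mL : measurable_fun setT L) (L0 : forall x, 0 <= L x).
Hypothesis nuL : forall A, measurable A -> nu A = (\int[mu]_(x in A) (L x)%:E)%E.
Local Open Scope ereal_scope.

Import HBNNSimple.

(** From sets to simple functions by linearity, then to [f] by monotone convergence on both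
    sides. *)
Lemma ge0_integral_density (f : T -> \bar R) : measurable_fun setT f -> (forall x, 0 <= f x) ->
  \int[nu]_x f x = \int[mu]_x (f x * (L x)%:E).
Proof.
move=> mf f0; pose h := nnsfun_approx measurableT mf.
have mLE : measurable_fun setT (EFin \o L) by exact/measurable_EFinP.
have hf x : (h n x)%:E @[n --> \oo] --> f x by exact: cvg_nnsfun_approx.
have ndh x : {homo (fun n => (h n x)%:E) : m n / (m <= n)%N >-> m <= n}.
  by move=> m n mn; rewrite lee_fin; exact/lefP/nd_nnsfun_approx.
have mh n : measurable_fun setT (fun x => (h n x)%:E) by exact/measurable_EFinP.
have -> : \int[nu]_x f x = limn (fun n => \int[nu]_x (h n x)%:E).
  rewrite -monotone_convergence//; first by apply: eq_integral => x _; exact/esym/cvg_lim.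
  by move=> n x _; rewrite lee_fin.
have -> : \int[mu]_x (f x * (L x)%:E) = limn (fun n => \int[mu]_x ((h n x)%:E * (L x)%:E)).
  rewrite -monotone_convergence//.
  - apply: eq_integral => x _; apply/esym/cvg_lim => //.
    by apply: cvgeZr => //; exact: hf.
  - by move=> n; exact: emeasurable_funM.
  - by move=> n x _; rewrite mule_ge0 ?lee_fin.
  - by move=> x _ m n mn; rewrite lee_wpmul2r ?lee_fin ?L0// -lee_fin; exact: ndh.
congr (limn _); apply/funext => n.
transitivity (\int[nu]_x (\sum_(y \in range (h n)) (y * \1_(h n @^-1` [set y]) x)%:E)).
  by apply: eq_integral => x _; rewrite fsumEFin// -fimfunE.
have mi (y : R) : measurable (h n @^-1` [set y]) by [].
rewrite ge0_integral_fsum//; last 2 first.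
- by move=> y; apply/measurable_EFinP; apply: measurable_funM => //; exact: measurable_indic.
- by move=> y x _; exact: nnfun_muleindic_ge0.
transitivity (\int[mu]_x (\sum_(y \in range (h n)) ((y * \1_(h n @^-1` [set y]) x)%:E * (L x)%:E))); last first.
  apply: eq_integral => x _; rewrite -ge0_mule_fsuml; last by move=> y; exact: nnfun_muleindic_ge0.
  by rewrite fsumEFin// -fimfunE.
rewrite ge0_integral_fsum//; last 2 first.
- move=> y; apply: emeasurable_funM => //; apply/measurable_EFinP; apply: measurable_funM => //; exact: measurable_indic.
- by move=> y x _; rewrite mule_ge0 ?lee_fin//; exact: nnfun_muleindic_ge0.
apply: eq_fsbigr => r; rewrite inE => -[t _ <-].
under [LHS]eq_integral do rewrite EFinM.
under [RHS]eq_integral do rewrite -EFinM -mulrA EFinM.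
have r0 : (0 <= h n t)%R by [].
have mI : measurable_fun setT (\1_(h n @^-1` [set h n t]) : T -> R) by exact: measurable_indic.
rewrite (ge0_integralZl_EFin nu measurableT _ _ r0); last 2 first.
- by move=> x _; rewrite lee_fin.
- exact/measurable_EFinP.
rewrite (ge0_integralZl_EFin mu measurableT _ _ r0); last 2 first.
- by move=> x _; rewrite lee_fin mulr_ge0.
- by apply/measurable_EFinP; apply: measurable_funM.
by rewrite integral_indic// setIT nuL// integral_indicM.
Qed.

Lemma integral_density (f : T -> R) : measurable_fun setT f ->
  \int[nu]_x (f x)%:E = \int[mu]_x (f x * L x)%:E.
Proof.
move=> mf; rewrite integralE [RHS]integralE.
have mfE : measurable_fun setT (EFin \o f) by exact/measurable_EFinP.
rewrite !ge0_integral_density//; [|exact: measurable_funeneg|exact: measurable_funepos].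
congr (_ - _); apply: eq_integral => x _.
- rewrite funepos.unlock -EFin_max -EFinM -EFin_max; congr EFin.
  by rewrite maxr_pMl// mul0r.
- rewrite funeneg.unlock -!EFinN -!EFin_max -EFinM; congr EFin.
  by rewrite maxr_pMl// mul0r mulNr.
Qed.

End density_integral.

(** Used with [r] an L^2 norm and [G] a Gagliardo seminorm: it bounds the L^2 norm by the Sobolev
    norm. *)
Lemma le_sqr_add_poweR12 (R : realType) (r : R) (G : \bar R) : 0 <= r -> (0 <= G)%E ->
  (r%:E <= (r%:E ^+ 2 + G) `^ 2^-1)%E.
Proof.
move=> r0 G0; have r2 : (0 <= r%:E ^+ 2)%E by rewrite expe2 mule_ge0.
apply: (@le_trans _ _ ((r%:E ^+ 2) `^ 2^-1)%E).
  by rewrite expe2 -EFinM poweR_EFin -expr2 powR12_sqrt ?sqr_ge0// sqrtr_sqr ger0_norm.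
apply: gt0_ler_poweR; rewrite ?in_itv/= ?andbT ?leey ?leeDl//; [by rewrite r2|by rewrite adde_ge0].
Qed.

Section neg_sobolev_density.
Context {R : realType} (n : nat).
Notation mu := (lebesgue_rV R n).
Variables (nu : {measure set 'rV[R]_n -> \bar R}) (L : 'rV[R]_n -> R).
Hypotheses (mL : measurable_fun setT L) (L0 : forall x, 0 <= L x).
Hypothesis Loo : (sqint mu L < +oo)%E.
Hypothesis nuL : forall A, measurable A -> nu A = (\int[mu]_(x in A) (L x)%:E)%E.

Lemma sqint_Lfun (f : 'rV[R]_n -> R) : measurable_fun setT f -> (sqint mu f < +oo)%E -> f \in Lfun mu 2%:E.
Proof.
move=> mf foo; apply/andP; split; first by rewrite inE.
by rewrite inE; exact: sqint_finite_norm.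
Qed.

(** Pairing with [L] extends [nu] to W^{alpha,2}; by the Cauchy-Schwarz inequality it is bounded
    with constant the norm of [L]. This puts [neg_sobolev_norm] in its finite branch, the one given
    by the heat integral. *)
Lemma neg_sobolev_density alpha : neg_sobolev alpha (distr_of_measure nu).
Proof.
have LL := sqint_Lfun mL Loo.
have iL g : sobolev alpha g -> mu.-integrable setT (EFin \o (fun x => g x * L x)).
  move=> [/= gL _]; apply/Lfun1_integrable; exact: Lfun2_mul_Lfun1.
exists (fun g => (\int[mu]_x (g x * L x))%R).
  split.
    move=> a g h sg sh.
    rewrite (_ : (fun x => (a * g x + h x) * L x) = (fun x => a * (g x * L x) + h x * L x)); last first.
      by apply/funext => x; ring.
    rewrite RintegralD//; last exact: iL.
      by rewrite RintegralZl//; exact: iL.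
    by have := integrableZl measurableT a (iL g sg); apply: eq_integrable => // x _ /=; rewrite EFinM.
  have NL : ('N[mu]_2%:E[EFin \o L])%E \is a fin_num.
    by rewrite ge0_fin_numE ?Lnorm_ge0//; exact: sqint_finite_norm.
  exists (fine ('N[mu]_2%:E[EFin \o L])%E) => g sg; have [/= gL gg] := sg.
  have mg : measurable_fun setT g by move/andP: gL => [+ _]; rewrite inE.
  have Ng : ('N[mu]_2%:E[EFin \o g])%E \is a fin_num.
    by rewrite ge0_fin_numE ?Lnorm_ge0//; move/andP: gL => [_]; rewrite inE.
  rewrite fineK// muleC.
  apply: (@le_trans _ _ (('N[mu]_2%:E[EFin \o g])%E * ('N[mu]_2%:E[EFin \o L])%E)%E); last first.
    rewrite lee_wpmul2r ?Lnorm_ge0// /sobolev_norm.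
    have gag0 : (0 <= gagliardo alpha g)%E.
      apply: integral_ge0 => x _; apply: integral_ge0 => y _; rewrite lee_fin.
      by rewrite divr_ge0 ?exprn_ge0 ?powR_ge0.
    have r0 : (0 <= fine ('N[mu]_2%:E[EFin \o g])%E)%R by rewrite fine_ge0// Lnorm_ge0.
    by rewrite -(fineK Ng); exact: le_sqr_add_poweR12.
  apply: (@le_trans _ _ ('N[mu]_1%:E[EFin \o (g \* L)%R])%E); last by apply: hoelder => //; field.
  rewrite Lnorm1 /Rintegral -fine_abse; last by apply: integrable_fin_num => //; exact: iL.
  rewrite fineK; last by rewrite abse_fin_num; apply: integrable_fin_num => //; exact: iL.
  apply: le_abse_integral => //; apply/measurable_EFinP; exact: measurable_funM.
(* The empty list of derivatives gives the continuity of [phi] itself, hence its measurability. *)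
move=> phi [smooth_phi _]; have [cphi _] := smooth_phi [::].
by rewrite /distr_of_measure (integral_density mL L0 nuL)//; exact: continuous_measurable_rV.
Qed.

End neg_sobolev_density.

(** Continued by its upper bound [l] to the nonpositive half-line, [G] is monotone on the whole
    line; the proof works with the opposite function, which is nondecreasing. *)
Lemma nonincreasing_measurable01 (R : realType) (G : R -> R) (l : R) :
  (forall t, 0 < t -> G t <= l) -> (forall u t, 0 < u -> u <= t -> G t <= G u) ->
  measurable_fun (`]0%R, 1%R[ : set (measurableTypeR R)) G.
Proof.
move=> Gl ndG; pose g (t : R) := if t <= 0 then - l else - G t.
have mg : measurable_fun (`]0%R, 1%R[ : set (measurableTypeR R)) g.
  apply: nondecreasing_measurable => // s t st; rewrite /g.
  case: (leP s 0) => s0; case: (leP t 0) => t0 //.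
  - by rewrite lerN2 Gl.
  - by have := lt_le_trans s0 (le_trans st t0); rewrite ltxx.
  - by rewrite lerN2 ndG.
have := measurableT_comp (@oppr_measurable R setT) mg.
apply: eq_measurable_fun => t; rewrite inE /= in_itv/= => /andP[t0 _].
by rewrite /g leNgt t0 opprK.
Qed.

Lemma ler_dist_between (R : realType) (l e q : R) : 0 <= e -> l - e <= q -> q <= l -> `|l - q| <= e.
Proof. by move=> e0 h1 h2; rewrite ler_norml; apply/andP; split; lra. Qed.

Section abel_limit.
Context {R : realType} (n : nat).
Notation mu := (lebesgue_rV R n).
Notation leb := (@lebesgue_measure R).

Lemma poweR12_sqr (I : \bar R) : (0 <= I)%E -> ((I `^ 2^-1) ^+ 2 = I)%E.
Proof.
case: I => [r| |//]; last first.
  by move=> _; rewrite poweRyr ?invr_eq0// expe2 mulyy.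
by rewrite lee_fin => r0; rewrite poweR_EFin expe2 -EFinM -expr2 powR12_sqrt// sqr_sqrtr.
Qed.

Variables (nu : {finite_measure set 'rV[R]_n -> \bar R}) (L : 'rV[R]_n -> R) (l : R).
Hypotheses (mL : measurable_fun setT L) (L0 : forall x, 0 <= L x).
Hypothesis Ll : sqint mu L = l%:E.
Hypothesis nuL : forall A, measurable A -> nu A = (\int[mu]_(x in A) (L x)%:E)%E.

Lemma neg_sobolev_norm_sqr (alpha : R) :
  (neg_sobolev_norm alpha (distr_of_measure nu) ^+ 2 =
   \int[leb]_(t in `]0%R, 1%R[) (t `^ (alpha - 1) * energy nu (t + t))%:E)%E.
Proof.
have Loo : (sqint mu L < +oo)%E by rewrite Ll ltry.
rewrite /neg_sobolev_norm; case: asboolP => [_|]; last first.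
  by move=> H; exfalso; apply: H; exact: (neg_sobolev_density mL L0 Loo nuL).
rewrite poweR12_sqr; last first.
  apply: integral_ge0 => t tI; have t0 : 0 < t by move: tI; rewrite /= in_itv/= => /andP[].
  by rewrite mule_ge0 ?lee_fin ?invr_ge0 ?(ltW t0)// expe2 sqre_ge0.
apply: eq_integral => t tI; have t0 : 0 < t by move: tI; rewrite inE /= in_itv/= => /andP[].
rewrite (_ : ((_ * _) ^+ 2 = (t `^ (alpha / 2) ^+ 2)%:E * ('N[mu]_2%:E[EFin \o heat_conv (distr_of_measure nu) t]) ^+ 2)%E); last first.
  by rewrite !expe2 muleACA -EFinM expr2.
rewrite Lnorm2_sqr sqint_heat_conv// -!EFinM mulrAC; congr (_ * _)%:E.
rewrite -powR_mulrn ?powR_ge0// -powRrM -(powR_inv1 (ltW t0)) -powRD; last by rewrite (gt_eqF t0) implybT.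
by congr (_ `^ _); field.
Qed.

Hypothesis energy_le : forall t, 0 < t -> energy nu t <= l.
Hypothesis energy_lim : forall e : R, 0 < e ->
  exists2 de : R, 0 < de & forall t : R, 0 < t -> t <= de -> l - e <= energy nu t.

Lemma measurable_energy_time : measurable_fun (`]0%R, 1%R[ : set (measurableTypeR R)) (fun t : R => energy nu (t + t)).
Proof.
apply: (@nonincreasing_measurable01 _ (fun t => energy nu (t + t)) l).
- by move=> t t0; apply: energy_le; rewrite addr_gt0.
- by move=> u t u0 ut; apply: energy_nonincreasing; [rewrite addr_gt0|exact: lerD].
Qed.

(** The weight has integral [1 / alpha] over the unit interval. The energy is at most [l]
    throughout; for the lower bound only the times up to [de] are kept. *)
Lemma abel_bounds (alpha e : R) (de : R) : 0 < alpha -> 0 < de -> de < 1 -> 0 <= l - e ->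
  (forall t : R, 0 < t -> t <= de -> l - e <= energy nu (t + t)) ->
  (((l - e) * (de `^ alpha / alpha))%:E <=
     \int[leb]_(t in `]0%R, 1%R[) (t `^ (alpha - 1) * energy nu (t + t))%:E <= (l / alpha)%:E)%E.
Proof.
move=> a0 d0 d1 le0 ede.
have l0 : 0 <= l by have := energy_le ltr01; apply: le_trans; exact: energy_ge0.
have mp (D : set (measurableTypeR R)) : measurable_fun D (fun t : R => t `^ (alpha - 1)).
  by apply: measurable_funTS; exact: measurable_powR.
have mf : measurable_fun (`]0%R, 1%R[ : set (measurableTypeR R)) (fun t : R => (t `^ (alpha - 1) * energy nu (t + t))%:E).
  by apply/measurable_EFinP; apply: measurable_funM => //; exact: measurable_energy_time.
have I1 (c : R) : 0 < c -> (\int[leb]_(t in `]0%R, c]) (t `^ (alpha - 1))%:E = (c `^ alpha / alpha)%:E)%E.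
  by move=> c0; rewrite -(integral_powR_right 0 a0 c0) add0r; apply: eq_integral => t _; rewrite subr0.
apply/andP; split.
  rewrite EFinM -(I1 de d0) -ge0_integralZl_EFin//; last 2 first.
  - by move=> t _; rewrite lee_fin powR_ge0.
  - exact/measurable_EFinP.
  apply: (@le_trans _ _ (\int[leb]_(t in `]0%R, de]) (t `^ (alpha - 1) * energy nu (t + t))%:E)%E).
    apply: ge0_le_integral => //.
    - by move=> t _; rewrite -EFinM lee_fin mulr_ge0 ?powR_ge0.
    - by apply: measurable_funeM; exact/measurable_EFinP.
    - apply: measurable_funS mf => // t; rewrite /= !in_itv/= => /andP[-> /=] h; exact: le_lt_trans d1.
    - move=> t; rewrite /= in_itv/= => /andP[t0 td].
      by rewrite -EFinM lee_fin mulrC ler_wpM2l ?powR_ge0 ?ede.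
  apply: ge0_subset_integral => //.
  - by move=> t _; rewrite lee_fin mulr_ge0 ?powR_ge0 ?energy_ge0.
  - by move=> t; rewrite /= !in_itv/= => /andP[-> /=] h; exact: le_lt_trans d1.
rewrite (_ : l / alpha = l * (1 `^ alpha / alpha)); last by rewrite powR1 mul1r.
rewrite EFinM -(I1 1 ltr01) -integral_itv_bndo_bndc; last by apply/measurable_EFinP; exact: mp.
rewrite -ge0_integralZl_EFin//; last 2 first.
- by move=> t _; rewrite lee_fin powR_ge0.
- exact/measurable_EFinP.
apply: ge0_le_integral => //.
- by move=> t _; rewrite lee_fin mulr_ge0 ?powR_ge0 ?energy_ge0.
- by apply: measurable_funeM; exact/measurable_EFinP.
- move=> t; rewrite /= in_itv/= => /andP[t0 td].
  by rewrite -EFinM lee_fin mulrC ler_wpM2r ?powR_ge0 ?energy_le ?addr_gt0.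
Qed.

Lemma abel_limit :
  (alpha%:E * neg_sobolev_norm alpha (distr_of_measure nu) ^+ 2)%E @[alpha --> (0 : R)^'+] --> l%:E.
Proof.
pose I (alpha : R) := (\int[leb]_(t in `]0%R, 1%R[) (t `^ (alpha - 1) * energy nu (t + t))%:E)%E.
under eq_fun do rewrite neg_sobolev_norm_sqr -/(I _).
have l0 : 0 <= l by have := energy_le ltr01; apply: le_trans; exact: energy_ge0.
have Iub (alpha : R) : 0 < alpha -> (I alpha <= (l / alpha)%:E)%E.
  move=> a0; have h : 0 < 2^-1 :> R by rewrite invr_gt0.
  have h1 : 2^-1 < 1 :> R by rewrite invf_lt1 ?ltr1n.
  (* Only the upper bound is wanted here: with [e = l] the lower one is trivially admissible. *)
  have := @abel_bounds alpha l 2^-1 a0 h h1; rewrite subrr => /(_ (lexx _)).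
  by case/(_ (fun _ _ _ => energy_ge0 _ _))/andP.
have I0 (alpha : R) : (0 <= I alpha)%E.
  by apply: integral_ge0 => t _; rewrite lee_fin mulr_ge0 ?powR_ge0 ?energy_ge0.
have IE (alpha : R) : 0 < alpha -> (alpha%:E * I alpha = (alpha * fine (I alpha))%:E)%E.
  move=> a0; rewrite EFinM fineK// ge0_fin_numE//; apply: le_lt_trans (Iub _ a0) _; exact: ltry.
apply/fine_cvgP; split.
  near=> alpha; rewrite IE//; near: alpha; exact: nbhs_right_gt.
apply/cvgrPdist_le => e e0.
(* For [e > l] the bounds 0 and [l] on the mean already suffice; otherwise [l - e / 2] is
   nonnegative, as [abel_bounds] asks. *)
wlog el : e e0 / e <= l => [wl|].
  case: (leP e l) => [el|le]; first exact: wl.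
  near=> alpha.
  have a0 : 0 < alpha by near: alpha; exact: nbhs_right_gt.
  rewrite /= IE//=.
  have h := Iub _ a0; have h0 := I0 alpha; rewrite -(@fineK _ (I alpha)) in h h0; last first.
    by rewrite ge0_fin_numE//; apply: le_lt_trans (Iub _ a0) _; exact: ltry.
  move: h h0; rewrite !lee_fin; move: (fine _) => q h h0.
  apply: ler_dist_between; first exact: ltW.
  - by apply: (@le_trans _ _ 0); [rewrite subr_le0 ltW|rewrite mulr_ge0// ltW].
  - by rewrite mulrC -ler_pdivlMr.
have e2 : 0 < e / 2 by rewrite divr_gt0.
have le0 : 0 <= l - e / 2.
  by rewrite subr_ge0 (le_trans _ el)// ler_piMr ?(ltW e0)// invf_le1 ?ler1n.
have [de0 d00 ede0] := energy_lim e2.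
(* Half of [de0] because energies are taken at [t + t]; the cap [2^-1] keeps [de] below 1. *)
pose de := Num.min (de0 / 2) 2^-1.
have d0 : 0 < de by rewrite lt_min divr_gt0//= invr_gt0.
have d1 : de < 1 by rewrite gt_min invf_lt1 ?ltr1n// orbT.
have ede t : 0 < t -> t <= de -> l - e / 2 <= energy nu (t + t).
  move=> t0; rewrite le_min => /andP[td _]; apply: ede0; first by rewrite addr_gt0.
  by move: td; lra.
have cd : (l - e / 2) * de `^ alpha @[alpha --> 0^'+] --> l - e / 2.
  rewrite -[X in _ --> X]mulr1 -(powRr0 de); apply: cvgM; first exact: cvg_cst.
  have -> : powR de = (fun a => expR (a * ln de)).
    by apply/funext => a; rewrite /powR gt_eqF.
  apply: cvg_at_right_filter; apply: continuous_comp; last exact: continuous_expR.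
  by apply: cvgM; [exact: cvg_id|exact: cvg_cst].
near=> alpha.
have a0 : 0 < alpha by near: alpha; exact: nbhs_right_gt.
have dl : l - e <= (l - e / 2) * de `^ alpha.
  near: alpha; apply: (cvgr_ge _ cd); lra.
rewrite /= IE//=.
have /andP[h0 h] := abel_bounds a0 d0 d1 le0 ede.
rewrite -/(I alpha) -(@fineK _ (I alpha)) in h h0; last first.
  by rewrite ge0_fin_numE//; apply: le_lt_trans (Iub _ a0) _; exact: ltry.
move: h h0; rewrite !lee_fin mulrA; move: (fine _) => q h h0.
have h1 : alpha * q <= l by rewrite mulrC -ler_pdivlMr.
have h2 : (l - e / 2) * de `^ alpha <= alpha * q by rewrite (mulrC alpha) -ler_pdivrMr.
by apply: ler_dist_between => //; [exact: ltW|exact: le_trans h2].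
Unshelve. all: by end_near.
Qed.

End abel_limit.

(** * Approximation by sums of heat kernels *)

Section greedy_approximation.
Context {R : realType} (n : nat).
Notation mu := (lebesgue_rV R n).

Lemma continuous_heat_kernel (t : R) : 0 < t -> continuous (heat_kernel t : 'rV[R]_n -> R).
Proof.
move=> t0; have -> : heat_kernel t = (fun x : 'rV[R]_n => \prod_(i < n) gk t (x ord0 i)).
  by apply/funext => x; rewrite heat_kernelE.
move=> x; apply: cvg_big => //; first exact: mul_continuous.
  exact: (nbhs_filter x).
move=> i _; apply: (cvg_comp _ (gk t)); last exact: continuous_gk.
exact: coord_continuous.
Qed.

Definition kernel_sum (t : R) (s : seq 'rV[R]_n) (x : 'rV[R]_n) : R := \sum_(q <- s) heat_kernel t (x - q).

Lemma kernel_sum_ge0 t s x : 0 <= kernel_sum t s x.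
Proof. by apply: sumr_ge0 => q _; exact: heat_kernel_ge0. Qed.

Lemma measurable_kernel_sum t s : measurable_fun setT (kernel_sum t s).
Proof. by apply: measurable_sum => q; exact: measurable_heat_kernelB. Qed.

Lemma integral_mul_kernel_sum (m : {measure set 'rV[R]_n -> \bar R}) (t : R) s (f : 'rV[R]_n -> R) :
  measurable_fun setT f -> (forall x, 0 <= f x) ->
  (\int[m]_x (f x * kernel_sum t s x)%:E = \sum_(q <- s) \int[m]_x (f x * heat_kernel t (x - q))%:E)%E.
Proof.
move=> mf f0; rewrite -ge0_integral_sum//.
- by apply: eq_integral => x _; rewrite /kernel_sum mulr_sumr sumEFin.
- by move=> q; apply/measurable_EFinP; apply: measurable_funM => //; exact: measurable_heat_kernelB.
- by move=> q x _; rewrite lee_fin mulr_ge0 ?heat_kernel_ge0.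
Qed.

Variables (nu : {finite_measure set 'rV[R]_n -> \bar R}) (t : R).
Hypothesis t0 : 0 < t.
Local Notation U t := (heat_conv (distr_of_measure nu) t).
Let pot := U (t + t).
Let K2 := heat_kernel (t + t) : 'rV[R]_n -> R.
Let c := fine (nu setT).
Let E := energy nu (t + t).
Let t20 : 0 < t + t. Proof. exact: addr_gt0. Qed.

Lemma integral_heat_conv_kernel_sum s :
  (\int[mu]_x (U t x * kernel_sum t s x)%:E = (\sum_(q <- s) pot q)%:E)%E.
Proof.
rewrite integral_mul_kernel_sum//; [|exact: measurable_heat_conv|by move=> x; exact: heat_conv_ge0].
rewrite -sumEFin; apply: eq_bigr => q _; rewrite -heat_conv_semigroup//.
by apply: eq_integral => x _; rewrite mulrC.
Qed.

Lemma sqint_kernel_sum s :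
  sqint mu (kernel_sum t s) = (\sum_(q <- s) \sum_(p <- s) K2 (q - p))%:E.
Proof.
rewrite /sqint; under eq_integral do rewrite expr2.
rewrite integral_mul_kernel_sum//; [|exact: measurable_kernel_sum|by move=> x; exact: kernel_sum_ge0].
rewrite -sumEFin; apply: eq_bigr => q _.
under eq_integral do rewrite mulrC.
rewrite integral_mul_kernel_sum//; last 2 first.
- exact: measurable_heat_kernelB.
- by move=> x; exact: heat_kernel_ge0.
by rewrite -sumEFin; apply: eq_bigr => p _; rewrite heat_kernel_semigroup.
Qed.

Lemma sqint_heat_conv_sub_kernel_sum (a : R) s : 0 <= a ->
  sqint mu (fun x => U t x - a * kernel_sum t s x) =
  (E - 2 * (a * \sum_(q <- s) pot q) + a ^+ 2 * \sum_(q <- s) \sum_(p <- s) K2 (q - p))%:E.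
Proof.
move=> a0; have mk := measurable_kernel_sum t s; have k0 := kernel_sum_ge0 t s.
apply: sqint_sub.
- exact: measurable_heat_conv.
- exact: measurable_funM.
- by move=> x; exact: heat_conv_ge0.
- by move=> x; rewrite mulr_ge0.
- exact: sqint_heat_conv.
- under eq_integral do rewrite mulrCA EFinM.
  rewrite ge0_integralZl_EFin//; last 2 first.
  + by move=> x _; rewrite lee_fin mulr_ge0 ?heat_conv_ge0.
  + by apply/measurable_EFinP; apply: measurable_funM => //; exact: measurable_heat_conv.
  by rewrite integral_heat_conv_kernel_sum.
- rewrite /sqint; under eq_integral do rewrite exprMn EFinM.
  rewrite ge0_integralZl_EFin ?sqr_ge0//; last 2 first.
  + by move=> x _; rewrite lee_fin sqr_ge0.
  + by apply/measurable_EFinP; exact: measurable_funX.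
  by rewrite -[X in (_ * X)%E]/(sqint mu _) sqint_kernel_sum.
Qed.

Lemma cvg_heat_conv (u : R) (y : nat -> 'rV[R]_n) (y0 : 'rV[R]_n) : 0 < u -> y k @[k --> \oo] --> y0 ->
  U u (y k) @[k --> \oo] --> U u y0.
Proof.
move=> u0 yy.
have H : (\int[nu]_z (heat_kernel u (y k - z))%:E)%E @[k --> \oo] --> (\int[nu]_z (heat_kernel u (y0 - z))%:E)%E.
  have [|||||_ _ //] := @dominated_convergence _ _ R nu setT measurableT
    (fun k z => (heat_kernel u (y k - z))%:E) (fun z => (heat_kernel u (y0 - z))%:E)
    (cst ((4 * pi * u) `^ (- (n%:R / 2)))%:E).
  - by move=> k; exact: measurable_heat_kernelBl.
  - exact: measurable_heat_kernelBl.
  - apply: aeW => z _; apply: cvg_EFin; first exact: nearW.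
    apply: (cvg_comp (fun k => y k - z) (heat_kernel u)); last exact: continuous_heat_kernel.
    by apply: cvgB => //; exact: cvg_cst.
  - exact: finite_measure_integrable_cst.
  - apply: aeW => z k _; rewrite /= ger0_norm ?heat_kernel_ge0// lee_fin; exact: heat_kernel_ub.
have UE (v : 'rV[R]_n) := heat_convE nu v u0.
by move: H; rewrite -UE; under eq_fun do rewrite -UE; move=> /fine_cvgP[].
Qed.

(* D s is the squared L^2 distance between (size s) times U t and c times kernel_sum t s, and h s y is
   its increment when y is added to s. *)
Let D s : R := (size s)%:R ^+ 2 * E - 2 * (size s)%:R * c * (\sum_(q <- s) pot q)
  + c ^+ 2 * \sum_(q <- s) \sum_(p <- s) K2 (q - p).

Let h s y : R := (2 * (size s)%:R + 1) * E + c ^+ 2 * (K2 0 + 2 * \sum_(q <- s) K2 (y - q))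
  - (2 * ((size s)%:R + 1) * c * pot y + 2 * c * \sum_(q <- s) pot q).

Lemma greedy_increment s y : D (y :: s) = D s + h s y.
Proof.
rewrite /D /h /= !big_cons subrr -[(size s).+1%:R]natr1.
rewrite (_ : \sum_(q <- s) \sum_(p <- y :: s) K2 (q - p) =
    \sum_(q <- s) K2 (y - q) + \sum_(q <- s) \sum_(p <- s) K2 (q - p)); last first.
  rewrite -big_split/=; apply: eq_bigr => q _; rewrite big_cons; congr (_ + _).
  by rewrite /K2 -heat_kernelN opprB.
move: (\sum_(q <- s) K2 (y - q)) (\sum_(q <- s) \sum_(p <- s) _) (\sum_(q <- s) pot q) E c (pot y) (K2 0) (size s)%:R => *.
ring.
Qed.

Hypothesis c0 : 0 < c.

(* The average of h s over nu is at most c ^+ 2 * K2 0, since c times the average of the kernels centred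
   at y is U t and the cross terms cancel. *)
Lemma greedy_choice s : exists y, h s y <= c ^+ 2 * K2 0 + 1.
Proof.
apply: contrapT => /forallNP H.
(* All terms are moved to the side where they are nonnegative, so that the inequality can be
   integrated against [nu] without subtraction. *)
have {}H y : c ^+ 2 * K2 0 + 1 + (2 * ((size s)%:R + 1) * c * pot y + 2 * c * \sum_(q <- s) pot q) <=
    (2 * (size s)%:R + 1) * E + c ^+ 2 * (K2 0 + 2 * \sum_(q <- s) K2 (y - q)).
  by have /negP := H y; rewrite -ltNge => /ltW; rewrite /h lerBrDr.
have E0 : 0 <= E by exact: energy_ge0.
have pot0 y : 0 <= pot y by exact: heat_conv_ge0.
have K20 y : 0 <= K2 y by exact: heat_kernel_ge0.
have mpot : measurable_fun setT pot by exact: measurable_heat_conv.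
have S0 : 0 <= \sum_(q <- s) pot q by apply: sumr_ge0.
have cE : nu setT = c%:E by rewrite /c finite_measure_fineK.
have Ilin (a b : R) (f : 'rV[R]_n -> R) (F : R) : 0 <= a -> 0 <= b -> measurable_fun setT f -> (forall y, 0 <= f y) ->
    (\int[nu]_y (f y)%:E = F%:E)%E -> (\int[nu]_y (a + b * f y)%:E = (a * c + b * F)%:E)%E.
  move=> a0 b0 mf f0 fF; under eq_integral do rewrite EFinD EFinM.
  rewrite ge0_integralD//; last 2 first.
  - by move=> y _; rewrite -EFinM lee_fin mulr_ge0.
  - by apply: measurable_funeM; exact/measurable_EFinP.
  rewrite integral_cst// [X in (_ * X + _)%E](_ : _ = c%:E)// ge0_integralZl_EFin//; last 2 first.
  - by move=> y _; rewrite lee_fin.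
  - exact/measurable_EFinP.
  by rewrite fF -!EFinM -EFinD.
have IK : (\int[nu]_y (\sum_(q <- s) K2 (y - q))%:E = (\sum_(q <- s) pot q)%:E)%E.
  under eq_integral do rewrite -[X in X%:E]mul1r.
  rewrite (integral_mul_kernel_sum nu (t + t) s (f := cst 1))//.
  rewrite -sumEFin; apply: eq_bigr => q _; rewrite /pot heat_convE//.
  by apply: eq_integral => y _; rewrite mul1r -heat_kernelN opprB.
have N0 : 0 <= (size s)%:R :> R := ler0n _ _.
have n2 : 0 <= 2 :> R := ler0n _ _.
have cK0 : 0 <= c ^+ 2 * K2 0 := mulr_ge0 (sqr_ge0 c) (K20 0).
pose a1 := c ^+ 2 * K2 0 + 1 + 2 * c * \sum_(q <- s) pot q.
pose b1 := 2 * ((size s)%:R + 1) * c.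
pose a2 := (2 * (size s)%:R + 1) * E + c ^+ 2 * K2 0.
pose b2 := c ^+ 2 * 2.
have a10 : 0 <= a1 := addr_ge0 (addr_ge0 cK0 ler01) (mulr_ge0 (mulr_ge0 n2 (ltW c0)) S0).
have b10 : 0 <= b1 := mulr_ge0 (mulr_ge0 n2 (addr_ge0 N0 ler01)) (ltW c0).
have a20 : 0 <= a2 := addr_ge0 (mulr_ge0 (addr_ge0 (mulr_ge0 n2 N0) ler01) E0) cK0.
have b20 : 0 <= b2 := mulr_ge0 (sqr_ge0 c) n2.
have mS : measurable_fun setT (fun y : 'rV[R]_n => \sum_(q <- s) K2 (y - q)) := measurable_kernel_sum (t + t) s.
have Sk0 y : 0 <= \sum_(q <- s) K2 (y - q) := kernel_sum_ge0 (t + t) s y.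
have : (\int[nu]_y (a1 + b1 * pot y)%:E <= \int[nu]_y (a2 + b2 * \sum_(q <- s) K2 (y - q))%:E)%E.
  apply: ge0_le_integral.
  - exact: measurableT.
  - by move=> y _; rewrite lee_fin; exact: addr_ge0 a10 (mulr_ge0 b10 (pot0 y)).
  - by apply/measurable_EFinP; apply: measurable_funD; [exact: measurable_cst|apply: measurable_funM => //; exact: measurable_cst].
  - by apply/measurable_EFinP; apply: measurable_funD; [exact: measurable_cst|apply: measurable_funM => //; exact: measurable_cst].
  - move=> y _; rewrite lee_fin /a1 /b1 /a2 /b2; have := H y.
    move: (\sum_(q <- s) K2 _) (\sum_(q <- s) pot q) (pot y) (K2 0) E c (size s)%:R => k S p k0 e c' N hh.
    have -> : c' ^+ 2 * k0 + 1 + 2 * c' * S + 2 * (N + 1) * c' * p =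
      c' ^+ 2 * k0 + 1 + (2 * (N + 1) * c' * p + 2 * c' * S) by ring.
    by apply: le_trans hh _; rewrite le_eqVlt; apply/orP; left; apply/eqP; ring.
rewrite (Ilin a1 b1 pot E a10 b10 mpot pot0 (esym (energyE nu t20))) (Ilin a2 b2 _ _ a20 b20 mS Sk0 IK) /a1 /a2 /b1 /b2.
rewrite lee_fin -/E; move: E0 S0 c0 (K20 0); move: (\sum_(q <- s) pot q) E c (K2 0) (size s)%:R => S e c' k N e0 S0 c'0 k0 hh.
(* What is left after integration and cancellation, in contradiction with a positive mass and a
   nonnegative energy. *)
have : c' + c' * e <= 0.
  rewrite -(lerD2l ((c' ^+ 2 * k + 2 * c' * S) * c' + (2 * N + 1) * c' * e)) addr0.
  by apply: le_trans (le_trans hh _); rewrite le_eqVlt; apply/orP; left; apply/eqP; ring.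
by rewrite leNgt ltr_wpDr// mulr_ge0// ltW.
Qed.

(** The increment is continuous in the added point and rational points are dense; the constant 2 in
    place of 1 leaves room for the approximation. *)
Lemma greedy_choice_rat s : exists q : 'rV[rat]_n, h s (map_mx ratr q) <= c ^+ 2 * K2 0 + 2.
Proof.
have [y hy] := greedy_choice s.
have /choice[q qy] k : exists q : 'rV[rat]_n, ball y (k.+1%:R^-1 : R) (map_mx ratr q : 'rV[R]_n).
  by apply: rV_rat_dense; rewrite invr_gt0.
pose yk k : 'rV[R]_n := map_mx ratr (q k).
have yy : yk k @[k --> \oo] --> y.
  apply/cvg_ballP => e e0.
  have : \forall k \near \oo, (k.+1%:R^-1 : R) < e.
    by apply: (cvgr_lt (0 : R)) => //; exact: cvg_harmonic.
  by apply: filterS => k ke; apply: le_ball (qy k); exact: ltW.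
have ch : h s (yk k) @[k --> \oo] --> h s y.
  apply: cvgB.
    apply: cvgD; first exact: cvg_cst.
    apply: cvgM; first exact: cvg_cst.
    apply: cvgD; first exact: cvg_cst.
    apply: cvgM; first exact: cvg_cst.
    apply: cvg_big => //; [exact: add_continuous|move=> p _].
    apply: (@cvg_comp _ _ _ (fun k => yk k - p) K2 \oo (nbhs (y - p)) (nbhs (K2 (y - p)))).
      by apply: cvgB => //; exact: cvg_cst.
    exact: continuous_heat_kernel.
  apply: cvgD; last exact: cvg_cst.
  apply: cvgM; first exact: cvg_cst.
  exact: cvg_heat_conv.
have : \forall k \near \oo, h s (yk k) < c ^+ 2 * K2 0 + 2.
  apply: (cvgr_lt _ ch); apply: le_lt_trans hy _; by rewrite ltrD2l ltr1n.
by move=> /filter_ex[k /ltW hk]; exists (q k).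
Qed.

(** [D] is a squared distance scaled by the square of the number of points, so linear growth means
    an error of order 1/N. *)
Lemma greedy_sequence N : exists2 s : seq 'rV[rat]_n, size s = N &
  D (map (fun q => map_mx ratr q) s) <= N%:R * (c ^+ 2 * K2 0 + 2).
Proof.
elim: N => [|N [s sN IH]].
  by exists [::]; rewrite // /D !big_nil /= !mul0r !mulr0 expr0n/= mul0r subr0 addr0.
have [q hq] := greedy_choice_rat (map (fun q => map_mx ratr q) s).
exists (q :: s); first by rewrite /= sN.
by rewrite map_cons greedy_increment -natr1 mulrDl mul1r; exact: lerD.
Qed.

Lemma kernel_sum_dense (e : R) : 0 < e -> exists s : seq 'rV[rat]_n,
  (sqint mu (fun x => U t x - c / (size s)%:R * kernel_sum t (map (fun q => map_mx ratr q) s) x)%R <= e%:E)%E.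
Proof.
move=> e0; pose K := c ^+ 2 * K2 0 + 2.
have K0 : 0 < K by rewrite ltr_wpDl// mulr_ge0 ?sqr_ge0 ?heat_kernel_ge0.
(* The squared distance is at most [N * K / N ^ 2 = K / N], which is below [e] for this [N]. *)
pose N := (Num.truncn (K / e)).+1.
have [s sN sD] := greedy_sequence N; exists s.
rewrite sqint_heat_conv_sub_kernel_sum ?divr_ge0 ?(ltW c0)// lee_fin sN.
have N0 : 0 < N%:R :> R by rewrite ltr0n.
have NK : K / e < N%:R by rewrite /N; exact: truncnS_gt.
apply: (@le_trans _ _ (D (map (fun q => map_mx ratr q) s) / N%:R ^+ 2)).
  rewrite /D size_map sN.
  move: (\sum_(q <- _) pot q) (\sum_(q <- _) \sum_(p <- _) _) E c => S SS e' c'.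
  rewrite le_eqVlt; apply/orP; left; apply/eqP; field; exact: lt0r_neq0.
rewrite ler_pdivrMr ?exprn_gt0//; apply: le_trans sD _.
rewrite (expr2 N%:R) (mulrCA e) ler_pM2l// -ler_pdivrMl//.
by rewrite mulrC ltW.
Qed.

End greedy_approximation.

(** * Random measures and strong measurability of their densities *)

Section strong_measurability.
Context d {Omega : measurableType d} {R : realType} (n : nat).
Notation mu := (lebesgue_rV R n).
Variables (F : Omega -> L2 R n) (phi : nat -> L2 R n).

Let dst j w := sqint mu (fun x => phi j x - F w x).

(** A running minimizer of the distance over the indices up to [k]; a new index wins only by a
    strict inequality, and the recursion makes measurability an induction. *)
Fixpoint nearest_index (k : nat) (w : Omega) : nat :=
  if k is k'.+1 then
    if (dst k w < dst (nearest_index k' w) w)%E then k else nearest_index k' w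
  else 0.

Lemma nearest_index_le k w : (nearest_index k w <= k)%N.
Proof. by elim: k => //= k IH; case: ifP => // _; exact: leqW. Qed.

Lemma nearest_index_min k w j : (j <= k)%N -> (dst (nearest_index k w) w <= dst j w)%E.
Proof.
elim: k => [|k IH]; first by rewrite leqn0 => /eqP ->.
rewrite leq_eqVlt ltnS => /predU1P[->|jk] /=.
  by case: ltP.
case: ifPn => h; last exact: IH.
by apply: le_trans (ltW h) _; exact: IH.
Qed.

Hypothesis mdst : forall j, measurable_fun setT (dst j).

Lemma measurable_nearest k :
  measurable_fun setT (nearest_index k) /\ measurable_fun setT (fun w => dst (nearest_index k w) w).
Proof.
elim: k => [|k [mJ mD]]; first by split; [exact: measurable_cst|exact: mdst].
have mb : measurable_fun setT (fun w => (dst k.+1 w < dst (nearest_index k w) w)%E).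
  exact: measurable_fun_lte.
split; first by apply: measurable_fun_ifT => //; exact: measurable_cst.
rewrite (_ : (fun _ => _) = (fun w => if (dst k.+1 w < dst (nearest_index k w) w)%E then dst k.+1 w
    else dst (nearest_index k w) w)).
  exact: measurable_fun_ifT.
by apply/funext => w /=; case: ifP.
Qed.

(** The nearest point among [phi 0, ..., phi k] takes finitely many values on measurable sets, and
    its distance to [F w] does not exceed that of any index up to [k]. *)
Lemma strongly_measurable_of_dense :
  (forall w (e : R), 0 < e -> exists j, (dst j w <= e%:E)%E) -> strongly_measurable F.
Proof.
move=> dense; exists (fun k w => phi (nearest_index k w)); split.
  move=> k; split.
    apply: (@sub_finite_set _ _ (phi @` `I_k.+1)); last exact/finite_image/finite_II.
    move=> _ [w _ <-]; exists (nearest_index k w) => //=.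
    by rewrite ltnS nearest_index_le.
  move=> f; rewrite (_ : _ @^-1` _ = nearest_index k @^-1` [set j | phi j = f])//.
  by rewrite -[X in measurable X]setTI; apply: (measurable_nearest k).1.
move=> w; apply: (@sqint_cvg0 _ _ _ mu (fun k x => phi (nearest_index k w) x - F w x)) => e e0.
have [j je] := dense w e e0.
exists j => k jk; apply: le_trans je; exact: nearest_index_min.
Qed.

End strong_measurability.

Section L2_of.
Context {R : realType} (n : nat).
Notation mu := (lebesgue_rV R n).

(** Total on functions, with value 0 outside L^2, so that families can be defined before square
    integrability is proved. *)
Definition L2_of (f : 'rV[R]_n -> R) : L2 R n :=
  if pselect (f \in Lfun mu 2%:E) is left h then Lfun_Sub (lee1n 2) h else 0.

Lemma L2_ofE f : measurable_fun setT f -> (sqint mu f < +oo)%E -> L2_of f = f :> ('rV[R]_n -> R).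
Proof.
move=> mf foo; rewrite /L2_of; case: pselect => [h|]; first exact: Lfun_valP.
by move=> H; exfalso; apply: H; exact: sqint_Lfun.
Qed.

Lemma measurable_L2 (f : L2 R n) : measurable_fun setT f.
Proof. exact: measurable_funP. Qed.

Lemma L2norm_sqr (f : L2 R n) : (L2norm f ^+ 2)%E = sqint mu f.
Proof. exact: Lnorm2_sqr. Qed.

Lemma sqint_L2_lty (f : L2 R n) : (sqint mu f < +oo)%E.
Proof. by apply: finite_norm_sqint; exact: Lfunction_finite. Qed.

Lemma sqint_triangle (f g h : 'rV[R]_n -> R) :
  measurable_fun setT f -> measurable_fun setT g -> measurable_fun setT h ->
  (sqint mu (fun x => f x - h x)%R <=
   2%:E * sqint mu (fun x => f x - g x)%R + 2%:E * sqint mu (fun x => g x - h x)%R)%E.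
Proof.
move=> mf mg mh.
have m (u v : 'rV[R]_n -> R) : measurable_fun setT u -> measurable_fun setT v ->
    measurable_fun setT (fun x => ((u x - v x) ^+ 2)%:E).
  by move=> mu1 mv; apply/measurable_EFinP; apply: measurable_funX; exact: measurable_funB.
rewrite /sqint -!ge0_integralZl_EFin//; try exact: m; try by move=> x _; rewrite lee_fin sqr_ge0.
rewrite -ge0_integralD//; try (by move=> x _; rewrite -EFinM lee_fin mulr_ge0 ?sqr_ge0);
  try (by apply: measurable_funeM; exact: m).
apply: ge0_le_integral => //.
- by move=> x _; rewrite lee_fin sqr_ge0.
- exact: m.
- by apply: emeasurable_funD; apply: measurable_funeM; exact: m.
move=> x _; rewrite -!EFinM -EFinD lee_fin -subr_ge0.
have -> : 2 * (f x - g x) ^+ 2 + 2 * (g x - h x) ^+ 2 - (f x - h x) ^+ 2 = (f x - g x - (g x - h x)) ^+ 2 by ring.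
exact: sqr_ge0.
Qed.

End L2_of.

(** * Random measures with bounded expected energy *)

Section bounded_monotone.
Context d (T : measurableType d) (R : realType) (P : {measure set T -> \bar R}).
Variables (g : nat -> T -> \bar R) (C : R).
Local Open Scope ereal_scope.
Hypothesis mg : forall k, measurable_fun setT (g k).
Hypothesis g0 : forall k w, 0 <= g k w.
Hypothesis ndg : forall w, {homo (fun k => g k w) : m k / (m <= k)%N >-> m <= k}.
Hypothesis gC : forall k, \int[P]_w g k w <= C%:E.

Lemma measurable_lim_nondecreasing : measurable_fun setT (fun w => limn (g^~ w)).
Proof.
apply: (emeasurable_fun_cvg g) => // w _.
by apply: ereal_nondecreasing_is_cvgn; exact: ndg.
Qed.

Lemma integral_lim_le : \int[P]_w limn (g^~ w) <= C%:E.
Proof.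
rewrite monotone_convergence//.
apply: lime_le; last by apply: nearW => k; exact: gC.
apply: ereal_nondecreasing_is_cvgn => m k mk.
by apply: ge0_le_integral => // w _; exact: ndg.
Qed.

(** The limit has a finite integral by monotone convergence, hence it is finite almost everywhere
    and bounds the sequence. *)
Lemma ae_bounded_nondecreasing : {ae P, forall w, exists M : nat, forall k, g k w <= M%:R%:E}.
Proof.
have lim_ge k w : g k w <= limn (g^~ w).
  apply: lime_ge; first by apply: ereal_nondecreasing_is_cvgn; exact: ndg.
  by exists k => // j kj; exact: ndg.
have lim0 w : 0 <= limn (g^~ w) by apply: le_trans (lim_ge 0%N w).
have : P.-integrable setT (fun w => limn (g^~ w)).
  apply/integrableP; split; first exact: measurable_lim_nondecreasing.
  under eq_integral do rewrite gee0_abs//.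
  by apply: le_lt_trans integral_lim_le _; rewrite ltry.
move/(integrable_ae measurableT); apply: filterS => w /(_ I) fw.
exists (Num.truncn (fine (limn (g^~ w)))).+1 => k.
apply: le_trans (lim_ge k w) _; rewrite -(fineK fw) lee_fin; exact/ltW/truncnS_gt.
Qed.

End bounded_monotone.

Section image_measure.
Context d1 d2 (T1 : measurableType d1) (T2 : measurableType d2) (R : realType).
Variables (m : {finite_measure set T1 -> \bar R}) (f : T1 -> T2).

(* The measurability of f is an argument so that the instances below can be inferred. *)
Definition image_measure (mf : measurable_fun setT f) : set T2 -> \bar R := pushforward m f.

Variable mf : measurable_fun setT f.

HB.instance Definition _ := Measure.copy (image_measure mf)
  (measure_function_pushforward__canonical__measure_function_Measure m mf).

Let image_measure_finite : fin_num_fun (image_measure mf).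
Proof.
move=> A mA; apply: fin_num_measure.
by rewrite -[X in measurable X]setTI; apply: mf.
Qed.

HB.instance Definition _ := Measure_isFinite.Build _ _ _ (image_measure mf) image_measure_finite.

End image_measure.

Section random_measure.
Context dO (Om : measurableType dO) dS (S : measurableType dS) {R : realType} (n : nat).
Notation mu := (lebesgue_rV R n).
Variables (lam : {finite_measure set S -> \bar R}) (Y : Om * S -> 'rV[R]_n).
Hypothesis mY : measurable_fun setT Y.
Local Open Scope ereal_scope.

Lemma measurable_slice w : measurable_fun setT (fun s => Y (w, s)).
Proof. exact: measurableT_comp mY (measurable_pair1 w). Qed.

(** The image of [lam] under a slice of [Y]. With Lebesgue measure on the time interval and the path
    of the process, this is the occupation measure. *)
Definition random_measure w : {finite_measure set 'rV[R]_n -> \bar R} :=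
  image_measure lam (measurable_slice w).

Lemma random_measureE w A : random_measure w A = lam ((fun s => Y (w, s)) @^-1` A).
Proof. by []. Qed.

Lemma random_measureT w : random_measure w setT = lam setT.
Proof. by rewrite random_measureE preimage_setT. Qed.

Lemma integral_random_measure w (f : 'rV[R]_n -> \bar R) : measurable_fun setT f -> (forall y, 0 <= f y) ->
  \int[random_measure w]_y f y = \int[lam]_s f (Y (w, s)).
Proof.
move=> mf f0; rewrite (ge0_integral_pushforward (measurable_slice w))//.
Qed.

Local Notation U w t := (heat_conv (distr_of_measure (random_measure w)) t).

Lemma heat_conv_random_measure w t x : (0 < t)%R ->
  (U w t x)%:E = \int[lam]_s (heat_kernel t (x - Y (w, s)))%:E.
Proof.
move=> t0; rewrite heat_convE// integral_random_measure//.
- exact: measurable_heat_kernelBl.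
- by move=> y; rewrite lee_fin heat_kernel_ge0.
Qed.

Lemma measurable_heat_conv_random_measure t : (0 < t)%R ->
  measurable_fun setT (fun p : Om * 'rV[R]_n => U p.1 t p.2).
Proof.
move=> t0; apply/measurable_EFinP.
rewrite (_ : _ \o _ = (fun p : Om * 'rV[R]_n => \int[lam]_s (heat_kernel t (p.2 - Y (p.1, s)))%:E)); last first.
  by apply/funext => p /=; rewrite heat_conv_random_measure.
apply: (measurable_integral_snd lam (fun (p : Om * 'rV[R]_n) s => (heat_kernel t (p.2 - Y (p.1, s)))%:E)).
  apply/measurable_EFinP; apply: measurable_heat_kernelB.
  - exact: (measurableT_comp measurable_snd measurable_fst).
  - apply: (measurableT_comp mY); apply/measurable_fun_pairP; split => /=.
    + exact: (measurableT_comp measurable_fst measurable_fst).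
    + exact: measurable_snd.
by move=> p s; rewrite lee_fin heat_kernel_ge0.
Qed.

Lemma energy_random_measure w t : (0 < t)%R ->
  (energy (random_measure w) t)%:E = \int[lam]_s \int[lam]_r (heat_kernel t (Y (w, s) - Y (w, r)))%:E.
Proof.
move=> t0; rewrite energyE// integral_random_measure.
- by apply: eq_integral => s _; rewrite heat_conv_random_measure.
- by apply/measurable_EFinP; exact: measurable_heat_conv.
- by move=> y; rewrite lee_fin heat_conv_ge0.
Qed.

Let measurable_pair_kernel t : measurable_fun setT
  (fun p : (Om * S) * S => (heat_kernel t (Y (p.1.1, p.1.2) - Y (p.1.1, p.2)))%:E).
Proof.
apply/measurable_EFinP; apply: measurable_heat_kernelB; apply: (measurableT_comp mY);
  apply/measurable_fun_pairP; split => /=.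
- exact: (measurableT_comp measurable_fst measurable_fst).
- exact: (measurableT_comp measurable_snd measurable_fst).
- exact: (measurableT_comp measurable_fst measurable_fst).
- exact: measurable_snd.
Qed.

Let kernel_ge0 t (x y : 'rV[R]_n) : 0 <= (heat_kernel t (x - y))%:E.
Proof. by rewrite lee_fin heat_kernel_ge0. Qed.

Lemma measurable_energy t : (0 < t)%R -> measurable_fun setT (fun w => energy (random_measure w) t).
Proof.
move=> t0; apply/measurable_EFinP.
rewrite (_ : _ \o _ = (fun w => \int[lam]_s \int[lam]_r (heat_kernel t (Y (w, s) - Y (w, r)))%:E)); last first.
  by apply/funext => w /=; rewrite energy_random_measure.
apply: (measurable_integral_snd lam (fun w s => \int[lam]_r (heat_kernel t (Y (w, s) - Y (w, r)))%:E)).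
  exact: (measurable_integral_snd lam (fun (p : Om * S) r => (heat_kernel t (Y (p.1, p.2) - Y (p.1, r)))%:E)).
by move=> w s; apply: integral_ge0.
Qed.

Lemma expectation_energy (P : probability Om R) t : (0 < t)%R ->
  \int[P]_w (energy (random_measure w) t)%:E =
  \int[lam]_s \int[lam]_r \int[P]_w (heat_kernel t (Y (w, s) - Y (w, r)))%:E.
Proof.
move=> t0; under eq_integral do rewrite energy_random_measure//.
rewrite (integral_swap P lam (fun w s => \int[lam]_r (heat_kernel t (Y (w, s) - Y (w, r)))%:E)); last 2 first.
- exact: (measurable_integral_snd lam (fun (p : Om * S) r => (heat_kernel t (Y (p.1, p.2) - Y (p.1, r)))%:E)).
- by move=> w s; apply: integral_ge0.
apply: eq_integral => s _.
apply: (integral_swap P lam (fun w r => (heat_kernel t (Y (w, s) - Y (w, r)))%:E)) => //.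
apply/measurable_EFinP; apply: measurable_heat_kernelB; apply: (measurableT_comp mY).
  apply/measurable_fun_pairP; split => /=; [exact: measurable_fst|exact: measurable_cst].
by apply/measurable_fun_pairP; split => /=; [exact: measurable_fst|exact: measurable_snd].
Qed.

Variable P : probability Om R.
Variable C : R.
Hypothesis energyC : forall t, (0 < t)%R -> \int[P]_w (energy (random_measure w) t)%:E <= C%:E.

Let h k : R := k.+1%:R^-1.
Let h0 k : (0 < h k)%R. Proof. by rewrite /h invr_gt0. Qed.
Let g k w := (energy (random_measure w) (h k))%:E.

Lemma nondecreasing_energy_seq w : {homo (fun k => g k w) : m k / (m <= k)%N >-> m <= k}.
Proof.
move=> m k mk; rewrite lee_fin; apply: energy_nonincreasing => //.
by rewrite /h lef_pV2 ?posrE// ler_nat.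
Qed.

Lemma measurable_energy_seq k : measurable_fun setT (g k).
Proof. by apply/measurable_EFinP; exact: measurable_energy. Qed.

Let g0 k w : 0 <= g k w.
Proof. by rewrite lee_fin energy_ge0. Qed.

(** Integer bounds and times [k.+1%:R^-1] make the event a countable combination of measurable ones;
    monotonicity of the energy covers the other times. *)
Definition bounded_energy : set Om :=
  [set w | exists M : nat, forall k, (energy (random_measure w) k.+1%:R^-1 <= M%:R)%R].

Lemma measurable_bounded_energy : measurable bounded_energy.
Proof.
rewrite (_ : bounded_energy = \bigcup_M \bigcap_k ((fun w => energy (random_measure w) (h k)) @^-1` `]-oo, M%:R])); last first.
  apply/seteqP; split => w.
  - by case=> M HM; exists M => // k _ /=; rewrite in_itv/=; exact: HM.
  - by case=> M _ HM; exists M => k; have := HM k I; rewrite /= in_itv.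
apply: bigcup_measurable => M _; apply: bigcap_measurable => // k _.
by rewrite -[X in measurable X]setTI; apply: measurable_energy.
Qed.

Lemma integral_lim_energy : \int[P]_w limn (fun k => (energy (random_measure w) k.+1%:R^-1)%:E) <= C%:E.
Proof.
exact: (integral_lim_le measurable_energy_seq g0 nondecreasing_energy_seq (fun k => energyC (h0 k))).
Qed.

Lemma ae_bounded_energy : {ae P, forall w, bounded_energy w}.
Proof.
have := ae_bounded_nondecreasing measurable_energy_seq g0 nondecreasing_energy_seq (fun k => energyC (h0 k)).
by apply: filterS => w [M HM]; exists M => k; rewrite -lee_fin; exact: HM.
Qed.

End random_measure.

Section density_field.
Context dO (Om : measurableType dO) dS (S : measurableType dS) {R : realType} (n : nat).
Notation mu := (lebesgue_rV R n).
Variables (lam : {finite_measure set S -> \bar R}) (Y : Om * S -> 'rV[R]_n).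
Hypothesis mY : measurable_fun setT Y.
Hypothesis lam0 : 0 < fine (lam setT).
Variables (P : probability Om R) (C : R).
Local Notation nu := (random_measure lam mY).
Hypothesis energyC : forall t, 0 < t -> (\int[P]_w (energy (nu w) t)%:E <= C%:E)%E.
Local Notation U w t := (heat_conv (distr_of_measure (nu w)) t).

Let h k : R := k.+1%:R^-1.
Let h0 k : 0 < h k. Proof. by rewrite /h invr_gt0. Qed.
Let h_small (de : R) : 0 < de -> exists N, forall k, (N <= k)%N -> h k <= de.
Proof.
move=> d0; have : \forall k \near \oo, (k.+1%:R^-1 : R) < de.
  by apply: (cvgr_lt (0 : R)) => //; exact: cvg_harmonic.
by case=> N _ HN; exists N => k Nk; apply: ltW; exact: HN.
Qed.

Definition is_density_limit w (L : L2 R n) (l : R) : Prop :=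
  [/\ forall x, 0 <= L x, sqint mu L = l%:E,
    forall e : R, 0 < e -> exists N, forall k, (N <= k)%N ->
      (sqint mu (fun x => U w (h k) x - L x)%R <= e%:E)%E,
    forall t : R, 0 < t -> energy (nu w) t <= l &
    forall e : R, 0 < e -> exists2 de : R, 0 < de &
      forall t : R, 0 < t -> t <= de -> l - e <= energy (nu w) t].

(** The value 0 off the event of bounded energy is prescribed because strong measurability is asked
    at every [w]. *)
Lemma density_field_exists : exists L : Om -> L2 R n, forall w,
  (bounded_energy lam mY w -> exists l, is_density_limit w (L w) l) /\ (~ bounded_energy lam mY w -> L w = 0).
Proof.
suff /choice[L HL] : forall w, exists L : L2 R n,
    (bounded_energy lam mY w -> exists l, is_density_limit w L l) /\ (~ bounded_energy lam mY w -> L = 0).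
  by exists L.
move=> w; have [[M bM]|bw] := pselect (bounded_energy lam mY w); last by exists 0; split.
have [L [l [mL L0 Ll cvgL [el ll]]]] := heat_conv_limit bM.
have LE : L2_of L = L :> (_ -> _) by apply: L2_ofE => //; rewrite Ll ltry.
by exists (L2_of L); split => [_|[]]; [exists l; split; rewrite ?LE|exists M].
Qed.

Variable L : Om -> L2 R n.
Hypothesis Lspec : forall w,
  (bounded_energy lam mY w -> exists l, is_density_limit w (L w) l) /\ (~ bounded_energy lam mY w -> L w = 0).

Lemma density_limit_energy w l : is_density_limit w (L w) l ->
  (energy (nu w) (h k))%:E @[k --> \oo] --> l%:E.
Proof.
move=> [_ _ _ el ll]; apply: cvg_EFin; first exact: nearW.
apply/cvgrPdist_le => e e0; have [de d0 led] := ll e e0.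
have [N HN] := h_small d0; exists N => // k Nk /=.
apply: ler_dist_between; [exact: ltW|by apply: led => //; exact: HN|exact: el].
Qed.

(** On the event of bounded energy the distance to [L w] is the limit of the distances to the
    smoothings, which are jointly measurable in [w] and [x]; elsewhere [L w] is 0. *)
Lemma measurable_sqint_sub_density (f : 'rV[R]_n -> R) : measurable_fun setT f -> (sqint mu f < +oo)%E ->
  measurable_fun setT (fun w => sqint mu (fun x => f x - L w x)).
Proof.
move=> mf foo.
pose u k w := sqint mu (fun x => f x - U w (h k) x).
have mu_ k : measurable_fun setT (u k).
  apply: (measurable_integral_snd mu (fun w x => ((f x - U w (h k) x) ^+ 2)%:E)).
    apply/measurable_EFinP; apply: measurable_funX; apply: measurable_funB.
      exact: (measurableT_comp mf measurable_snd).
    exact: measurable_heat_conv_random_measure.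
  by move=> w x; rewrite lee_fin sqr_ge0.
have mb : measurable_fun setT (fun w => w \in bounded_energy lam mY).
  apply: (measurable_fun_bool true) => //; rewrite setTI.
  rewrite (_ : _ @^-1` _ = bounded_energy lam mY); first exact: measurable_bounded_energy.
  by apply/seteqP; split => w; [exact: set_mem|exact: mem_set].
(* The upper limit is measurable in [w] everywhere, while convergence is known on the event only. *)
rewrite (_ : (fun w => _) = (fun w => if w \in bounded_energy lam mY then limn_esup (u^~ w) else sqint mu f)).
  apply: measurable_fun_ifT => //.
  exact: measurable_fun_limn_esup.
apply/funext => w; case: ifPn => [|/negP]; rewrite in_setE => bw; last first.
  by rewrite (Lspec w).2//; apply: eq_integral => x _; rewrite subr0.
have [l [L0 Ll cvgL _ _]] := (Lspec w).1 bw.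
have mL : measurable_fun setT (L w) := measurable_L2 (L w).
have mU k : measurable_fun setT (U w (h k)) := measurable_heat_conv (nu w) (h k).
have fL : (sqint mu (fun x => f x - L w x)%R < +oo)%E.
  have := @sqint_triangle R n f (cst 0) (L w) mf (measurable_cst _) mL.
  move/le_lt_trans; apply; rewrite lte_add_pinfty// lte_mul_pinfty//.
    by rewrite (_ : (fun x => _) = f)//; apply/funext => x; rewrite subr0.
  by rewrite sqintN (_ : (fun x => _) = L w) ?Ll ?ltry//; apply/funext => x; rewrite subr0.
have c : u k w @[k --> \oo] --> sqint mu (fun x => f x - L w x)%R.
  apply: cvg_sqint => //.
  - by move=> k; exact: measurable_funB.
  - exact: measurable_funB.
  move=> e e0; have [N HN] := cvgL e e0; exists N => k Nk.
  rewrite (_ : sqint _ _ = sqint mu (fun x => U w (h k) x - L w x)); first exact: HN.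
  by rewrite sqintN; apply: eq_integral => x _; congr ((_ ^+ 2)%:E); ring.
by rewrite (is_cvg_limn_esupE _); [exact/esym/cvg_lim|apply/cvg_ex; eexists; exact: c].
Qed.

(** The sums of [kernel_sum_dense], enumerated by coding times and lists of rational points. One
    family serves all [w], because the total mass of the random measure is deterministic. *)
Definition approx_family (j : nat) : L2 R n :=
  if @unpickle (nat * seq 'rV[rat]_n)%type j is Some (k, s) then
    L2_of (fun x => fine (lam setT) / (size s)%:R * kernel_sum (h k) (map (fun q => map_mx ratr q) s) x)
  else 0.

Lemma approx_familyE k s : approx_family (pickle (k, s)) =
  (fun x => fine (lam setT) / (size s)%:R * kernel_sum (h k) (map (fun q => map_mx ratr q) s) x) :> (_ -> _).
Proof.
rewrite /approx_family pickleK; apply: L2_ofE.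
  by apply: measurable_funM => //; exact: measurable_kernel_sum.
rewrite /sqint; under eq_integral do rewrite exprMn EFinM.
rewrite ge0_integralZl_EFin ?sqr_ge0//; last 2 first.
- by move=> x _; rewrite lee_fin sqr_ge0.
- by apply/measurable_EFinP; apply: measurable_funX; exact: measurable_kernel_sum.
by rewrite -[X in (_ * X)%E]/(sqint mu _) sqint_kernel_sum// -EFinM ltry.
Qed.

Lemma strongly_measurable_density : strongly_measurable L.
Proof.
apply: (@strongly_measurable_of_dense _ _ _ _ _ approx_family).
  by move=> j; apply: measurable_sqint_sub_density; [exact: measurable_L2|exact: sqint_L2_lty].
move=> w e e0; have [bw|bw] := pselect (bounded_energy lam mY w); last first.
  (* The empty sum is the zero function, which is exactly [L w] here. *)
  exists (pickle (0%N, [::] : seq 'rV[rat]_n)); rewrite (Lspec w).2// approx_familyE.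
  rewrite /sqint integral0_eq ?lee_fin ?ltW// => x _.
  by rewrite /kernel_sum big_nil mulr0 subr0 expr0n.
have [l [L0 Ll cvgL _ _]] := (Lspec w).1 bw.
(* [sqint_triangle] doubles each of the two squared errors. *)
have e4 : 0 < e / 4 by rewrite divr_gt0.
have [N HN] := cvgL _ e4.
have c0 : 0 < fine (nu w setT) by rewrite random_measureT.
have [s Hs] := kernel_sum_dense (h0 N) c0 e4.
exists (pickle (N, s)); rewrite approx_familyE.
have mU : measurable_fun setT (U w (h N)) := measurable_heat_conv (nu w) (h N).
have mK : measurable_fun setT (fun x : 'rV[R]_n => fine (lam setT) / (size s)%:R * kernel_sum (h N) (map (fun q => map_mx ratr q) s) x).
  by apply: measurable_funM => //; exact: measurable_kernel_sum.
apply: le_trans (sqint_triangle mK mU (measurable_L2 (L w))) _.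
rewrite random_measureT in Hs.
have -> : (e%:E = 2%:E * (e / 4)%:E + 2%:E * (e / 4)%:E)%E.
  by rewrite -!EFinM -EFinD; congr EFin; field.
apply: leeD; rewrite lee_pmul2l//; last exact: HN.
by rewrite sqintN.
Qed.

(** The squared norm of [L w] is the limit of the energies, or 0 off the event, and the expectation
    of that limit is at most [C] by monotone convergence. *)
Lemma bochner_density : bochner_L2 P L.
Proof.
split; first exact: strongly_measurable_density.
have mL2 : measurable_fun setT (fun w => sqint mu (L w)).
  rewrite (_ : (fun w => _) = (fun w => sqint mu (fun x => cst 0 x - L w x))); last first.
    by apply/funext => w; rewrite sqintN; apply: eq_integral => x _; rewrite subr0.
  apply: measurable_sqint_sub_density => //.
  by rewrite /sqint integral0_eq// => x _; rewrite expr0n.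
under eq_integral do rewrite L2norm_sqr.
apply: le_lt_trans (ltry C); apply: le_trans (integral_lim_energy energyC).
have mlim := measurable_lim_nondecreasing (measurable_energy_seq lam mY) (nondecreasing_energy_seq lam mY).
have lim0 w : (0 <= limn (fun k => (energy (nu w) k.+1%:R^-1)%:E))%E.
  apply: lime_ge; last by apply: nearW => k; rewrite lee_fin energy_ge0.
  by apply: ereal_nondecreasing_is_cvgn; exact: nondecreasing_energy_seq.
apply: ge0_le_integral => //.
- by move=> w _; exact: sqint_ge0.
- move=> w _; have [bw|bw] := pselect (bounded_energy lam mY w); last first.
    by rewrite (Lspec w).2// /sqint integral0_eq ?lim0// => x _; rewrite expr0n.
  have [l Hl] := (Lspec w).1 bw; have [_ -> _ _ _] := Hl.
  by rewrite (cvg_lim _ (density_limit_energy Hl)).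
Qed.

Lemma density_field_spec : {ae P, forall w, (forall A : set 'rV[R]_n, measurable A ->
    nu w A = (\int[mu]_(x in A) (L w x)%:E)%E) /\
  ((alpha%:E * neg_sobolev_norm alpha (distr_of_measure (nu w)) ^+ 2)%E
         @[alpha --> (0 : R)^'+] --> (L2norm (L w) ^+ 2)%E)}.
Proof.
apply: filterS (ae_bounded_energy energyC) => w bw.
have [l [L0 Ll cvgL el ll]] := (Lspec w).1 bw.
have nuL A : measurable A -> nu w A = (\int[mu]_(x in A) (L w x)%:E)%E.
  exact: (measure_eq_density (measurable_L2 (L w)) L0 Ll cvgL).
by split => //; rewrite L2norm_sqr Ll; exact: (abel_limit (measurable_L2 (L w)) L0 Ll nuL el ll).
Qed.

End density_field.

(** * Fractional Brownian motion *)

Section gaussian_moments.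
Context d {Omega : measurableType d} {R : realType} (P : probability Omega R).
Notation leb := (@lebesgue_measure R).
Implicit Types V : Omega -> R.

(** The law is transported to the line, where it is a Dirac mass for [s = 0] and otherwise has
    density the heat kernel of time [s ^+ 2 / 2]. *)
Lemma ge0_expectation_gaussian V (m s : R) (f : R -> \bar R) : measurable_fun setT V -> 0 <= s ->
  (forall A : set R, measurable A -> P (V @^-1` A) = gaussian_law m s A) ->
  measurable_fun setT f -> (forall x, (0 <= f x)%E) ->
  (\int[P]_w f (V w) = if (s == 0)%R then f m else \int[leb]_x (f x * (gk (s ^+ 2 / 2) (x - m))%:E))%E.
Proof.
move=> mV s0 PV mf f0.
have -> : (\int[P]_w f (V w) = \int[pushforward P (V : _ -> measurableTypeR R)]_x f x)%E.
  by rewrite ge0_integral_pushforward.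
case: ifPn => s_0.
  rewrite (eq_measure_integral (\d_(m : measurableTypeR R) : {measure set (measurableTypeR R) -> \bar R})); last first.
    move=> A mA _; transitivity (gaussian_law m s A); first exact: PV.
    by rewrite /gaussian_law s_0.
  by rewrite integral_dirac// diracT mul1e.
rewrite (eq_measure_integral (normal_prob m s)); last first.
  move=> A mA _; transitivity (gaussian_law m s A); first exact: PV.
  by rewrite /gaussian_law (negbTE s_0).
have s_gt0 : 0 < s by rewrite lt0r s_0.
rewrite (@ge0_integral_density _ _ _ leb _ (normal_pdf m s))//.
- apply: eq_integral => x _; rewrite gk_normal_pdf ?divr_gt0 ?exprn_gt0//.
  by rewrite mulrCA divff// mulr1 sqrtr_sqr ger0_norm.
- exact: measurable_normal_pdf.
- by move=> x; exact: normal_pdf_ge0.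
Qed.

Lemma gk_integral_sqr (t m a : R) : 0 < t ->
  (\int[leb]_x ((x - a) ^+ 2 * gk t (x - m))%:E = ((m - a) ^+ 2 + 2 * t)%:E)%E.
Proof.
move=> t0.
have i0 : leb.-integrable setT (EFin \o (fun x => gk t (x - m))) := integrable_gk m t0.
have i1 : leb.-integrable setT (EFin \o (fun x => x * gk t (x - m))).
  apply: (@integrable_le_gk _ t m (1 + `|m|)) => // x.
  have h : `|x| <= `|m| + `|x - m| by rewrite -{1}(subrKC m x) ler_normD.
  have := normr_ge0 m; rewrite -(real_normK (num_real (x - m))); move: h.
  move: `|x - m| `|m| `|x| => u b c h b0.
  have := mulr_ge0 b0 (sqr_ge0 u); have := sqr_ge0 (u - 1); have := sqr_ge0 u; nra.
have i2 : leb.-integrable setT (EFin \o (fun x => (x - m) ^+ 2 * gk t (x - m))).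
  apply: (@integrable_le_gk _ t m 1) => //; first by apply: measurable_funX; exact: measurable_funB.
  by move=> x; rewrite ger0_norm ?sqr_ge0// mul1r lerDr.
have j1 : leb.-integrable setT (EFin \o (fun x => 2 * (m - a) * (x * gk t (x - m)))).
  by have := integrableZl measurableT (2 * (m - a)) i1; apply: eq_integrable => // x _ /=; rewrite EFinM.
have j0 : leb.-integrable setT (EFin \o (fun x => (a ^+ 2 - m ^+ 2) * gk t (x - m))).
  by have := integrableZl measurableT (a ^+ 2 - m ^+ 2) i0; apply: eq_integrable => // x _ /=; rewrite EFinM.
have j10 : leb.-integrable setT (EFin \o (fun x => 2 * (m - a) * (x * gk t (x - m)) + (a ^+ 2 - m ^+ 2) * gk t (x - m))).
  by have := integrableD measurableT j1 j0; apply: eq_integrable => // x _ /=; rewrite EFinD.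
(* Expansion around [m], which leaves the moments of orders 2, 1 and 0 already computed. *)
have E x : (x - a) ^+ 2 * gk t (x - m) = (x - m) ^+ 2 * gk t (x - m) +
    (2 * (m - a) * (x * gk t (x - m)) + (a ^+ 2 - m ^+ 2) * gk t (x - m)) by ring.
under eq_integral do rewrite E EFinD.
rewrite (integralD_EFin measurableT i2 j10) (integralD_EFin measurableT j1 j0).
have fn f : leb.-integrable setT (EFin \o f) -> (\int[leb]_x (EFin \o f) x = (\int[leb]_x f x)%R%:E)%E.
  by move=> fi; rewrite /Rintegral fineK//; exact: integrable_fin_num.
rewrite !fn// RintegralZl// RintegralZl// gk_integral_linear// gk_integral_quadratic//.
rewrite (_ : \int[leb]_x gk t (x - m) = 1); last by rewrite /Rintegral integral_gk.
rewrite -!EFinD; congr EFin; ring.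
Qed.

Lemma gaussian_rv_sqr V : gaussian_rv P V -> exists m s : R, [/\ 0 <= s,
  (forall A : set R, measurable A -> P (V @^-1` A) = gaussian_law m s A) &
  forall a, (\int[P]_w ((V w - a) ^+ 2)%:E = ((m - a) ^+ 2 + s ^+ 2)%:E)%E].
Proof.
move=> [mV [m [s [s0 PV]]]]; exists m, s; split => // a.
rewrite (@ge0_expectation_gaussian V m s (fun x => ((x - a) ^+ 2)%:E))//; last 2 first.
- by apply/measurable_EFinP; apply: measurable_funX; exact: measurable_funB.
- by move=> x; rewrite lee_fin sqr_ge0.
case: eqVneq => [->|s_0]; first by rewrite expr0n addr0.
have s_gt0 : 0 < s by rewrite lt0r s_0.
under eq_integral do rewrite -EFinM.
rewrite gk_integral_sqr ?divr_gt0 ?exprn_gt0//.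
by rewrite mulrCA divff// mulr1.
Qed.

Lemma gaussian_rv_Lfun2 V : gaussian_rv P V -> V \in Lfun P 2%:E.
Proof.
move=> gV; have [mV _] := gV; have [m [s [_ _ V2]]] := gaussian_rv_sqr gV.
apply/andP; split; first by rewrite inE.
rewrite inE; apply: sqint_finite_norm; rewrite /sqint.
rewrite (_ : (\int[P]_w (V w ^+ 2)%:E)%E = ((m - 0) ^+ 2 + s ^+ 2)%:E) ?ltry// -V2.
by apply: eq_integral => w _; rewrite subr0.
Qed.

(* Comparing the second moments about 0 and about 1 shows that the parameter m of the law vanishes. *)
Lemma centered_gaussian_rv_cos V (v : R) : gaussian_rv P V ->
  (\int[P]_w (V w)%:E = 0)%E -> (\int[P]_w (V w ^+ 2)%:E = v%:E)%E ->
  (\int[P]_w (1 + cos (V w))%:E = (1 + expR (- (v / 2)))%:E)%E.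
Proof.
move=> gV V0 Vv; have [mV _] := gV; have [m [s [s0 PV V2]]] := gaussian_rv_sqr gV.
have iV2 : P.-integrable setT (EFin \o (fun w => V w ^+ 2)).
  by apply/Lfun1_integrable; exact: Lfun2_mul_Lfun1 (gaussian_rv_Lfun2 gV) (gaussian_rv_Lfun2 gV).
have iV : P.-integrable setT (EFin \o V).
  apply/Lfun1_integrable; apply: Lfun_subset12; last exact: gaussian_rv_Lfun2.
  exact: fin_num_measure.
have ms : m ^+ 2 + s ^+ 2 = v.
  have := V2 0; under eq_integral do rewrite subr0.
  by rewrite Vv subr0 => -[].
have ms1 : (m - 1) ^+ 2 + s ^+ 2 = v + 1.
  have := V2 1.
  have E w : (V w - 1) ^+ 2 = V w ^+ 2 + (- 2 * V w + 1) by ring.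
  under eq_integral do rewrite E EFinD.
  have j1 : P.-integrable setT (EFin \o (fun w => - 2 * V w)).
    by have := integrableZl measurableT (- 2) iV; apply: eq_integrable => // x _ /=; rewrite EFinM.
  have j0 : P.-integrable setT (EFin \o (fun=> 1)) by exact: finite_measure_integrable_cst.
  have j10 : P.-integrable setT (EFin \o (fun w => - 2 * V w + 1)).
    by have := integrableD measurableT j1 j0; apply: eq_integrable => // x _ /=; rewrite EFinD.
  rewrite (integralD_EFin measurableT iV2 j10) (integralD_EFin measurableT j1 j0).
  rewrite Vv (_ : (\int[P]_x (EFin \o (fun w => - 2 * V w)%R) x = 0)%E); last first.
    under eq_integral do rewrite /= EFinM.
    rewrite -[RHS](mule0 (- 2)%:E) -V0; exact: (integralZl measurableT iV).
  rewrite add0e (_ : (\int[P]_x (EFin \o (fun=> 1%R)) x = 1)%E); last first.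
    by rewrite -[RHS](@probability_setT _ _ _ P) -[RHS]mul1e -integral_cst.
  by rewrite -EFinD => -[].
have m0 : m = 0 by move: ms ms1; rewrite -(subrr v); nra.
have s2 : s ^+ 2 = v by rewrite -ms m0 expr0n add0r.
rewrite (@ge0_expectation_gaussian V m s (fun x => (1 + cos x)%:E))//; last first.
- apply/measurable_EFinP; apply: measurable_funD => //.
  by apply: continuous_measurable_fun; exact: continuous_cos.
rewrite m0; case: eqVneq => [s_0|s_0].
  by rewrite cos0 -s2 s_0 expr0n mul0r oppr0 expR0.
have s_gt0 : 0 < s by rewrite lt0r s_0.
have t0 : 0 < s ^+ 2 / 2 by rewrite divr_gt0 ?exprn_gt0.
have := gk_integral_1cos 1 0 t0.
rewrite expr1n mulr1 cos0 mulr1 s2 => <-.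
by apply: eq_integral => x _; rewrite subr0 mul1r addr0 EFinM.
Qed.

Lemma second_moment_sum (I : finType) (Z : I -> Omega -> R) (c : I -> R) (G : I -> I -> R) :
  (forall a, Z a \in Lfun P 2%:E) ->
  (forall a b, (\int[P]_w (Z a w * Z b w)%:E = (G a b)%:E)%E) ->
  (\int[P]_w ((\sum_a c a * Z a w) ^+ 2)%:E = (\sum_a \sum_b c a * c b * G a b)%:E)%E.
Proof.
move=> Z2 ZG.
have iZ a b : P.-integrable setT (EFin \o (fun w => Z a w * Z b w)).
  by apply/Lfun1_integrable; exact: Lfun2_mul_Lfun1.
have icZ a b : P.-integrable setT (fun w => (c a * c b * (Z a w * Z b w))%:E).
  by have := integrableZl measurableT (c a * c b) (iZ a b); apply: eq_integrable => // w _ /=; rewrite EFinM.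
under eq_integral.
  move=> w _; rewrite expr2 big_distrlr/= -sumEFin.
  under eq_bigr do rewrite -sumEFin.
  under eq_bigr do under eq_bigr do rewrite mulrACA.
  over.
rewrite integral_sum//; last first.
  by move=> a; apply: integrable_sum.
rewrite -sumEFin; apply: eq_bigr => a _.
rewrite integral_sum// -sumEFin; apply: eq_bigr => b _.
under eq_integral do rewrite EFinM.
rewrite [RHS]EFinM -(ZG a b); exact: (integralZl measurableT (iZ a b)).
Qed.

Lemma first_moment_sum (I : finType) (Z : I -> Omega -> R) (c : I -> R) :
  (forall a, P.-integrable setT (EFin \o Z a)) -> (forall a, (\int[P]_w (Z a w)%:E = 0)%E) ->
  (\int[P]_w (\sum_a c a * Z a w)%:E = 0)%E.
Proof.
move=> iZ Z0; under eq_integral do rewrite -sumEFin.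
rewrite integral_sum//; last first.
  by move=> a; have := integrableZl measurableT (c a) (iZ a); apply: eq_integrable => // w _ /=; rewrite EFinM.
rewrite big1// => a _; under eq_integral do rewrite EFinM.
rewrite -(mule0 (c a)%:E) -(Z0 a); exact: (integralZl measurableT (iZ a)).
Qed.

End gaussian_moments.

Section fbm_increments.
Context d {Omega : measurableType d} {R : realType} (P : probability Omega R).
Variables (n : nat) (H T : R) (B : R -> Omega -> 'rV[R]_n).
Hypotheses (H01 : 0 < H < 1) (fB : fbm P H T B).
Local Notation I0T := (`[0, T] : interval R).

Definition fbm_cov (s t : R) : R := (t `^ (2 * H) + s `^ (2 * H) - `|s - t| `^ (2 * H)) / 2.

(** A single coordinate is the linear combination with one time and one basis vector, hence
    Gaussian. *)
Lemma fbm_coord_Lfun2 t i : t \in I0T -> (fun w => B t w ord0 i) \in Lfun P 2%:E.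
Proof.
move=> tT; apply: gaussian_rv_Lfun2.
have := @fbm_gaussian _ _ _ _ _ _ _ _ fB 1 (fun=> t) (fun=> delta_mx ord0 i) (fun=> tT).
rewrite (_ : (fun w => _) = (fun w => B t w ord0 i))//.
apply/funext => w; rewrite big_ord1 (bigD1 i)//= mxE !eqxx mul1r big1 ?addr0// => j ji.
by rewrite mxE eqxx/= (negbTE ji) mul0r.
Qed.

Lemma fbm_coord_moment s t i j : s \in I0T -> t \in I0T ->
  (\int[P]_w (B s w ord0 i * B t w ord0 j)%:E = (fbm_cov s t * (i == j)%:R)%:E)%E.
Proof.
move=> sT tT; have := fbm_covariance fB i j tT sT.
rewrite covariance.unlock !(fbm_centered fB)//= expectation.unlock.
rewrite !mxE /fbm_cov => E.
rewrite -E; apply: eq_integral => w _; congr EFin.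
by transitivity ((B s w ord0 i - 0) * (B t w ord0 j - 0)); first rewrite !subr0.
Qed.

(** The variance of one coordinate of an increment: stationarity of the increments together with
    self-similarity. *)
Lemma fbm_cov_increment s r : 0 <= s -> 0 <= r ->
  fbm_cov s s - 2 * fbm_cov s r + fbm_cov r r = `|s - r| `^ (2 * H).
Proof.
move=> s0 r0; have H0 : 2 * H != 0 by case/andP: H01 => h _; rewrite mulf_neq0// gt_eqF.
rewrite /fbm_cov !subrr normr0 powR0//.
by move: (s `^ _) (r `^ _) (`|s - r| `^ _) => a b c; field.
Qed.

Lemma fbm_increment_cos s r (xi : 'rV[R]_n) : s \in I0T -> r \in I0T ->
  (\int[P]_w (1 + cos (dotp xi (B s w - B r w)))%:E =
   (1 + expR (- (`|s - r| `^ (2 * H) * euclid_norm xi ^+ 2 / 2)))%:E)%E.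
Proof.
move=> sT rT.
have s0 : 0 <= s by move: sT; rewrite in_itv/= => /andP[].
have r0 : 0 <= r by move: rT; rewrite in_itv/= => /andP[].
(* The increment is a linear combination over two times with coefficients [xi] and [- xi], indexed
   together with the coordinate by pairs. *)
pose t (j : 'I_2) := if j == ord0 then s else r.
pose a (j : 'I_2) := if j == ord0 then xi else - xi.
have tT j : t j \in I0T by rewrite /t; case: ifP.
pose c (p : 'I_2 * 'I_n) := a p.1 ord0 p.2.
pose Z (p : 'I_2 * 'I_n) w := B (t p.1) w ord0 p.2.
have VE w : \sum_p c p * Z p w = dotp xi (B s w - B r w).
  rewrite -(pair_bigA _ (fun j i => a j ord0 i * B (t j) w ord0 i))/= big_ord_recl big_ord1 /a /t/=.
  rewrite -big_split/=; apply: eq_bigr => i _; rewrite !mxE; ring.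
have gV : gaussian_rv P (fun w => dotp xi (B s w - B r w)).
  have := @fbm_gaussian _ _ _ _ _ _ _ _ fB 2 t a tT.
  rewrite (_ : (fun w => _) = (fun w => dotp xi (B s w - B r w)))//.
  by apply/funext => w; rewrite -VE -(pair_bigA _ (fun j i => a j ord0 i * B (t j) w ord0 i)).
have Z2 p : Z p \in Lfun P 2%:E by exact: fbm_coord_Lfun2.
have iZ p : P.-integrable setT (EFin \o Z p).
  by apply/Lfun1_integrable; apply: Lfun_subset12; [exact: fin_num_measure|exact: Z2].
apply: centered_gaussian_rv_cos => //.
  under eq_integral do rewrite -VE.
  apply: first_moment_sum => // p.
  by have := fbm_centered fB p.2 (tT p.1); rewrite expectation.unlock.
under eq_integral do rewrite -VE.
rewrite (@second_moment_sum _ _ _ P _ Z c (fun p q => fbm_cov (t p.1) (t q.1) * (p.2 == q.2)%:R))//; last first.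
  by move=> p q; exact: fbm_coord_moment.
congr EFin.
rewrite -(pair_bigA _ (fun j i => \sum_q c (j, i) * c q * (fbm_cov (t j) (t q.1) * (i == q.2)%:R)))/=.
rewrite sqr_euclid_norm -fbm_cov_increment// mulr_sumr big_ord_recl big_ord1 -big_split/=.
apply: eq_bigr => i _.
have Q j : \sum_q c (j, i) * c q * (fbm_cov (t j) (t q.1) * (i == q.2)%:R) =
    a j ord0 i * (xi ord0 i * fbm_cov (t j) s - xi ord0 i * fbm_cov (t j) r).
  rewrite -(pair_bigA _ (fun k l => c (j, i) * c (k, l) * (fbm_cov (t j) (t k) * (i == l)%:R)))/=.
  under eq_bigr.
    move=> k _; rewrite (bigD1 i)//= eqxx mulr1 big1 ?addr0; last first.
      by move=> l li; rewrite eq_sym (negbTE li) !mulr0.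
    over.
  rewrite big_ord_recl big_ord1 /c /a /t/= mxE; ring.
rewrite !Q /a /t/= !mxE.
have -> : fbm_cov r s = fbm_cov s r by rewrite /fbm_cov distrC (addrC (s `^ _)).
ring.
Qed.

End fbm_increments.

Section expected_heat_kernel.
Context d {Omega : measurableType d} {R : realType} (P : probability Omega R) (n : nat).
Notation mu := (lebesgue_rV R n).
Variables (X : Omega -> 'rV[R]_n) (v : R).
Hypotheses (mX : measurable_fun setT X) (v0 : 0 < v).
Hypothesis Xcos : forall xi, (\int[P]_w (1 + cos (dotp xi (X w)))%:E =
  (1 + expR (- (v * euclid_norm xi ^+ 2 / 2)))%:E)%E.

Lemma dotpC (x y : 'rV[R]_n) : dotp x y = dotp y x.
Proof. by apply: eq_bigr => i _; rewrite mulrC. Qed.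

Lemma heat_kernelV (t : R) (x : 'rV[R]_n) : 0 < t ->
  expR (- (euclid_norm x ^+ 2 / (4 * t))) = (4 * pi * t) `^ (n%:R / 2) * heat_kernel t x.
Proof.
move=> t0; have p0 : 0 < 4 * pi * t by rewrite !mulr_gt0// pi_gt0.
by rewrite /heat_kernel mulrA powRN divff ?mul1r// gt_eqF// powR_gt0.
Qed.

Lemma integral_heat_kernel0 (u : R) : 0 < u -> (\int[mu]_z (heat_kernel u z)%:E = 1)%E.
Proof.
move=> u0; rewrite -[RHS](integral_heat_kernel (0 : 'rV[R]_n) u0).
by apply: eq_integral => z _; rewrite subr0.
Qed.

(* Both sides plus 1 are the double integral of (1 + cos (dotp z (X w))) * heat_kernel u z. *)
Lemma expected_gaussian_duality (u : R) : 0 < u ->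
  (\int[P]_w (expR (- (u * euclid_norm (X w) ^+ 2)))%:E =
   \int[mu]_z (heat_kernel u z * expR (- (v * euclid_norm z ^+ 2 / 2)))%:E)%E.
Proof.
move=> u0.
have mnorm (f : R -> R) : measurable_fun setT f -> measurable_fun setT (fun z : 'rV[R]_n => f (euclid_norm z ^+ 2)).
  move=> mf; apply: (measurableT_comp mf).
  under eq_fun do rewrite sqr_euclid_norm.
  by apply: measurable_sum => i; apply: measurable_funX; exact: measurable_coordR.
have me k : measurable_fun setT (fun z : 'rV[R]_n => expR (- (k * euclid_norm z ^+ 2))).
  apply: (mnorm (fun x => expR (- (k * x)))); apply: (measurableT_comp (@measurable_expR R)).
  by apply: (measurableT_comp (@oppr_measurable R setT)); exact: measurable_funM.
have me2 : measurable_fun setT (fun z : 'rV[R]_n => expR (- (v * euclid_norm z ^+ 2 / 2))).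
  by under eq_fun do rewrite mulrAC; exact: me.
have mk : measurable_fun setT (heat_kernel u : 'rV[R]_n -> R) := measurable_heat_kernel u.
have H1 : (\int[P]_w (1 + expR (- (u * euclid_norm (X w) ^+ 2)))%:E =
   \int[mu]_z (heat_kernel u z * (1 + expR (- (v * euclid_norm z ^+ 2 / 2))))%:E)%E.
  transitivity (\int[P]_w \int[mu]_z ((1 + cos (dotp (X w) z)) * heat_kernel u z)%:E)%E.
    apply: eq_integral => w _; have := heat_kernel_integral_cos (X w) 0 u0.
    by rewrite cos0 mulr1 => <-; apply: eq_integral => z _; rewrite addr0.
  rewrite (integral_swap P mu (fun w z => ((1 + cos (dotp (X w) z)) * heat_kernel u z)%:E)); last 2 first.
  - apply/measurable_EFinP; apply: measurable_funM; last exact: (measurableT_comp mk measurable_snd).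
    apply: measurable_funD => //.
    apply: (measurableT_comp (@measurable_cosR R)); apply: measurable_dotp; last exact: measurable_snd.
    exact: (measurableT_comp mX measurable_fst).
  - by move=> w z; rewrite lee_fin mulr_ge0 ?cos1_ge0 ?heat_kernel_ge0.
  apply: eq_integral => z _; rewrite EFinM -Xcos -ge0_integralZl_EFin ?heat_kernel_ge0//.
  - by apply: eq_integral => w _; rewrite -EFinM mulrC dotpC.
  - apply/measurable_EFinP; apply: measurable_funD => //.
    apply: (measurableT_comp (@measurable_cosR R)); apply: measurable_dotp => //.
have L1 : (\int[P]_w (1 + expR (- (u * euclid_norm (X w) ^+ 2)))%:E =
    1 + \int[P]_w (expR (- (u * euclid_norm (X w) ^+ 2)))%:E)%E.
  under eq_integral do rewrite EFinD.
  rewrite ge0_integralD//; last by apply/measurable_EFinP; exact: (measurableT_comp (me u) mX).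
  congr (_ + _)%E.
  by rewrite -[RHS](@probability_setT _ _ _ P) -[RHS]mul1e -integral_cst.
have L2 : (\int[mu]_z (heat_kernel u z * (1 + expR (- (v * euclid_norm z ^+ 2 / 2))))%:E =
    1 + \int[mu]_z (heat_kernel u z * expR (- (v * euclid_norm z ^+ 2 / 2)))%:E)%E.
  under eq_integral do rewrite mulrDr mulr1 EFinD.
  rewrite ge0_integralD//; last 4 first.
  - by move=> z _; rewrite lee_fin heat_kernel_ge0.
  - exact/measurable_EFinP.
  - by move=> z _; rewrite lee_fin mulr_ge0 ?heat_kernel_ge0 ?expR_ge0.
  - by apply/measurable_EFinP; exact: measurable_funM.
  congr (_ + _)%E.
  exact: integral_heat_kernel0.
have := congr1 (fun x => x - 1)%E H1; rewrite L1 L2 !(addeC 1%E) !addeK//.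
Qed.

(** At [X] the kernel is a multiple of [expR (- (u * euclid_norm (X w) ^+ 2))]. By duality its mean
    is an integral of [heat_kernel u] against a Gaussian proportional to [heat_kernel q]; bounding
    the former by its maximum gives a bound uniform in [t]. *)
Lemma expected_heat_kernel_le (t : R) : 0 < t ->
  (\int[P]_w (heat_kernel t (X w))%:E <= ((2 * pi * v) `^ (- (n%:R / 2)))%:E)%E.
Proof.
move=> t0; pose u := (4 * t)^-1; pose q := (2 * v)^-1.
have u0 : 0 < u by rewrite invr_gt0 mulr_gt0.
have q0 : 0 < q by rewrite invr_gt0 mulr_gt0.
have pi0 : 0 < pi :> R := pi_gt0 R.
have mk w : measurable_fun setT (heat_kernel w : 'rV[R]_n -> R) := measurable_heat_kernel w.
pose A := (4 * pi * t) `^ (- (n%:R / 2)).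
pose A' := (4 * pi * u) `^ (- (n%:R / 2)) * (4 * pi * q) `^ (n%:R / 2).
have E1 : (\int[P]_w (heat_kernel t (X w))%:E = A%:E * \int[P]_w (expR (- (u * euclid_norm (X w) ^+ 2)))%:E)%E.
  rewrite -ge0_integralZl_EFin ?powR_ge0//.
  - apply: eq_integral => w _; rewrite -EFinM /heat_kernel -/A.
    by congr (A * expR (- _))%:E; exact: mulrC.
  - have -> : (fun w => (expR (- (u * euclid_norm (X w) ^+ 2)))%:E) =
      (fun w => ((4 * pi * t) `^ (n%:R / 2) * heat_kernel t (X w))%:E).
      by apply/funext => w; rewrite -heat_kernelV// /u mulrC.
    by apply/measurable_EFinP; apply: measurable_funM => //; exact: (measurableT_comp (mk t) mX).
rewrite E1 expected_gaussian_duality//.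
have E2 : (\int[mu]_z (heat_kernel u z * expR (- (v * euclid_norm z ^+ 2 / 2)))%:E <= A'%:E)%E.
  have -> : A'%:E = (A'%:E * \int[mu]_z (heat_kernel q z)%:E)%E.
    by rewrite integral_heat_kernel0// mule1.
  rewrite -ge0_integralZl_EFin//; last 3 first.
  - by move=> z _; rewrite lee_fin heat_kernel_ge0.
  - exact/measurable_EFinP.
  - by rewrite mulr_ge0 ?powR_ge0.
  have ez (z : 'rV[R]_n) : expR (- (v * euclid_norm z ^+ 2 / 2)) = (4 * pi * q) `^ (n%:R / 2) * heat_kernel q z.
    by rewrite -heat_kernelV//; congr (expR (- _)); rewrite /q; field; apply: lt0r_neq0.
  apply: ge0_le_integral => //.
  - by move=> z _; rewrite lee_fin mulr_ge0 ?heat_kernel_ge0 ?expR_ge0.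
  - apply/measurable_EFinP; apply: measurable_funM => //; under eq_fun do rewrite ez.
    exact: measurable_funM.
  - by apply: measurable_funeM; exact/measurable_EFinP.
  - move=> z _; rewrite -EFinM lee_fin ez /A' mulrA; apply: ler_wpM2r; first exact: heat_kernel_ge0.
    by apply: ler_wpM2r; [exact: powR_ge0|exact: heat_kernel_ub].
apply: le_trans (lee_wpmul2l _ E2) _; first by rewrite lee_fin powR_ge0.
rewrite -EFinM lee_fin /A /A'.
have p1 : 0 <= 4 * pi * t by rewrite !mulr_ge0// ltW.
have p2 : 0 <= 4 * pi * u by rewrite !mulr_ge0// ltW.
have p3 : 0 <= 4 * pi * q by rewrite !mulr_ge0// ltW.
have -> : (4 * pi * q) `^ (n%:R / 2) = ((4 * pi * q)^-1) `^ (- (n%:R / 2)).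
  by rewrite -[X in _ = X `^ _]powR_inv1// -powRrM mulN1r opprK.
rewrite mulrA -!powRM ?(mulr_ge0 p1 p2) ?p1 ?p2 ?invr_ge0 ?p3//.
(* Since [4 * t * u = 1] and [2 * v * q = 1], the time [t] cancels; [pi] is abstracted as a positive
   variable. *)
have gen (p : R) : 0 < p -> 4 * p * t * (4 * p * u) / (4 * p * q) = 2 * p * v.
  by move=> pp; rewrite /u /q; field; rewrite (lt0r_neq0 v0) (lt0r_neq0 t0) (lt0r_neq0 pp).
by rewrite gen.
Qed.

End expected_heat_kernel.

Section double_integral.
Context {R : realType}.
Notation leb := (@lebesgue_measure R).

Lemma measurable_dist_powR (s b : R) : measurable_fun setT (fun r : R => `|s - r| `^ b).
Proof.
apply: (measurableT_comp (measurable_powR b)).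
by apply: (measurableT_comp (@normr_measurable R setT)); exact: measurable_funB.
Qed.

Lemma integral_dist_powR_le (T a s : R) : 0 < a -> 0 < T -> 0 <= s <= T ->
  (\int[leb]_(r in `[0%R, T]) (`|s - r| `^ (a - 1))%:E <= (2 * (T `^ a / a))%:E)%E.
Proof.
move=> a0 T0 /andP[s0 sT].
pose f (r : R) := (`|s - r| `^ (a - 1))%:E.
have mf (D : set (measurableTypeR R)) : measurable_fun D f.
  by apply: measurable_funTS; apply/measurable_EFinP; exact: measurable_dist_powR.
have f0 r : (0 <= f r)%E by rewrite lee_fin powR_ge0.
pose A : set (measurableTypeR R) := `[(s - T)%R, s[%classic.
pose C : set (measurableTypeR R) := `]s, (s + T)%R]%classic.
have mA : measurable A by exact: measurable_itv.
have mC : measurable C by exact: measurable_itv.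
have m1 : measurable ([set s] : set (measurableTypeR R)) by exact: measurable_set1.
apply: (@le_trans _ _ (\int[leb]_(r in (A `|` C) `|` [set s]) f r)%E).
  apply: ge0_subset_integral => //; first by apply: measurableU => //; exact: measurableU.
  move=> r; rewrite /= in_itv/= => /andP[r0 rT].
  have [rs|sr|->] := ltgtP r s; [left; left|left; right|by right].
  - by rewrite /A /= in_itv/= rs andbT lerBlDr (le_trans sT)// lerDr.
  - by rewrite /C /= in_itv/= sr/= (le_trans rT)// lerDr.
rewrite ge0_integral_setU//; last 2 first.
- exact: measurableU.
- apply/disj_setPRL => r /= -> [|]; rewrite /A /C /= in_itv/= ltxx ?andbF//.
rewrite integral_set1 adde0 ge0_integral_setU//; last first.
  apply/disj_setPRL => r; rewrite /A /C /= !in_itv/= => /andP[sr _] /andP[_ rs].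
  by have := lt_trans sr rs; rewrite ltxx.
have -> : (\int[leb]_(r in A) f r = (T `^ a / a)%:E)%E.
  rewrite -(integral_powR_left s a0 T0); apply: eq_integral => r; rewrite inE /A /= in_itv/= => /andP[_ rs].
  by rewrite /f ger0_norm// subr_ge0 ltW.
have -> : (\int[leb]_(r in C) f r = (T `^ a / a)%:E)%E.
  rewrite -(integral_powR_right s a0 T0); apply: eq_integral => r; rewrite inE /C /= in_itv/= => /andP[sr _].
  by rewrite /f distrC ger0_norm// subr_ge0 ltW.
by rewrite -EFinD lee_fin; lra.
Qed.

(** The singularity on the diagonal is integrable since [a > 0]. The measure [m] is known through
    its integrals, which are those of Lebesgue measure on the time interval. *)
Lemma double_integral_le (m : {finite_measure set (measurableTypeR R) -> \bar R}) (T a K : R)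
    (F : R -> R -> \bar R) :
  (forall f : R -> \bar R, measurable_fun setT f -> (forall x, (0 <= f x)%E) ->
    (\int[m]_s f s = \int[leb]_(s in `[0%R, T]) f s)%E) ->
  0 < a -> 0 < T -> 0 <= K ->
  measurable_fun setT (fun p : measurableTypeR R * measurableTypeR R => F p.1 p.2) ->
  (forall s r, (0 <= F s r)%E) ->
  (forall s r, s \in `[0, T] -> r \in `[0, T] -> s != r -> (F s r <= (K * `|s - r| `^ (a - 1))%:E)%E) ->
  (\int[m]_s \int[m]_r F s r <= (T * (K * (2 * (T `^ a / a))))%:E)%E.
Proof.
move=> mleb a0 T0 K0 mF F0 FK.
have mFs s : measurable_fun setT (F s) by exact: (measurableT_comp mF (measurable_pair1 s)).
have mI : measurable_fun setT (fun s => \int[m]_r F s r)%E by exact: (measurable_integral_snd m F).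
have I0 s : (0 <= \int[m]_r F s r)%E by apply: integral_ge0.
pose D : set (measurableTypeR R) := `[0, T]%classic.
have mD : measurable D by exact: measurable_itv.
have inner s : D s -> (\int[m]_r F s r <= (K * (2 * (T `^ a / a)))%:E)%E.
  rewrite /D /= => sT; rewrite (mleb _ (mFs s) (F0 s)).
  apply: (@le_trans _ _ (\int[leb]_(r in D) (K * `|s - r| `^ (a - 1))%:E)%E).
    apply: ae_ge0_le_integral.
    - exact: mD.
    - by move=> r _.
    - by apply: measurable_funTS; exact: mFs.
    - by move=> r _; rewrite lee_fin mulr_ge0 ?powR_ge0.
    - by apply: measurable_funTS; apply/measurable_EFinP; apply: measurable_funM => //; exact: measurable_dist_powR.
    (* The bound on [F s] may fail at [r = s], a null set. *)
    - exists [set s]; split; [exact: measurable_set1|exact: lebesgue_measure_set1|].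
      move=> r /= /not_implyP[rT Frs]; apply: contrapT => /eqP rs; apply: Frs.
      by apply: FK => //; rewrite eq_sym.
  under eq_integral do rewrite EFinM.
  rewrite ge0_integralZl_EFin//; last first.
    by apply: measurable_funTS; apply/measurable_EFinP; exact: measurable_dist_powR.
  rewrite EFinM; apply: lee_wpmul2l; first by rewrite lee_fin.
  by apply: integral_dist_powR_le => //; move: sT; rewrite in_itv.
rewrite (mleb _ mI I0).
apply: (@le_trans _ _ (\int[leb]_(s in D) (K * (2 * (T `^ a / a)))%:E)%E).
  by apply: ge0_le_integral => //; exact: measurable_funTS.
rewrite integral_cst//= lebesgue_measure_itv/= lte_fin T0 -EFinD subr0.
by rewrite -EFinM mulrC.
Qed.

End double_integral.

Section eq_setfun.
Import HBNNSimple.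

(* The occupation measure is only a set function: it agrees with a measure on measurable sets. *)
Lemma eq_setfun_integral d (T : measurableType d) (R : realType) (m1 m2 : set T -> \bar R) (f : T -> \bar R) :
  (forall A, measurable A -> m1 A = m2 A) -> (\int[m1]_x f x = \int[m2]_x f x)%E.
Proof.
move=> m12.
have E (h : {nnsfun T >-> R}) : sintegral m1 h = sintegral m2 h.
  by rewrite /sintegral; apply: eq_fsbigr => r _; rewrite m12.
(* The integral is a difference of suprema of integrals of simple functions, which see the set
   function on measurable sets only. *)
rewrite /integral /=; congr (_ - _)%E; congr ereal_sup; apply/seteqP; split => _ [h Hh <-] /=;
  exists h => //; by rewrite E.
Qed.

End eq_setfun.

Lemma integral_mfrestr d (T : measurableType d) (R : realType) (mu : {measure set T -> \bar R}) (D : set T)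
    (mD : measurable D) (Doo : (mu D < +oo)%E) (f : T -> \bar R) : measurable_fun setT f ->
  (forall x, (0 <= f x)%E) -> (\int[mfrestr mD Doo]_x f x = \int[mu]_(x in D) f x)%E.
Proof.
move=> mf f0.
rewrite (@ge0_integral_density _ _ _ mu (mfrestr mD Doo) (\1_D))//.
- rewrite [RHS]integral_mkcond; apply: eq_integral => x _.
  by rewrite patchE indicE; case: ifP => _; rewrite ?mule1 ?mule0.
- by move=> A mA; rewrite integral_indic// setIC.
Qed.

(** * The occupation measure of fractional Brownian motion *)

Section occupation_density.
Context {R : realType} d (Omega : measurableType d) (P : probability Omega R).
Variables (n : nat) (T H : R) (B : R -> Omega -> 'rV[R]_n).
Hypotheses (T0 : 0 < T) (H01 : 0 < H < 1) (fB : fbm P H T B) (Hn : H * n%:R < 1).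
Notation leb := (@lebesgue_measure R).
Local Notation D := (`[0, T]%classic : set (measurableTypeR R)).

Let mD : measurable D. Proof. exact: measurable_itv. Qed.

Let lebDT : leb D = T%:E.
Proof. by rewrite lebesgue_measure_itv/= lte_fin T0 -EFinD subr0. Qed.

Let Doo : (leb D < +oo)%E. Proof. by rewrite lebDT ltry. Qed.

(** Lebesgue measure on the time interval, seen as a finite measure on the whole line so that the
    results on random measures apply. *)
Definition time_measure : {finite_measure set (measurableTypeR R) -> \bar R} := mfrestr mD Doo.

Lemma time_measureT : time_measure setT = T%:E.
Proof. by rewrite -lebDT /time_measure /= /mfrestr /mrestr setTI. Qed.

Lemma integral_time_measure (f : R -> \bar R) : measurable_fun setT f -> (forall x, (0 <= f x)%E) ->
  (\int[time_measure]_s f s = \int[leb]_(s in D) f s)%E.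
Proof. by move=> mf f0; apply: integral_mfrestr. Qed.

(** Outside the time interval nothing is known about [B]; the value 0 there gives joint
    measurability on the full product. *)
Definition extended_path (p : Omega * measurableTypeR R) : 'rV[R]_n :=
  if p.2 \in `[0, T] then B p.2 p.1 else 0.

Lemma measurable_extended_path : measurable_fun setT extended_path.
Proof.
apply/measurable_fun_coordP => i.
have mB : measurable_fun (setT `*` D) (fun p : Omega * measurableTypeR R => B p.2 p.1 ord0 i).
  exact: (measurableT_comp (measurable_coord i) (fbm_measurable fB)).
have mDD : measurable ([set: Omega] `*` D) by exact: measurableX.
have := (measurable_restrictT _ mDD).1 mB.
congr (measurable_fun _ _); apply/funext => p; rewrite patchE /extended_path.
have -> : (p \in [set: Omega] `*` D) = (p.2 \in `[0, T]).
  by apply/idP/idP => [/set_mem[_ h]|h]; [exact: h|apply/mem_set; split].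
by case: ifP => // _; rewrite mxE.
Qed.

Local Notation nu := (random_measure time_measure measurable_extended_path).

Lemma occupationE w A : measurable A -> occupation T B w A = nu w A.
Proof.
move=> mA; rewrite random_measureE /occupation.
transitivity (\int[leb]_(s in D) (\1_((fun s => extended_path (w, s)) @^-1` A) s)%:E)%E.
  apply: eq_integral => s; rewrite inE /= => sT.
  have -> : B s w = extended_path (w, s) by rewrite /extended_path /= sT.
  by [].
rewrite integral_indic//; last first.
  by rewrite -[X in measurable X]setTI; apply: measurable_slice => //; exact: measurable_extended_path.
Qed.

Lemma distr_of_occupation w : distr_of_measure (occupation T B w) = distr_of_measure (nu w).
Proof.
apply/funext => phi; congr fine; apply: eq_setfun_integral => A mA; exact: occupationE.
Qed.

(** [a - 1 = - H n] is the exponent of the singularity on the diagonal, and [a > 0] is exactly the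
    assumption [H * n%:R < 1]. *)
Let a := 1 - H * n%:R.
Let a0 : 0 < a. Proof. by rewrite subr_gt0. Qed.
Let K := (2 * pi) `^ (- (n%:R / 2)) : R.

(* For s = r and 0 < n the right-hand side is 0, since 0 `^ b = 0 for every nonzero b. *)
Lemma expected_heat_kernel_path t s r : 0 < t -> s \in `[0, T] -> r \in `[0, T] -> s != r ->
  (\int[P]_w (heat_kernel t (extended_path (w, s) - extended_path (w, r)))%:E <=
   (K * `|s - r| `^ (a - 1))%:E)%E.
Proof.
move=> t0 sT rT sr.
have sr0 : 0 < `|s - r| by rewrite normr_gt0 subr_eq0.
have v0 : 0 < `|s - r| `^ (2 * H) by rewrite powR_gt0.
have mX : measurable_fun setT (fun w => extended_path (w, s) - extended_path (w, r)).
  by apply: measurable_rVB; exact: (measurableT_comp measurable_extended_path (measurable_pair2 _)).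
rewrite /extended_path /= sT rT in mX *.
have := expected_heat_kernel_le mX v0 (fun xi => fbm_increment_cos H01 fB xi sT rT) t0.
move/le_trans; apply; rewrite lee_fin powRM ?mulr_ge0 ?pi_ge0 ?powR_ge0//.
rewrite -powRrM /K /a (_ : 2 * H * - (n%:R / 2) = 1 - H * n%:R - 1)//.
by field.
Qed.

Lemma expectation_energy_le t : 0 < t ->
  (\int[P]_w (energy (nu w) t)%:E <= (T * (K * (2 * (T `^ a / a))))%:E)%E.
Proof.
move=> t0; rewrite expectation_energy//.
pose F s r := (\int[P]_w (heat_kernel t (extended_path (w, s) - extended_path (w, r)))%:E)%E.
have F0 s r : (0 <= F s r)%E by apply: integral_ge0 => w _; rewrite lee_fin heat_kernel_ge0.
have mY := measurable_extended_path.
have mF : measurable_fun setT (fun p : measurableTypeR R * measurableTypeR R => F p.1 p.2).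
  apply: (measurable_integral_snd P (fun (p : measurableTypeR R * measurableTypeR R) w =>
    (heat_kernel t (extended_path (w, p.1) - extended_path (w, p.2)))%:E)).
    apply/measurable_EFinP; apply: measurable_heat_kernelB; apply: (measurableT_comp mY);
      apply/measurable_fun_pairP; split => /=.
    - exact: measurable_snd.
    - exact: (measurableT_comp measurable_fst measurable_fst).
    - exact: measurable_snd.
    - exact: (measurableT_comp measurable_snd measurable_fst).
  by move=> p w; rewrite lee_fin heat_kernel_ge0.
apply: (@double_integral_le _ time_measure T a K F) => //.
- by move=> f mf f0; exact: integral_time_measure.
- exact: powR_ge0.
- by move=> s r sT rT sr; exact: expected_heat_kernel_path.
Qed.

End occupation_density.

Theorem mainTheorem5 (R : realType) (d : measure_display)
    (Omega : measurableType d) (P : probability Omega R)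
    (n : nat) (T H : R) (B : R -> Omega -> 'rV[R]_n) :
  0 < T -> 0 < H < 1 -> fbm P H T B -> H * n%:R < 1 ->
  exists L : Omega -> L2 R n, [/\ bochner_L2 P L,
    {ae P, forall w, forall A : set 'rV[R]_n, measurable A ->
       occupation T B w A = (\int[lebesgue_rV R n]_(x in A) (L w x)%:E)%E} &
    {ae P, forall w,
       (alpha%:E *
          neg_sobolev_norm alpha (distr_of_measure (occupation T B w)) ^+ 2)%E
         @[alpha --> (0 : R)^'+] --> (L2norm (L w) ^+ 2)%E}].
Proof.
move=> T0 H01 fB Hn.
have mY := measurable_extended_path fB.
have lamT : fine (time_measure T0 setT) = T by rewrite time_measureT.
have lam0 : 0 < fine (time_measure T0 setT) by rewrite lamT.
have eC := expectation_energy_le T0 H01 fB Hn.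
have [L Lspec] := density_field_exists (time_measure T0) mY.
exists L; split.
- exact: (bochner_density lam0 eC Lspec).
- apply: filterS (density_field_spec eC Lspec) => w [nuL _] A mA.
  by rewrite (occupationE T0 fB w mA); exact: nuL.
- apply: filterS (density_field_spec eC Lspec) => w [_ lim].
  by rewrite (distr_of_occupation T0 fB).
Qed.
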